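(* Let $R$ be a ring, and let $I_1$ and $I_2$ be (two-sided) ideals of $R$ such that $I_1\cap I_2=0$. Then (1) $\mathrm{fin.dim}(R)\leq \mathrm{fin.dim}(R/I_1)+\mathrm{fin.dim}(R/I_2)+\max\{1,\mathrm{flat.dim}((R/I_2)_R)\}+1.$ (2) Suppose that $\mathrm{Tor}_i^R(I_2,I_1)=0$ for all $i\geq 0$. If the left $R$-module $R/I_1$ has a finite projective resolution by finitely generated projective modules, then (a) $\mathrm{fin.dim}(R/(I_1+I_2))\leq \mathrm{fin.dim}(R/I_1)+\mathrm{fin.dim}(R/I_2)+1$. (b) $\mathrm{fin.dim}(R/I_1)\leq \mathrm{fin.dim}(R)+\mathrm{fin.dim}(R/(I_1+I_2))+\max\{1,\mathrm{proj.dim}(_R(R/I_1))\}+3$.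
   Context: Rings are associative with identity. $\mathrm{fin.dim}(A)$ of a ring $A$ is the supremum of the projective dimensions of those left $A$-modules that have a finite projective resolution by finitely generated projective modules. $\mathrm{proj.dim}$ and $\mathrm{flat.dim}$ denote projective and flat dimension; $(R/I_2)_R$ is $R/I_2$ as a right $R$-module. Inequalities are in $\mathbb{N}\cup\{\infty\}$. *)

(* Defs.v *)
From HB Require Import structures.
From mathcomp Require Import all_boot all_order all_algebra.
From mathcomp Require Import boolp classical_sets functions cardinality fsbigop.
From mathcomp.multinomials Require Import freeg.

Set Implicit Arguments.
Unset Strict Implicit.
Unset Printing Implicit Defensive.

Import GRing.Theory.
Local Open Scope ring_scope.
Local Open Scope quotient_scope.

(* ------------------------------------------------------------------------ *)
(* N \cup {oo}, with inf set0 = oo and sup set0 = 0                          *)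

Inductive enat := Fin of nat | Infty.

Declare Scope enat_scope.
Delimit Scope enat_scope with EN.
Bind Scope enat_scope with enat.

Definition enat_add (x y : enat) : enat :=
  if x is Fin m then if y is Fin n then Fin (m + n) else Infty else Infty.

Definition enat_le (x y : enat) : Prop :=
  match x, y with
  | _, Infty => True
  | Infty, Fin _ => False
  | Fin m, Fin n => (m <= n)%N
  end.

Definition enat_max (x y : enat) : enat :=
  if x is Fin m then if y is Fin n then Fin (maxn m n) else Infty else Infty.

Notation "x + y" := (enat_add x y) : enat_scope.
Notation "x <= y" := (enat_le x y) : enat_scope.

Definition enat_inf (S : set nat) : enat :=
  match pselect (exists n, `[< S n >]) with
  | left exS => Fin (ex_minn exS)
  | right _ => Infty
  end.

Definition enat_sup (S : set enat) : enat :=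
  enat_inf [set n : nat | forall x, S x -> (x <= Fin n)%EN]%classic.

(* ------------------------------------------------------------------------ *)
(* Left R-modules are objects of [lmodType R]; right R-modules are objects   *)
(* of [lmodType R^c], where [R^c] is the opposite ring, so that the action   *)
(* m.r of r on m is written [(r : R^c) *: m].  Rings are [pzRingType]s: the  *)
(* zero ring is allowed, because R/I is zero when I = R.                     *)

Section QuotientModule.
Variables (R : pzRingType) (M : lmodType R) (U : submodClosed M).

(* [submodClosed] is stated over semirings and hence does not inherit from   *)
(* [zmodClosed], which the additive quotient requires.                       *)
Definition submod_zmod : {pred M} := U.
Fact submod_zmod_closed : zmod_closed submod_zmod.
Proof. exact: GRing.submod_closedB (submodClosedP U). Qed.
HB.instance Definition _ := GRing.isZmodClosed.Build M submod_zmod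
  submod_zmod_closed.

Definition quotmod : Type := {ideal_quot (submod_zmod : zmodClosed M)}.
HB.instance Definition _ := GRing.Zmodule.on quotmod.

Definition quotmod_pi (x : M) : quotmod :=
  \pi_{ideal_quot (submod_zmod : zmodClosed M)} x.
Definition quotmod_scale (a : R) (x : quotmod) : quotmod :=
  quotmod_pi (a *: repr x).

Lemma quotmod_pi_eq x y : quotmod_pi x = quotmod_pi y <-> x - y \in U.
Proof.
have := Quotient.idealrBE (submod_zmod : zmodClosed M) x y.
by rewrite -[_ \in _]/(x - y \in U) => ->; split=> /eqP.
Qed.

Lemma quotmod_piD : {morph quotmod_pi : x y / x + y}.
Proof. by move=> x y; rewrite /quotmod_pi !piE. Qed.

Lemma quotmod_reprK x : quotmod_pi (repr x) = x.
Proof. exact: reprK. Qed.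

Lemma quotmod_piZ a x : quotmod_pi (a *: x) = quotmod_scale a (quotmod_pi x).
Proof.
apply/quotmod_pi_eq; rewrite -scalerBr rpredZ //.
by apply/quotmod_pi_eq; rewrite quotmod_reprK.
Qed.

Lemma quotmod_scaleA a b x :
  quotmod_scale a (quotmod_scale b x) = quotmod_scale (a * b) x.
Proof. by rewrite -[x]quotmod_reprK -!quotmod_piZ scalerA. Qed.

Lemma quotmod_scale1 : left_id 1 quotmod_scale.
Proof. by move=> x; rewrite -[x]quotmod_reprK -quotmod_piZ scale1r. Qed.

Lemma quotmod_scaleDr : right_distributive quotmod_scale +%R.
Proof.
move=> a x y; rewrite -[x]quotmod_reprK -[y]quotmod_reprK.
by rewrite -quotmod_piD -!quotmod_piZ scalerDr quotmod_piD.
Qed.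

Lemma quotmod_scaleDl x : {morph quotmod_scale^~ x : a b / a + b}.
Proof.
by move=> a b; rewrite -[x]quotmod_reprK -!quotmod_piZ scalerDl quotmod_piD.
Qed.

HB.instance Definition _ := GRing.Zmodule_isLmodule.Build R quotmod
  quotmod_scaleA quotmod_scale1 quotmod_scaleDr quotmod_scaleDl.

End QuotientModule.

Section SubModule.
Variables (R : pzRingType) (M : lmodType R) (U : submodClosed M).

Definition submod : Type := {x : M | x \in U}.
HB.instance Definition _ := SubType.on submod.
HB.instance Definition _ := Choice.on submod.
HB.instance Definition _ := [SubChoice_isSubLmodule of submod by <:].

End SubModule.

(* ------------------------------------------------------------------------ *)
(* Two-sided ideals, possibly equal to R.  Membership is boolean, which is   *)
(* no restriction under the classical axioms of [boolp].                     *)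

Record ideal (R : pzRingType) := Ideal {
  ideal_mem :> {pred R};
  ideal0 : 0 \in ideal_mem;
  idealD : forall x y, x \in ideal_mem -> y \in ideal_mem -> x + y \in ideal_mem;
  idealMl : forall a x, x \in ideal_mem -> a * x \in ideal_mem;
  idealMr : forall a x, x \in ideal_mem -> x * a \in ideal_mem }.

Section Ideals.
Variable R : pzRingType.
Implicit Types I J : ideal R.

Definition ideal_add_mem I J : {pred R} :=
  [pred z | `[< exists x y, [/\ x \in I, y \in J & z = x + y] >]].

Lemma ideal_add0 I J : 0 \in ideal_add_mem I J.
Proof. by apply/asboolP; exists 0, 0; rewrite !ideal0 addr0. Qed.

Lemma ideal_addD I J z t : z \in ideal_add_mem I J -> t \in ideal_add_mem I J ->
  z + t \in ideal_add_mem I J.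
Proof.
move=> /asboolP[x [y [Ix Jy ->]]] /asboolP[x' [y' [Ix' Jy' ->]]].
by apply/asboolP; exists (x + x'), (y + y'); rewrite !idealD // addrACA.
Qed.

Lemma ideal_addMl I J a z :
  z \in ideal_add_mem I J -> a * z \in ideal_add_mem I J.
Proof.
move=> /asboolP[x [y [Ix Jy ->]]].
by apply/asboolP; exists (a * x), (a * y); rewrite !idealMl // mulrDr.
Qed.

Lemma ideal_addMr I J a z :
  z \in ideal_add_mem I J -> z * a \in ideal_add_mem I J.
Proof.
move=> /asboolP[x [y [Ix Jy ->]]].
by apply/asboolP; exists (x * a), (y * a); rewrite !idealMr // mulrDl.
Qed.

Definition ideal_add I J : ideal R :=
  Ideal (@ideal_add0 I J) (@ideal_addD I J) (@ideal_addMl I J)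
    (@ideal_addMr I J).

Lemma idealN I x : x \in I -> - x \in I.
Proof. by move=> Ix; rewrite -mulN1r idealMl. Qed.

Definition ideal_zmod I : {pred R} := I.
Fact ideal_zmod_closed I : zmod_closed (ideal_zmod I).
Proof.
by split=> [|x y Ix Iy]; [exact: ideal0 | exact: idealD Ix (idealN Iy)].
Qed.
HB.instance Definition _ I :=
  GRing.isZmodClosed.Build R (ideal_zmod I) (ideal_zmod_closed I).

Definition ideal_left I : {pred R^o} := I.
Fact ideal_left_closed I : subsemimod_closed (ideal_left I).
Proof.
split=> [|a x Ix]; last exact: (idealMl a Ix).
by split=> [|x y Ix Iy]; [exact: ideal0 | exact: idealD Ix Iy].
Qed.
HB.instance Definition _ I :=
  GRing.isSubmodClosed.Build R R^o (ideal_left I) (ideal_left_closed I).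

Definition ideal_right I : {pred (R^c)^o} := I.
Fact ideal_right_closed I : subsemimod_closed (ideal_right I).
Proof.
split=> [|a x Ix]; last exact: (idealMr (a : R) Ix).
by split=> [|x y Ix Iy]; [exact: ideal0 | exact: idealD Ix Iy].
Qed.
HB.instance Definition _ I :=
  GRing.isSubmodClosed.Build R^c (R^c)^o (ideal_right I) (ideal_right_closed I).

Definition ideal_lmod I : lmodType R := submod (ideal_left I).
Definition ideal_rmod I : lmodType R^c := submod (ideal_right I).
Definition quotient_lmod I : lmodType R := quotmod (ideal_left I).
Definition quotient_rmod I : lmodType R^c := quotmod (ideal_right I).

End Ideals.

Section QuotientRing.
Variables (R : pzRingType) (I : ideal R).

Definition quotring : Type := {ideal_quot (ideal_zmod I : zmodClosed R)}.
HB.instance Definition _ := GRing.Zmodule.on quotring.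

Definition quotring_pi (x : R) : quotring :=
  \pi_{ideal_quot (ideal_zmod I : zmodClosed R)} x.
Definition quotring_one : quotring := quotring_pi 1.
Definition quotring_mul (x y : quotring) : quotring :=
  quotring_pi (repr x * repr y).

Lemma quotring_pi_eq x y : quotring_pi x = quotring_pi y <-> x - y \in I.
Proof.
have := Quotient.idealrBE (ideal_zmod I : zmodClosed R) x y.
by rewrite -[_ \in _]/(x - y \in I) => ->; split=> /eqP.
Qed.

Lemma quotring_reprK x : quotring_pi (repr x) = x.
Proof. exact: reprK. Qed.

Lemma quotring_piD : {morph quotring_pi : x y / x + y}.
Proof. by move=> x y; rewrite /quotring_pi !piE. Qed.

Lemma quotring_piM x y :
  quotring_pi (x * y) = quotring_mul (quotring_pi x) (quotring_pi y).
Proof.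
have rI z : z - repr (quotring_pi z) \in I.
  by apply/quotring_pi_eq; rewrite quotring_reprK.
apply/quotring_pi_eq; set x' := repr _; set y' := repr _.
rewrite -(subrKA (x' * y)) -mulrBl -mulrBr.
by apply: idealD; [exact/idealMr/rI | exact/idealMl/rI].
Qed.

Fact quotring_mulA : associative quotring_mul.
Proof.
move=> x y z; rewrite -[x]quotring_reprK -[y]quotring_reprK.
by rewrite -[z]quotring_reprK -!quotring_piM mulrA.
Qed.

Fact quotring_mul1l : left_id quotring_one quotring_mul.
Proof. by move=> x; rewrite -[x]quotring_reprK -quotring_piM mul1r. Qed.

Fact quotring_mul1r : right_id quotring_one quotring_mul.
Proof. by move=> x; rewrite -[x]quotring_reprK -quotring_piM mulr1. Qed.

Fact quotring_mulDl : left_distributive quotring_mul +%R.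
Proof.
move=> x y z; rewrite -[x]quotring_reprK -[y]quotring_reprK.
rewrite -[z]quotring_reprK -quotring_piD -!quotring_piM mulrDl.
by rewrite quotring_piD.
Qed.

Fact quotring_mulDr : right_distributive quotring_mul +%R.
Proof.
move=> x y z; rewrite -[x]quotring_reprK -[y]quotring_reprK.
rewrite -[z]quotring_reprK -quotring_piD -!quotring_piM mulrDr.
by rewrite quotring_piD.
Qed.

HB.instance Definition _ := GRing.Zmodule_isPzRing.Build quotring
  quotring_mulA quotring_mul1l quotring_mul1r quotring_mulDl quotring_mulDr.

End QuotientRing.

(* ------------------------------------------------------------------------ *)
(* The abelian group M (x)_R N for a right module M and a left module N:     *)
(* the free abelian group on M * N modulo the subgroup [tensor_rel].         *)

Section Tensor.
Variables (R : pzRingType) (M : lmodType R^c) (N : lmodType R).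

Definition tensor_gen (m : M) (n : N) : {freeg (M * N)} := << (m, n) >>.

Inductive tensor_rel : {freeg (M * N)} -> Prop :=
| TensorDl m m' n :
    tensor_rel (tensor_gen (m + m') n - (tensor_gen m n + tensor_gen m' n))
| TensorDr m n n' :
    tensor_rel (tensor_gen m (n + n') - (tensor_gen m n + tensor_gen m n'))
| TensorA m (r : R) n :
    tensor_rel (tensor_gen ((r : R^c) *: m) n - tensor_gen m (r *: n))
| Tensor0 : tensor_rel 0
| TensorB x y : tensor_rel x -> tensor_rel y -> tensor_rel (x - y).

Definition tensor_pred : {pred {freeg (M * N)}} :=
  [pred x | `[< tensor_rel x >]].
Fact tensor_pred_closed : zmod_closed tensor_pred.
Proof.
split=> [|x y /asboolP rx /asboolP ry]; apply/asboolP; first exact: Tensor0.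
exact: TensorB.
Qed.
HB.instance Definition _ :=
  GRing.isZmodClosed.Build {freeg (M * N)} tensor_pred tensor_pred_closed.

Definition tensor : zmodType :=
  {ideal_quot (tensor_pred : zmodClosed {freeg (M * N)})}.

Definition tensor_pi (x : {freeg (M * N)}) : tensor :=
  \pi_{ideal_quot (tensor_pred : zmodClosed {freeg (M * N)})} x.

Lemma tensor_pi_eq x y : tensor_pi x = tensor_pi y <-> tensor_rel (x - y).
Proof.
have := Quotient.idealrBE (tensor_pred : zmodClosed {freeg (M * N)}) x y.
move=> xyE; split=> [/eqP|r]; last by apply/eqP; rewrite -xyE; apply/asboolP.
by rewrite -xyE => /asboolP.
Qed.

Lemma tensor_piB : {morph tensor_pi : x y / x - y}.
Proof. by move=> x y; rewrite /tensor_pi !piE. Qed.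

Lemma tensor_reprK x : tensor_pi (repr x) = x.
Proof. exact: reprK. Qed.

End Tensor.

Section TensorMap.
Variables (R : pzRingType) (M : lmodType R^c) (N N' : lmodType R).
Variable f : {linear N -> N'}.

Definition tensor_map_pre (x : {freeg (M * N)}) : {freeg (M * N')} :=
  fglift (fun mn : M * N => tensor_gen mn.1 (f mn.2)) x.

(* id_M (x) f                                                                *)
Definition tensor_map (x : tensor M N) : tensor M N' :=
  tensor_pi (tensor_map_pre (repr x)).

Lemma tensor_map_preB : {morph tensor_map_pre : x y / x - y}.
Proof. exact: lift_is_additive. Qed.
HB.instance Definition _ := GRing.isZmodMorphism.Build _ _ tensor_map_pre
  tensor_map_preB.

Lemma tensor_map_preU m n : tensor_map_pre (tensor_gen m n) = tensor_gen m (f n).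
Proof. by rewrite /tensor_map_pre liftU scale1r. Qed.

Lemma tensor_map_pre_rel x : tensor_rel x -> tensor_rel (tensor_map_pre x).
Proof.
elim=> [m m' n|m n n'|m r n||{}x y _ rx _ ry].
- by rewrite raddfB raddfD /= !tensor_map_preU; exact: TensorDl.
- by rewrite raddfB raddfD /= !tensor_map_preU linearD; exact: TensorDr.
- by rewrite raddfB /= !tensor_map_preU linearZ; exact: TensorA.
- by rewrite raddf0; exact: Tensor0.
- by rewrite raddfB; exact: TensorB.
Qed.

Lemma tensor_map_pi x : tensor_map (tensor_pi x) = tensor_pi (tensor_map_pre x).
Proof.
apply/tensor_pi_eq; rewrite -tensor_map_preB; apply: tensor_map_pre_rel.
by apply/tensor_pi_eq; rewrite tensor_reprK.
Qed.

Lemma tensor_map_is_zmod_morphism : zmod_morphism tensor_map.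
Proof.
move=> x y; rewrite -[x]tensor_reprK -[y]tensor_reprK.
by rewrite -tensor_piB !tensor_map_pi tensor_map_preB tensor_piB.
Qed.
HB.instance Definition _ := GRing.isZmodMorphism.Build _ _ tensor_map
  tensor_map_is_zmod_morphism.

End TensorMap.
Arguments tensor_map {R} M {N N'} f x.

Definition projective (R : pzRingType) (P : lmodType R) : Prop :=
  forall (M N : lmodType R) (g : {linear M -> N}) (f : {linear P -> N}),
    (forall y, exists x, g x = y) ->
    exists h : {linear P -> M}, forall x, g (h x) = f x.

Definition finitely_generated (R : pzRingType) (M : lmodType R) : Prop :=
  exists (n : nat) (e : 'I_n -> M),
    forall x, exists c : 'I_n -> R, x = \sum_(i < n) c i *: e i.

Definition flat (R : pzRingType) (M : lmodType R^c) : Prop :=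
  forall (N N' : lmodType R) (f : {linear N -> N'}),
    injective f -> injective (tensor_map M f).

(* An exact sequence ... -> P_2 -> P_1 -> P_0 -> M -> 0                       *)
Record resolution (R : pzRingType) (M : lmodType R) := Resolution {
  res_obj :> nat -> lmodType R;
  res_diff : forall i, {linear res_obj i.+1 -> res_obj i};
  res_aug : {linear res_obj 0 -> M};
  res_aug_surj : forall y, exists x, res_aug x = y;
  res_exact0 : forall x, res_aug x = 0 <-> exists y, res_diff 0 y = x;
  res_exactS : forall i x,
    res_diff i x = 0 <-> exists y, res_diff i.+1 y = x }.

Definition res_length_le (R : pzRingType) (M : lmodType R) (P : resolution M)
    (n : nat) : Prop :=
  forall i, (n < i)%N -> forall x : P i, x = 0.

(* The least length of a resolution of M by modules in the class C            *)
Definition res_dim (R : pzRingType) (C : lmodType R -> Prop) (M : lmodType R) :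
    enat :=
  enat_inf [set n | exists P : resolution M,
    (forall i, C (P i)) /\ res_length_le P n]%classic.

Definition proj_dim (R : pzRingType) (M : lmodType R) : enat :=
  res_dim (@projective R) M.

Definition flat_dim (R : pzRingType) (M : lmodType R^c) : enat :=
  res_dim (@flat R) M.

Definition has_finite_fgproj_res (R : pzRingType) (M : lmodType R) : Prop :=
  exists (P : resolution M) (n : nat),
    (forall i, projective (P i) /\ finitely_generated (P i)) /\
    res_length_le P n.

Definition fin_dim (R : pzRingType) : enat :=
  enat_sup [set d | exists M : lmodType R,
    has_finite_fgproj_res M /\ d = proj_dim M]%classic.

(* ------------------------------------------------------------------------ *)
(* The free module on a set X: finitely supported functions X -> R           *)

Section FreeModule.
Variables (R : pzRingType) (X : choiceType).

Definition free_pred : {pred X -> R^o} :=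
  [pred f : X -> R^o | `[< finite_set [set x | f x != 0]%classic >]].

Fact free_pred_closed : subsemimod_closed free_pred.
Proof.
split=> [|a f /asboolP ff]; last first.
  apply/asboolP; apply: sub_finite_set ff => x /=.
  by apply: contra_neq; rewrite scalrfctE => ->; rewrite scaler0.
split=> [|f g /asboolP ff /asboolP fg]; apply/asboolP.
  by apply: (sub_finite_set _ (@finite_set0 X)) => x /=; rewrite eqxx.
apply: (@sub_finite_set _ _
  ([set x | f x != 0] `|` [set x | g x != 0])%classic).
  move=> x /=; case: (eqVneq (f x) 0) => [fx0|fx0 _]; last by left.
  by rewrite addrfctE fx0 add0r; right.
by rewrite finite_setU.
Qed.
HB.instance Definition _ := GRing.isSubmodClosed.Build R (X -> R^o) free_pred
  free_pred_closed.

Definition freemod : lmodType R := submod free_pred.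

End FreeModule.

Section FreeLift.
Variables (R : pzRingType) (X : choiceType) (M : lmodType R) (v : X -> M).

(* the linear map R^(X) -> M sending the basis element x to v x               *)
Definition free_lift (f : freemod R X) : M :=
  \sum_(x \in [set: X]) (val f x : R) *: v x.

Lemma free_finite (f : freemod R X) : finite_set [set x | val f x != 0]%classic.
Proof. by case: f => f /= /asboolP. Qed.

Lemma free_liftE (f : freemod R X) (A : set X) : finite_set A ->
  ([set x | val f x != 0] `<=` A)%classic ->
  free_lift f = \sum_(x \in A) (val f x : R) *: v x.
Proof.
move=> finA fA; rewrite /free_lift; apply/esym/fsbig_widen => // x [_ nAx] /=.
have [->|fx] := eqVneq (val f x) 0; first by rewrite scale0r.
by case: nAx; apply: fA.
Qed.

Lemma free_lift_is_linear : linear free_lift.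
Proof.
move=> a f g.
pose A := ([set x | val f x != 0] `|` [set x | val g x != 0])%classic.
have finA : finite_set A by rewrite finite_setU; split; exact: free_finite.
rewrite (@free_liftE f A) ?(@free_liftE g A) //; last 2 first.
- by move=> x; right.
- by move=> x; left.
rewrite (@free_liftE _ A) //; last first.
  move=> x /=; rewrite /A /=; have [fx|fx _] := eqVneq (val f x) 0; last by left.
  move=> h; right; apply: contraNN h => /eqP gx.
  by rewrite addrfctE scalrfctE /= fx gx scaler0 addr0.
rewrite !fsbig_finite //= scaler_sumr -big_split /=; apply: eq_bigr => x _.
by rewrite scalerDl scalerA.
Qed.
HB.instance Definition _ := GRing.isLinear.Build R (freemod R X) M *:%R free_lift
  free_lift_is_linear.

End FreeLift.

Section FreeBasis.
Variables (R : pzRingType) (X : choiceType).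

Definition free_fun (x : X) : X -> R^o := fun y => if y == x then 1 else 0.
Fact free_fun_pred x : free_fun x \in @free_pred R X.
Proof.
apply/asboolP; apply: (sub_finite_set _ (finite_set1 x)) => y /=.
by rewrite /free_fun; case: (y =P x); rewrite ?eqxx.
Qed.

Definition free_basis (x : X) : freemod R X :=
  exist _ (free_fun x) (free_fun_pred x) : submod (@free_pred R X).

Lemma free_lift_basis (M : lmodType R) (v : X -> M) x :
  free_lift v (free_basis x) = v x.
Proof.
rewrite (@free_liftE _ _ _ _ _ [set x]%classic) ?fsbig_set1 /=.
- by rewrite /free_fun eqxx scale1r.
- exact: finite_set1.
- by move=> y; rewrite /= /free_fun; case: (y =P x); rewrite ?eqxx.
Qed.

Lemma free_lift_id (f : freemod R X) : free_lift free_basis f = f.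
Proof.
rewrite (free_liftE _ (free_finite f)) // fsbig_finite; last exact: free_finite.
apply: val_inj; rewrite raddf_sum /=; apply/funext => y; rewrite fct_sumE.
have [fy|fy] := eqVneq (val f y) 0.
  rewrite big1_seq ?fy // => x /andP[_]; rewrite in_fset_set; last exact: free_finite.
  rewrite inE /= scalrfctE /free_fun; case: (y =P x) => [<-|_]; first by rewrite fy eqxx.
  by rewrite scaler0.
rewrite (bigD1_seq y) ?finmap.fset_uniq //=; last first.
  by rewrite in_fset_set ?inE //; exact: free_finite.
rewrite big1 ?addr0 => [|x xy].
  by rewrite scalrfctE /free_fun eqxx /= [_ *: _]mulr1.
by rewrite scalrfctE /free_fun eq_sym (negPf xy) scaler0.
Qed.

Lemma free_linearE (M : lmodType R) (h : {linear freemod R X -> M}) f :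
  h f = free_lift (h \o free_basis) f.
Proof.
rewrite -{1}[f]free_lift_id !(free_liftE _ (free_finite f)) //.
rewrite !fsbig_finite ?linear_sum; try exact: free_finite.
by apply: eq_bigr => x _; rewrite linearZ.
Qed.

Lemma free_projective : projective (freemod R X).
Proof.
move=> M N g f gsurj; have [s sE] := choice (fun x => gsurj (f (free_basis x))).
exists (free_lift s) => x.
have -> : g (free_lift s x) = (g \o free_lift s) x by [].
rewrite [LHS]free_linearE [RHS]free_linearE.
by congr free_lift; apply/funext => y /=; rewrite free_lift_basis sE.
Qed.

End FreeBasis.

(* the linear map R^(M) -> M sending the basis element x to x                 *)
Definition free_eval (R : pzRingType) (M : lmodType R) :
    {linear freemod R M -> M} :=
  free_lift (fun x : M => x).

(* The standard free resolution of M: Z_0 = M, Z_(i+1) is the kernel of       *)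
(* R^(Z_i) -> Z_i, and the i-th term is R^(Z_i).                              *)
Section FreeResolution.
Variable R : pzRingType.

Definition free_ker (M : lmodType R) : {pred freemod R M} :=
  [pred f : freemod R M | free_eval _ f == 0].
Fact free_ker_closed (M : lmodType R) : subsemimod_closed (@free_ker M).
Proof.
split=> [|a f /eqP f0]; last by apply/eqP; rewrite linearZ /= f0 scaler0.
split=> [|f g /eqP f0 /eqP g0]; apply/eqP; first by rewrite linear0.
by rewrite linearD /= f0 g0 addr0.
Qed.
HB.instance Definition _ (M : lmodType R) := GRing.isSubmodClosed.Build R
  (freemod R M) (@free_ker M) (@free_ker_closed M).

Fixpoint syzygy (M : lmodType R) (i : nat) : lmodType R :=
  if i is j.+1 then submod (@free_ker (syzygy M j)) else M.

Definition free_diff (M : lmodType R) (i : nat)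
    (f : freemod R (syzygy M i.+1)) : freemod R (syzygy M i) :=
  \val (free_eval _ f : submod (@free_ker (syzygy M i))).

Lemma free_diff_is_linear M i : linear (@free_diff M i).
Proof. by move=> a f g; rewrite /free_diff linearP. Qed.
HB.instance Definition _ (M : lmodType R) i := GRing.isLinear.Build R
  (freemod R (syzygy M i.+1)) (freemod R (syzygy M i)) *:%R (@free_diff M i) (@free_diff_is_linear M i).

Lemma free_eval_surj (M : lmodType R) (x : M) : exists f, free_eval M f = x.
Proof. by exists (free_basis R x); rewrite /free_eval /= free_lift_basis. Qed.

Lemma free_exact0 (M : lmodType R) (f : freemod R M) :
  free_eval _ f = 0 <-> exists g, @free_diff M 0 g = f.
Proof.
split=> [f0|[g <-]]; last by apply/eqP; exact: (valP (free_eval _ g)).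
have kf : f \in @free_ker M by apply/eqP.
have [g gE] := free_eval_surj (exist _ f kf : submod (@free_ker M)).
by exists g; rewrite /free_diff gE.
Qed.

Lemma free_exactS (M : lmodType R) i (f : freemod R (syzygy M i.+1)) :
  free_diff f = 0 <-> exists g, @free_diff M i.+1 g = f.
Proof.
rewrite -(free_exact0 f); split=> [h|h]; last by rewrite /free_diff h.
by apply: val_inj; rewrite /= -/(free_diff f) h.
Qed.

Definition free_resolution (M : lmodType R) : resolution M :=
  @Resolution R M (fun i => freemod R (syzygy M i)) (fun i => @free_diff M i)
    (@free_eval R M) (@free_eval_surj M) (@free_exact0 M) (@free_exactS M).

Lemma free_resolution_projective (M : lmodType R) i :
  projective (free_resolution M i).
Proof. exact: free_projective. Qed.

End FreeResolution.

(* ------------------------------------------------------------------------ *)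
(* Tor_i^R(M, N) = H_i(M (x)_R P) for the standard free resolution P of N     *)

Section TensorHomology.
Variables (R : pzRingType) (M : lmodType R^c) (N : lmodType R).
Variables (P : resolution N) (i : nat).

Definition tensor_cycle_pred : {pred tensor M (P i)} :=
  match i return {pred tensor M (P i)} with
  | 0 => predT
  | j.+1 => [pred x | tensor_map M (res_diff P j) x == 0]
  end.
Fact tensor_cycle_closed : zmod_closed tensor_cycle_pred.
Proof.
rewrite /tensor_cycle_pred; case: i => [//|j]; split=> [|x y].
  by rewrite inE raddf0.
by rewrite !inE => /eqP x0 /eqP y0; rewrite raddfB /= x0 y0 subr0.
Qed.
HB.instance Definition _ := GRing.isZmodClosed.Build (tensor M (P i))
  tensor_cycle_pred tensor_cycle_closed.

Definition tensor_cycle : Type := {x : tensor M (P i) | x \in tensor_cycle_pred}.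
HB.instance Definition _ := SubType.on tensor_cycle.
HB.instance Definition _ := Choice.on tensor_cycle.
HB.instance Definition _ := [SubChoice_isSubZmodule of tensor_cycle by <:].

Definition tensor_bound_pred : {pred tensor_cycle} :=
  [pred x | `[< exists y, tensor_map M (res_diff P i) y = val x >]].
Fact tensor_bound_closed : zmod_closed tensor_bound_pred.
Proof.
split=> [|x y /asboolP[x' xE] /asboolP[y' yE]]; apply/asboolP.
  by exists 0; rewrite raddf0.
by exists (x' - y'); rewrite raddfB /= xE yE.
Qed.
HB.instance Definition _ := GRing.isZmodClosed.Build tensor_cycle
  tensor_bound_pred tensor_bound_closed.

Definition tensor_homology : zmodType :=
  {ideal_quot (tensor_bound_pred : zmodClosed tensor_cycle)}.

End TensorHomology.

Definition Tor (R : pzRingType) (i : nat) (M : lmodType R^c) (N : lmodType R) :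
    zmodType :=
  tensor_homology M (free_resolution N) i.

(* Main.v *)
Require Import Defs.
From mathcomp.multinomials Require Import freeg.
From HB Require Import structures.
From mathcomp Require Import all_boot all_order all_algebra.
From mathcomp Require Import boolp classical_sets functions cardinality fsbigop.

Set Implicit Arguments.
Unset Strict Implicit.
Unset Printing Implicit Defensive.

Import GRing.Theory.
Local Open Scope ring_scope.

(** Write S = R/I1, T = R/I2 and M = R/(I1 + I2), and note that I1 I2 and I2 I1
vanish.  All modules are R-modules, an R/J-module being an R-module annihilated
by J; syzygies are taken with respect to finitely generated projective covers
over the ring at hand, and pd, perf stand for bounds on the projective dimension
and for finite resolutions by finitely generated projectives.  The condition
Tor_i(R/I, X) = 0 for i > 0, called [torfree] below, only involves intersections
K /\ IN = IK for submodules K of N, and it makes X |-> X/IX exact along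
resolutions of X.

The bound for R.  Let X be perfect over R and f the flat dimension of T.  The
f-th syzygy of X is torfree for I2, so reducing it modulo I2 gives a perfect
T-module, and after fin.dim(T) more syzygies X/I2X is projective over T.  Such a
module is also torfree for I1 ([torfree_other_ideal]); hence after fin.dim(S) more
syzygies both reductions are projective.  Then X is projective: the two partial
splittings of a projective cover combine because I1 I2 = 0 ([proj_patch]).

From now on Tor_i(I2, I1) = 0 for all i and S is perfect over R, of projective
dimension p.  As I1 /\ I2 = 0, S is torfree for I2 ([S_torfree]).

The bound for S.  Let Y be perfect over S.  It is perfect over R, and its syzygy
of order fin.dim(R) over S has projective dimension at most p over R and is
torfree for I2; after fin.dim(M) more syzygies Y/I2Y is projective over M.  As Y
has a finite resolution by projective S-modules, Y/I2Y lifts stably to a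
projective S-module D with a map to Y that is an isomorphism modulo I2
([stable_lift]).  If F is a projective cover of Y over R, the pullback W of F and D
over Y satisfies W/I2W = F/I2F, so W is torfree for I1, and
0 -> W/I1W -> F/I1F + D -> Y -> 0 is exact; this bounds the projective dimension of
Y over S by p + 1 ([pd_of_lift]).

The bound for M.  Consider the category of R-linear maps V -> U from a T-module
to an S-module, that is, of modules over the triangular ring with diagonal S, T
and corner M.  An M-module X is an object X = X of it, and U/I2U gives a functor
back.  The object M = M is the quotient of T -> M by I1 -> 0, and the latter is
resolved by an explicit complex built from an R-resolution of I1 ([sigma_short]);
so X = X is perfect and acyclic for the functor back as soon as X is perfect
([diag_perf]).  In this category perfect objects have projective dimension at most
fin.dim(S) + fin.dim(T) + 1 ([pd_rep]), and the functor back carries the bound to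
X. *)

(** * Short exact sequences *)

(** Exact sequences and resolutions are needed both for modules and for maps
between modules over different quotients of R; this structure collects what the
diagram chases use.  Objects have additive groups of elements, and homomorphisms
are functions satisfying a predicate, so that preimages can be chosen freely and
shown to form a homomorphism afterwards, by [hom_mono]. *)
Record category := Category {
  ob :> Type;
  car : ob -> zmodType;
  hom : forall A B : ob, (car A -> car B) -> Prop;
  fin : ob -> Prop;
  homB : forall A B f, @hom A B f -> {morph f : x y / x - y};
  hom_id : forall A, @hom A A id;
  hom_comp : forall A B C f g, @hom A B f -> @hom B C g -> @hom A C (g \o f);
  hom_zero : forall A B, hom (fun _ : car A => 0 : car B);
  hom_sub : forall A B f g, @hom A B f -> @hom A B g ->
    hom (fun x : car A => f x - g x : car B);
  hom_mono : forall A B C (i : car B -> car C) (h : car A -> car B),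
    hom i -> injective i -> hom (i \o h) -> hom h;
  has_zero : exists Z : ob, forall x : car Z, x = 0;
  has_pullback : forall A B C (f : car A -> car C) (g : car B -> car C),
    hom f -> hom g ->
    exists (W : ob) (p : car W -> car A) (q : car W -> car B),
    [/\ hom p, hom q,
        forall a b, f a = g b <-> exists w, p w = a /\ q w = b,
        forall x y, p x = p y -> q x = q y -> x = y
      & forall D (h : car D -> car W), hom (p \o h) -> hom (q \o h) -> hom h];
  fin_zero : forall Z, (forall x : car Z, x = 0) -> fin Z;
  fin_surj : forall A B (f : car A -> car B),
    hom f -> (forall y, exists x, f x = y) -> fin A -> fin B;
  fin_ext : forall A B C (f : car A -> car B) (g : car B -> car C),
    hom f -> hom g -> (forall y, exists x, g x = y) ->
    (forall x, g x = 0 -> exists y, f y = x) -> fin A -> fin C -> fin B }.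

Arguments hom {c A B} f.
Arguments car {c} A.
Arguments fin {c} A.

Section ShortExact.
Variable C : category.
Implicit Types (A B K N P Q X Z W : C).

Definition surj A B (f : car A -> car B) := forall y, exists x, f x = y.

Definition ses K N X (i : car K -> car N) (g : car N -> car X) :=
  [/\ hom i, hom g, injective i, surj g & forall x, g x = 0 <-> exists k, i k = x].

Definition short K N X := exists i g, @ses K N X i g.

Definition retract A B := exists (i : car A -> car B) (r : car B -> car A),
  [/\ hom i, hom r & forall x, r (i x) = x].

Definition proj P := forall A B (g : car A -> car B) (f : car P -> car B),
  hom g -> surj g -> hom f -> exists2 h, hom h & forall x, g (h x) = f x.

Definition is_zero Z := forall x : car Z, x = 0.

Lemma hom_ext A B (f g : car A -> car B) : f =1 g -> hom f -> hom g.
Proof. by move=> /funext->. Qed.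

Lemma homf0 A B (f : car A -> car B) : hom f -> f 0 = 0.
Proof. by move=> hf; rewrite -{1}(subrr 0) (homB hf) subrr. Qed.

Lemma homN A B (f : car A -> car B) : hom f -> {morph f : x / - x}.
Proof. by move=> hf x; rewrite -(sub0r x) (homB hf) homf0 // sub0r. Qed.

Lemma homD A B (f : car A -> car B) : hom f -> {morph f : x y / x + y}.
Proof. by move=> hf x y; rewrite -[in LHS](opprK y) (homB hf) (homN hf) opprK. Qed.

Lemma hom_add A B (f g : car A -> car B) :
  hom f -> hom g -> hom (fun x => f x + g x).
Proof.
move=> hf hg; apply: hom_ext (hom_sub hf (hom_sub (hom_zero A B) hg)) => x /=.
by rewrite sub0r opprK.
Qed.

Lemma hom_inj A B (f : car A -> car B) :
  hom f -> (forall x, f x = 0 -> x = 0) -> injective f.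
Proof.
move=> hf f0 x y fxy; apply/eqP; rewrite -subr_eq0; apply/eqP/f0.
by rewrite (homB hf) fxy subrr.
Qed.

Lemma zero_proj Z : is_zero Z -> proj Z.
Proof.
move=> Z0 A B g f hg _ hf; exists (fun=> 0); first exact: hom_zero.
by move=> x; rewrite (Z0 x) !homf0.
Qed.

Lemma surj_comp A B N (f : car A -> car B) (g : car B -> car N) :
  surj f -> surj g -> surj (g \o f).
Proof. by move=> sf sg z; have [y <-] := sg z; have [x <-] := sf y; exists x. Qed.

Lemma ker_ses A B (g : car A -> car B) : hom g -> surj g ->
  exists K (i : car K -> car A), ses i g.
Proof.
move=> hg sg; have [Z Z0] := has_zero C.
have [K [i [q [hi hq iE ijoint _]]]] := has_pullback hg (hom_zero Z B).
exists K, i; split=> //.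
  by move=> x y xy; apply: ijoint => //; rewrite (Z0 (q x)) (Z0 (q y)).
move=> x; split=> [gx|[k <-]].
  by have [k [<- _]] : exists w, i w = x /\ q w = 0; [apply/iE | exists k].
by apply: (iffRL (iE (i k) (q k))); exists k.
Qed.

Lemma ker_short A B (g : car A -> car B) : hom g -> surj g ->
  exists K, short K A B.
Proof. by move=> hg sg; have [K [i s]] := ker_ses hg sg; exists K, i, g. Qed.

Lemma ses_lift K N X (i : car K -> car N) (g : car N -> car X) A
    (f : car A -> car N) : ses i g -> hom f -> (forall a, g (f a) = 0) ->
  exists2 h : car A -> car K, hom h & forall a, i (h a) = f a.
Proof.
move=> [hi hg ii sg ex] hf gf0.
have [h hE] := choice (fun a => iffLR (ex (f a)) (gf0 a)).
by exists h => //; apply: (hom_mono hi ii); apply: hom_ext hf => a /=; rewrite hE.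
Qed.

Lemma bij_retract A B (f : car A -> car B) :
  hom f -> injective f -> surj f -> retract A B /\ retract B A.
Proof.
move=> hf fi sf; have [g gE] := choice sf.
have hg : hom g by apply: (hom_mono hf fi); apply: hom_ext (hom_id B) => x /=.
by split; [exists f, g | exists g, f]; split=> // x; apply: fi.
Qed.

Lemma ses_split K N X (i : car K -> car N) (g : car N -> car X) :
  ses i g -> proj X -> exists s r, [/\ hom s, hom r, forall x, g (s x) = x,
    forall k, r (i k) = k & forall x, x = i (r x) + s (g x)].
Proof.
move=> S pX; have [hi hg ii sg ex] := S.
have [s hs sE] := pX _ _ g id hg sg (hom_id X).
have hd : hom (fun x => x - s (g x)) by exact: hom_sub (hom_id N) (hom_comp hg hs).
have [|r hr rE] := ses_lift S hd.
  by move=> x; rewrite (homB hg) sE subrr.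
exists s, r; split=> // [k|x]; last by rewrite rE subrK.
apply: ii; rewrite rE; have -> : g (i k) = 0 by apply/ex; exists k.
by rewrite homf0 // subr0.
Qed.

Lemma ses_retract K N X : short K N X -> proj X -> retract K N.
Proof.
move=> [i [g S]] pX; have [s [r [hs hr _ rE _]]] := ses_split S pX.
by exists i, r; split=> //; case: S.
Qed.

Lemma proj_retract A B : retract A B -> proj B -> proj A.
Proof.
move=> [i [r [hi hr ri]]] pB M N g f hg sg hf.
have [h hh hE] := pB _ _ g (f \o r) hg sg (hom_comp hr hf).
by exists (h \o i); [exact: hom_comp | move=> x; rewrite /= hE /= ri].
Qed.

Lemma proj_ext A B N : short A B N -> proj A -> proj N -> proj B.
Proof.
move=> [a [b S]] pA pN; have [hi hg _ _ _] := S.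
have [s [r [hs hr _ _ dec]]] := ses_split S pN.
move=> X Y g f hg' sg hf.
have [h1 hh1 h1E] := pA _ _ g (f \o a) hg' sg (hom_comp hi hf).
have [h2 hh2 h2E] := pN _ _ g (f \o s) hg' sg (hom_comp hs hf).
exists (fun x => h1 (r x) + h2 (b x)).
  exact: hom_add (hom_comp hr hh1) (hom_comp hg hh2).
by move=> x; rewrite (homD hg') h1E h2E /= -(homD hf) -dec.
Qed.

Lemma fin_retract A B : retract A B -> fin B -> fin A.
Proof.
move=> [i [r [hi hr ri]]]; apply: (fin_surj hr) => x.
by exists (i x).
Qed.

Lemma short_fin A B N : short A B N -> fin A -> fin N -> fin B.
Proof.
move=> [a [b [ha hb _ sb ex]]]; apply: (fin_ext ha hb sb) => x.
by move/ex.
Qed.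

Lemma short_zero A : exists2 Z, is_zero Z & short Z A A.
Proof.
have [Z Z0] := has_zero C; exists Z => //; exists (fun=> 0), id; split=> //.
- exact: hom_zero.
- exact: hom_id.
- by move=> x y _; rewrite (Z0 x) (Z0 y).
- by move=> x; exists x.
- by move=> x; split=> [->|[k <-]] //; exists 0.
Qed.

(** Schanuel's lemma before splitting: the pullback W of two maps onto N is an
extension in two ways. *)
Lemma pullback_ses A B N K P (a : car A -> car B) (b : car B -> car N)
    (k : car K -> car P) (p : car P -> car N) : ses a b -> ses k p ->
  exists W (u : car W -> car B) (v : car W -> car P) k' a',
  [/\ @ses K W B k' u, @ses A W P a' v, forall w, b (u w) = p (v w)
    & forall x y, b x = p y -> exists w, u w = x /\ v w = y].
Proof.
move=> [ha hb ai sb exb] [hk hp ki sp exp].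
have [W [u [v [hu hv uvE uvi lft]]]] := has_pullback hb hp.
exists W, u, v.
have bu w : b (u w) = p (v w) by apply/uvE; exists w.
have hk' x : exists w, u w = 0 /\ v w = k x.
  by apply/uvE; rewrite homf0 //; apply/esym/exp; exists x.
have ha' x : exists w, u w = a x /\ v w = 0.
  by apply/uvE; rewrite (homf0 hp); apply/exb; exists x.
have [k' k'E] := choice hk'; have [a' a'E] := choice ha'.
exists k', a'; split=> [||w|x y /uvE //]; last by [].
- split=> //.
  + apply: lft; first by apply: hom_ext (hom_zero _ _) => x /=; case: (k'E x).
    by apply: hom_ext hk => x /=; case: (k'E x).
  + by move=> x y xy; apply: ki; rewrite -(k'E x).2 xy (k'E y).2.
  + move=> y; have [z zE] := sp (b y).
    by have [w [<- _]] := iffLR (uvE y z) (esym zE); exists w.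
  + move=> x; split=> [ux|[z <-]]; last by case: (k'E z).
    have [z zE] : exists z, k z = v x by apply/exp; rewrite -bu ux homf0.
    by exists z; apply: uvi; [rewrite ux (k'E z).1 | rewrite (k'E z).2].
- split=> //.
  + apply: lft; last by apply: hom_ext (hom_zero _ _) => x /=; case: (a'E x).
    by apply: hom_ext ha => x /=; case: (a'E x).
  + by move=> x y xy; apply: ai; rewrite -(a'E x).1 xy (a'E y).1.
  + move=> y; have [z zE] := sb (p y).
    by have [w [_ <-]] := iffLR (uvE z y) zE; exists w.
  + move=> x; split=> [ux|[z <-]]; last by case: (a'E z).
    have [z zE] : exists z, a z = u x by apply/exb; rewrite bu ux homf0.
    by exists z; apply: uvi; [rewrite (a'E z).1 | rewrite ux (a'E z).2].
Qed.

Lemma pullback_short A B N K P : short A B N -> short K P N ->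
  exists W, short K W B /\ short A W P.
Proof.
move=> [a [b S]] [k [p T]].
have [W [u [v [k' [a' [S1 S2 _ _]]]]]] := pullback_ses S T.
by exists W; split; [exists k', u | exists a', v].
Qed.

Lemma has_prod A B : exists D (p : car D -> car A) (q : car D -> car B),
  [/\ [/\ hom p, hom q, surj p & surj q],
      exists (i : car A -> car D) (j : car B -> car D), [/\ hom i, hom j,
       (forall a, p (i a) = a /\ q (i a) = 0),
       (forall b, p (j b) = 0 /\ q (j b) = b) & ses i q],
      forall x y, p x = p y -> q x = q y -> x = y,
      forall N (f : car N -> car A) (g : car N -> car B), hom f -> hom g ->
        exists2 h, hom h & forall x, p (h x) = f x /\ q (h x) = g x
    & short A D B].
Proof.
have [Z Z0] := has_zero C.
have [D [p [q [hp hq pqE pqi lft]]]] :=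
  has_pullback (hom_zero A Z) (hom_zero B Z).
have ex a b : exists w, p w = a /\ q w = b by apply/pqE.
have univ N (f : car N -> car A) (g : car N -> car B) : hom f -> hom g ->
    exists2 h, hom h & forall x, p (h x) = f x /\ q (h x) = g x.
  move=> hf hg; have [h hE] := choice (fun x => ex (f x) (g x)).
  exists h => //; apply: lft.
    by apply: hom_ext hf => x /=; case: (hE x).
  by apply: hom_ext hg => x /=; case: (hE x).
have [i hi iE] := univ _ _ _ (hom_id A) (hom_zero A B).
have [j hj jE] := univ _ _ _ (hom_zero B A) (hom_id B).
have S : ses i q.
  split=> //.
  - by move=> x y xy; rewrite -(iE x).1 xy (iE y).1.
  - by move=> b; have [w [_ wE]] := ex 0 b; exists w.
  - move=> x; split=> [qx|[k <-]]; last by case: (iE k).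
    by exists (p x); apply: pqi; [case: (iE (p x)) | rewrite qx; case: (iE (p x))].
exists D, p, q; split=> //.
- split=> // [a|b]; first by have [w [wE _]] := ex a 0; exists w.
  by have [w [_ wE]] := ex 0 b; exists w.
- by exists i, j.
- by exists i, q.
Qed.

(** Composing a cover P of B with B -> N gives a cover of N, so a sequence
A -> B -> N gives rise to a sequence K -> K1 -> A of syzygies. *)
Lemma ker_comp_short A B N K P : short A B N -> short K P B ->
  exists K1, short K1 P N /\ short K K1 A.
Proof.
move=> [a [b S]] [k [p [hk hp ki sp exk]]].
have [ha hb ai sb exb] := S.
have [K1 [k1 S1]] := ker_ses (hom_comp hp hb) (surj_comp sp sb).
have [hk1 _ k1i _ ex1] := S1.
have [|u hu uE] := ses_lift S1 hk.
  by move=> x /=; have -> : p (k x) = 0 by [apply/exk; exists x]; rewrite homf0.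
have [|v hv vE] := ses_lift S (hom_comp hk1 hp).
  by move=> x; apply/(ex1 (k1 x)); exists x.
exists K1; split; first by exists k1, (b \o p).
exists u, v; split=> //.
- by move=> x y xy; apply: ki; rewrite -!uE xy.
- move=> y; have [x xE] := sp (a y).
  have [z zE] : exists z, k1 z = x by apply/ex1; rewrite /= xE; apply/exb; exists y.
  by exists z; apply: ai; rewrite vE /= zE.
- move=> x; split=> [vx|[z <-]].
    have [z zE] : exists z, k z = k1 x by apply/exk; rewrite -[LHS]vE vx homf0.
    by exists z; apply: k1i; rewrite uE.
  by apply: ai; rewrite vE /= uE homf0 //; apply/exk; exists z.
Qed.

(** A lift of PN -> N to B, together with PA -> A -> B, covers B. *)
Lemma horseshoe A B N KA PA KN PN : short A B N ->
  short KA PA A -> short KN PN N -> proj PN ->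
  exists KB PB, [/\ short KB PB B, short KA KB KN & short PA PB PN].
Proof.
move=> [a [b S]] [k [p S1]] [l [q S2]] pPN.
have [ha hb ai sb exb] := S; have [hk hp ki sp ex1] := S1.
have [hl hq li sq ex2] := S2.
have [t ht tE] := pPN _ _ b q hb sb hq.
have [D [d [e [[hd he sd se] [i [j [hi hj iE jE Si]]] dei univ _]]]] := has_prod PA PN.
pose f x := a (p (d x)) + t (e x).
have hf : hom f.
  exact: hom_add (hom_comp (hom_comp hd hp) ha) (hom_comp he ht).
have exab y : b (a y) = 0 by apply/exb; exists y.
have sf : surj f.
  move=> y; have [z zE] := sq (b y).
  have [x xE] : exists x, a x = y - t z.
    by apply/exb; rewrite (homB hb) tE zE subrr.
  have [w wE] := sp x; exists (i w + j z).
  rewrite /f (homD hd) (homD he) (iE w).1 (iE w).2 (jE z).1 (jE z).2.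
  by rewrite addr0 add0r wE xE subrK.
have [KB [m Sm]] := ker_ses hf sf; have [hm _ mi _ exm] := Sm.
exists KB, D; split; [by exists m, f| |by exists i, e].
have [|u hu uE] := ses_lift Sm (hom_comp hk hi).
  move=> x; rewrite /f /= (iE _).1 (iE _).2 (homf0 ht) addr0.
  by have -> : p (k x) = 0 by [apply/ex1; exists x]; rewrite homf0.
have [|v hv vE] := ses_lift S2 (hom_comp hm he).
  move=> x /=; rewrite -tE.
  have : f (m x) = 0 by apply/exm; exists x.
  by move/(congr1 b); rewrite (homD hb) exab add0r (homf0 hb).
exists u, v; split=> //.
- by move=> x y xy; apply: ki; rewrite -(iE (k x)).1 -(iE (k y)).1 -!/((i \o k) _) -!uE xy.
- move=> y; have /exb[z zE] : b (t (l y)) = 0 by rewrite tE; apply/ex2; exists y.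
  have [w wE] := sp (- z).
  have [x xE] : exists x, m x = i w + j (l y).
    apply/exm; rewrite /f (homD hd) (homD he) (iE w).1 (iE w).2 (jE _).1 (jE _).2.
    by rewrite addr0 add0r wE (homN ha) zE addNr.
  by exists x; apply: li; rewrite vE /= xE (homD he) (iE w).2 (jE _).2 add0r.
- move=> x; split=> [vx|[y <-]]; last first.
    by apply: li; rewrite vE /= uE /= (iE _).2 homf0.
  have e0 : e (m x) = 0 by rewrite -[LHS]vE vx homf0.
  have : f (m x) = 0 by apply/exm; exists x.
  rewrite /f e0 homf0 // addr0 => h0.
  have [y yE] : exists y, k y = d (m x) by apply/ex1/ai; rewrite h0 homf0.
  exists y; apply: mi; rewrite uE /=; apply: dei.
    by rewrite (iE _).1 yE.
  by rewrite (iE _).2 e0.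
Qed.

End ShortExact.
Arguments proj {C} P.

(** * Dimensions defined by resolutions *)

Section Dimension.
Variable C : category.
Implicit Types (A B K N P Q X Z W : C).

(** Length of resolutions with terms in Cc, whose last syzygy lies in Dc and
whose other syzygies lie in Tc.  The cases used are (any, proj, proj) for the
projective dimension, (any, fgp, fgp) for finite resolutions by finitely generated
projectives, (torfree1, proj, any) for vanishing of Tor up to a given degree,
(any, proj, torfree) for vanishing of Tor above it, and (any, flatk, flatk) for
the flat dimension. *)
Fixpoint gdim (Tc Cc Dc : C -> Prop) (n : nat) (X : C) : Prop :=
  if n is m.+1 then
    Tc X /\ exists K P, [/\ short K P X, Cc P & gdim Tc Cc Dc m K]
  else Dc X.

Definition ext_closed (D : C -> Prop) :=
  forall A B N, short A B N -> D A -> D N -> D B.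
Definition retract_closed (D : C -> Prop) :=
  forall A B, retract A B -> D B -> D A.

(** The closure properties under which the dimension does not depend on the
chosen resolution. *)
Record dim_theory (Tc Cc Dc : C -> Prop) : Prop := DimTheory {
  dt_proj : forall P, Cc P -> proj P;
  dt_Cext : ext_closed Cc;
  dt_Text : ext_closed Tc;
  dt_Tretract : retract_closed Tc;
  dt_Dext : ext_closed Dc;
  dt_Dretract : retract_closed Dc;
  dt_CT : forall P, Cc P -> Tc P;
  dt_CD : forall P, Cc P -> Dc P;
  dt_zero : forall Z, is_zero Z -> Cc Z }.

Section Theory.
Variables (Tc Cc Dc : C -> Prop).
Hypothesis dt : dim_theory Tc Cc Dc.
Let dim := gdim Tc Cc Dc.

Lemma gdimC n P : Cc P -> dim n P.
Proof.
elim: n P => [|n IH] P cP; first exact: dt_CD dt _ cP.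
split; first exact: dt_CT dt _ cP.
have [Z Z0 S] := short_zero P.
by exists Z, P; split=> //; apply: IH; apply: dt_zero dt _ Z0.
Qed.

Lemma gdim_ext n : ext_closed (dim n).
Proof.
elim: n => [|n IH] A B N S; first exact: dt_Dext dt _ _ _ S.
move=> [tA [KA [PA [SA cA dA]]]] [tN [KN [PN [SN cN dN]]]].
split; first exact: dt_Text dt _ _ _ S tA tN.
have [KB [PB [SB SK SP]]] := horseshoe S SA SN (dt_proj dt cN).
exists KB, PB; split=> //; last exact: IH SK dA dN.
exact: dt_Cext dt _ _ _ SP cA cN.
Qed.

(** In the pullback of two covers of X, which is an extension of P by K', the
kernel K is a retract.  The closure under retracts is a hypothesis because it is
proved by an induction that uses this lemma in lower dimension. *)
Lemma gdim_syz_of_retract n : retract_closed (dim n) ->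
  forall K P X, short K P X -> Cc P -> dim n.+1 X -> dim n K.
Proof.
move=> rn K P X S cP [_ [K' [P' [S' cP' dK']]]].
have [W [S1 S2]] := pullback_short S' S.
have dW : dim n W by apply: gdim_ext S2 dK' (gdimC n cP).
by apply: rn dW; apply: ses_retract S1 (dt_proj dt cP').
Qed.

(** If A + C = B, covers of A and C by the same P make up a cover of B.  The
kernel over A is a retract of its kernel, which has smaller dimension although
nothing is known about C. *)
Lemma gdim_retract n : retract_closed (dim n).
Proof.
elim: n => [|n IH] A B rAB; first exact: dt_Dretract dt _ _ rAB.
move=> dB; have [tB [K [P [S cP dK]]]] := dB.
split; first exact: dt_Tretract dt _ _ rAB tB.
have [i [r [hi hr ri]]] := rAB; have [k [p [hk hp ki sp exk]]] := S.
have sr : surj r by move=> x; exists (i x).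
have [KA [ka SA]] := ker_ses (hom_comp hp hr) (surj_comp sp sr).
exists KA, P; split=> //; first by exists ka, (r \o p).
have [D [d [e [[hd he sd se] [u [v [hu hv uE vE _]]] dei univ sD]]]] := has_prod P P.
(* the first copy of P covers A, the second one the complement of A *)
pose f x := i (r (p (d x))) + (p (e x) - i (r (p (e x)))).
have hirp : hom (fun x => i (r (p x))) by apply: hom_comp (hom_comp hp hr) hi.
have hf : hom f.
  apply: hom_add; first exact: (hom_comp hd hirp).
  exact: hom_comp he (hom_sub hp hirp).
have sf : surj f.
  move=> y; have [x xE] := sp y; exists (u x + v x); rewrite /f.
  rewrite (homD hd) (homD he) (uE x).1 (uE x).2 (vE x).1 (vE x).2 addr0 add0r.
  by rewrite xE addrC subrK.
have [J [j SJ]] := ker_ses hf sf; have [hj _ ji _ exj] := SJ.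
have cD : Cc D by exact: (dt_Cext dt sD cP cP).
have dJ : dim n J.
  by apply: (gdim_syz_of_retract IH) cD dB; exists j, f.
apply: IH dJ; have [hka _ kai _ exka] := SA.
have rpka x : r (p (ka x)) = 0 by apply/(exka (ka x)); exists x.
have [|s hs sE] := ses_lift SJ (hom_comp hka hu).
  move=> x; rewrite /f /= (uE _).1 (uE _).2 (homf0 hp) rpka.
  by rewrite (homf0 hr) (homf0 hi) subrr addr0.
have [|t ht tE] := ses_lift SA (hom_comp hj hd).
  move=> x /=; have : f (j x) = 0 by apply/exj; exists x.
  move/(congr1 r); rewrite /f (homD hr) (homB hr) !ri subrr addr0.
  by rewrite (homf0 hr).
exists s, t; split=> // x; apply: kai.
by rewrite tE /= sE /= (uE _).1.
Qed.

Lemma gdim_syz n K P X : short K P X -> Cc P -> dim n.+1 X -> dim n K.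
Proof. exact: (gdim_syz_of_retract (@gdim_retract n)). Qed.

(** The pullback of B and a cover of N is an extension of B by a syzygy of N,
and A is a retract of it. *)
Lemma gdim_kernel n A B N : short A B N -> dim n B -> dim n.+1 N -> dim n A.
Proof.
move=> S dB [_ [K [P [S' cP dK]]]].
have [W [S1 S2]] := pullback_short S S'.
apply: gdim_retract (gdim_ext S1 dK dB).
exact: ses_retract S2 (dt_proj dt cP).
Qed.

Lemma gdim_cokernel n A B N : short A B N -> Tc N ->
  dim n A -> dim n.+1 B -> dim n.+1 N.
Proof.
move=> S tN dA [_ [K [P [S' cP dK]]]]; split=> //.
have [K1 [S1 S2]] := ker_comp_short S S'.
by exists K1, P; split=> //; apply: gdim_ext S2 dK dA.
Qed.

End Theory.

Definition any (X : C) : Prop := True.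

Section Cumulative.
Variables (Cc Dc : C -> Prop).
Hypothesis dt : dim_theory any Cc Dc.
Hypothesis cov : forall X, Dc X -> exists K P, [/\ short K P X, Cc P & Dc K].
Let dim := gdim any Cc Dc.

Lemma gdimS n X : dim n X -> dim n.+1 X.
Proof.
elim: n X => [|n IH] X; first by move=> dX; split=> //; apply: cov.
move=> [_ [K [P [S cP dK]]]]; split=> //.
by exists K, P; split=> //; apply: IH.
Qed.

Lemma gdim_leq m n X : (m <= n)%N -> dim m X -> dim n X.
Proof.
by move=> /subnK <-; elim: (n - m)%N => // k IH dX; rewrite addSn; apply/gdimS/IH.
Qed.

Lemma gdim_cokernel_any n A B N : short A B N -> dim n A -> dim n.+1 B -> dim n.+1 N.
Proof. by move=> S; apply: gdim_cokernel. Qed.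

End Cumulative.

Definition fgp P := proj P /\ fin P.
Notation pd := (gdim any proj proj).
Notation perf := (gdim any fgp fgp).

Lemma fgp_ext : ext_closed fgp.
Proof.
by move=> A B N S [pA fA] [pN fN]; split; [apply: proj_ext S _ _|apply: short_fin S _ _].
Qed.

Lemma fgp_retract : retract_closed fgp.
Proof.
by move=> A B r [pB fB]; split; [apply: proj_retract r _|apply: fin_retract r _].
Qed.

Lemma zero_fgp Z : is_zero Z -> fgp Z.
Proof. by move=> Z0; split; [exact: zero_proj | exact: fin_zero]. Qed.

Lemma pd_theory : dim_theory any proj proj.
Proof.
split=> //; try exact: proj_ext; try exact: proj_retract; exact: zero_proj.
Qed.

Lemma perf_theory : dim_theory any fgp fgp.
Proof.
by split=> //; try exact: fgp_ext; try exact: fgp_retract; [move=> P []|exact: zero_fgp].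
Qed.

Lemma self_cover (D : C -> Prop) : (forall Z, is_zero Z -> D Z) ->
  forall X, D X -> exists K P, [/\ short K P X, D P & D K].
Proof.
move=> D0 X dX; have [Z Z0 S] := short_zero X.
by exists Z, X; split=> //; apply: D0.
Qed.

Lemma perf_fin n X : perf n X -> fin X.
Proof.
case: n => [[]//|n] [_ [K [P [[k [p [_ hp _ sp _]]] [_ fP] _]]]].
exact: fin_surj hp sp fP.
Qed.

Lemma perf_cov n X : perf n X -> exists K P, [/\ short K P X, fgp P & perf n.-1 K].
Proof.
case: n => [|n] dX; first exact: (self_cover zero_fgp).
by case: dX => _ [K [P [S cP dK]]]; exists K, P.
Qed.

(** A syzygy depends on the covers that are chosen, hence a relation. *)
Inductive syz : nat -> C -> C -> Prop :=
| syz0 X : syz 0 X X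
| syzS n X Y K P : syz n X Y -> short K P Y -> fgp P -> syz n.+1 X K.

Lemma perf_syz m n X : perf m X -> exists2 Z, syz n X Z & exists k, perf k Z.
Proof.
move=> dX; elim: n => [|n [Y s [k dY]]]; first by exists X; [exact: syz0 | exists m].
have [K [P [S cP dK]]] := perf_cov dY.
by exists K; [exact: syzS s S cP | exists k.-1].
Qed.

Lemma syz_pd m n X Z : syz n X Z -> pd m Z -> pd (n + m) X.
Proof.
move=> s; elim: s m => {n X Z} [//|n X Y K P _ IH S [pP _] m dK].
by rewrite addSnnS; apply: IH; split=> //; exists K, P.
Qed.

End Dimension.

Arguments any {C} X.
Arguments fgp {C} P.
Notation pd := (gdim any proj proj).
Notation perf := (gdim any fgp fgp).

(** * Vanishing of Tor in positive degrees *)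

(** The example is X |-> IX for an ideal I; [sub_surj] is right exactness of
X |-> X/IX. *)
Record subfunctor (C : category) := Subfunctor {
  sub :> forall A : C, car A -> Prop;
  subB : forall (A : C) (x y : car A), sub x -> sub y -> sub (x - y);
  sub_hom : forall (A B : C) (f : car A -> car B), hom f ->
    forall x, sub x -> sub (f x);
  sub_surj : forall (A B : C) (f : car A -> car B), hom f -> surj f ->
    forall y, sub y -> exists2 x, sub x & f x = y }.
Arguments sub {C} s {A} x.

Section TorsionFree.
Variables (C : category) (I : subfunctor C).
Implicit Types (A B K N P Q X Z W : C).

Lemma sub_hom_inj A B (f : car A -> car B) (g : car B -> car A) x :
  hom f -> hom g -> g (f x) = x -> sub I (f x) -> sub I x.
Proof. by move=> hf hg gf /(sub_hom hg); rewrite gf. Qed.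

(** For the subfunctor X |-> IX this is Tor_1(R/I, X) = 0, as the kernel of
K/IK -> N/IN is (K /\ IN)/IK.  All presentations of X are considered at once, which
makes the condition independent of choices and easy to restrict to subcategories. *)
Definition torfree1 X := forall K N (i : car K -> car N) (g : car N -> car X),
  ses i g -> forall k, sub I (i k) -> sub I k.

Lemma torfree1_ext : ext_closed torfree1.
Proof.
move=> A B N S tA tN L M j g S' x Ix.
have [a [b Sab]] := S; have [ha hb ai sb exb] := Sab.
have [hj hg ji sg exg] := S'.
have [K1 [k1 S1]] := ker_ses (hom_comp hg hb) (surj_comp sg sb).
have [hk1 _ k1i _ ex1] := S1.
have [|u hu uE] := ses_lift S1 hj.
  by move=> y /=; have -> : g (j y) = 0 by [apply/exg; exists y]; rewrite homf0.
have [|v hv vE] := ses_lift Sab (hom_comp hk1 hg).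
  by move=> y; apply/(ex1 (k1 y)); exists y.
have Suv : ses u v.
  split=> //.
  - by move=> y z yz; apply: ji; rewrite -!uE yz.
  - move=> y; have [z zE] := sg (a y).
    have [w wE] : exists w, k1 w = z by apply/ex1; rewrite /= zE; apply/exb; exists y.
    by exists w; apply: ai; rewrite vE /= wE.
  - move=> y; split=> [vy|[z <-]].
      have [z zE] : exists z, j z = k1 y by apply/exg; rewrite -[LHS]vE vy homf0.
      by exists z; apply: k1i; rewrite uE.
    by apply: ai; rewrite vE /= uE homf0 //; apply/exg; exists z.
by apply: (tA _ _ _ _ Suv); apply: (tN _ _ _ _ S1); rewrite uE.
Qed.

Lemma torfree1_retract : retract_closed torfree1.
Proof.
move=> A B [i [r [hi hr ri]]] tB K N j g S x Ix.
have [hj hg ji sg exg] := S.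
have [D [d [e [[hd he sd se] [u [v [hu hv uE vE _]]] dei univ sD]]]] := has_prod N B.
pose f y := i (g (d y)) + (e y - i (r (e y))).
have hir : hom (fun y => i (r y)) := hom_comp hr hi.
have hf : hom f.
  apply: hom_add; first exact: (hom_comp (hom_comp hd hg) hi).
  exact: (hom_comp he (hom_sub (hom_id B) hir)).
have sf : surj f.
  move=> y; have [z zE] := sg (r y); exists (u z + v y); rewrite /f.
  rewrite (homD hd) (homD he) (uE z).1 (uE z).2 (vE y).1 (vE y).2 addr0 add0r.
  by rewrite zE addrC subrK.
have [J [t SJ]] := ker_ses hf sf; have [ht _ ti _ exf] := SJ.
have [|s hs sE] := ses_lift SJ (hom_comp hj hu).
  move=> y; rewrite /f /= (uE _).1 (uE _).2 (homf0 hr) (homf0 hi) subr0 addr0.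
  by have -> : g (j y) = 0 by [apply/exg; exists y]; rewrite homf0.
have [|w hw wE] := ses_lift S (hom_comp ht hd).
  move=> y /=; have : f (t y) = 0 by apply/exf; exists y.
  move/(congr1 r); rewrite /f (homD hr) (homB hr) !ri subrr addr0.
  by rewrite (homf0 hr).
apply: (sub_hom_inj hs hw); first by apply: ji; rewrite wE /= sE /= (uE _).1.
by apply: (tB _ _ _ _ SJ); rewrite sE /=; apply: sub_hom.
Qed.

(** A projective presentation maps to any other one.  An element of IN in the
kernel L comes from I(L + P); its component in P lies in K, hence in IK. *)
Lemma torfree1_pres K P X (k : car K -> car P) (p : car P -> car X) :
  ses k p -> proj P -> (forall x, sub I (k x) -> sub I x) -> torfree1 X.
Proof.
move=> S pP tX L N j g S' x Ix; have [hj hg ji sg exg] := S'.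
have [hk hp ki sp exp] := S.
have [t ht tE] := pP _ _ g p hg sg hp.
have [|s hs sE] := ses_lift S' (hom_comp hk ht).
  by move=> y /=; rewrite tE; apply/exp; exists y.
have [D [d [e [[hd he sd se] [u [v [hu hv uE vE _]]] dei univ sD]]]] := has_prod L P.
pose f y := j (d y) + t (e y).
have hf : hom f := hom_add (hom_comp hd hj) (hom_comp he ht).
have sf : surj f.
  move=> y; have [z zE] := sp (g y).
  have [w wE] : exists w, j w = y - t z by apply/exg; rewrite (homB hg) tE zE subrr.
  exists (u w + v z); rewrite /f.
  rewrite (homD hd) (homD he) (uE _).1 (uE _).2 (vE _).1 (vE _).2 addr0 add0r.
  by rewrite wE subrK.
have [y Iy yE] := sub_surj hf sf Ix.
have py : p (e y) = 0.
  have : g (f y) = 0 by rewrite yE; apply/exg; exists x.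
  rewrite /f (homD hg) tE => <-.
  by have -> : g (j (d y)) = 0 by [apply/exg; exists (d y)]; rewrite add0r.
have [z zE] : exists z, k z = e y by apply/exp.
have Iz : sub I z by apply: tX; rewrite zE; apply: sub_hom.
have -> : x = d y - s (- z).
  by apply: ji; rewrite (homB hj) sE /= !(homN hk) (homN ht) opprK zE -yE.
by apply: subB; [apply: sub_hom | apply: sub_hom => //; rewrite -sub0r; apply: subB => //; rewrite -(subrr z); apply: subB].
Qed.

Lemma proj_torfree1 P : proj P -> torfree1 P.
Proof.
move=> pP K N i g S k Ik; have [s [r [hs hr _ ri _]]] := ses_split S pP.
by have [hi _ _ _ _] := S; apply: (sub_hom_inj hi hr (ri k)).
Qed.

(** Tor_(i+1) of X is Tor_i of a syzygy, so this is the vanishing of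
Tor_1, ..., Tor_n. *)
Definition torfree_upto := gdim torfree1 proj any.
Definition torfree X := forall n, torfree_upto n X.

Lemma torfree_upto_theory : dim_theory torfree1 proj any.
Proof.
split=> //; try exact: proj_ext; try exact: torfree1_ext;
  try exact: torfree1_retract; try exact: zero_proj; exact: proj_torfree1.
Qed.

Lemma torfree_coind (D : C -> Prop) :
  (forall X, D X -> torfree1 X /\ exists K P, [/\ short K P X, proj P & D K]) ->
  forall X, D X -> torfree X.
Proof.
move=> DE X dX n; elim: n X dX => [//|n IH] X /DE[tX [K [P [S pP dK]]]].
by split=> //; exists K, P; split=> //; apply: IH.
Qed.

Lemma torfree_torfree1 X : torfree X -> torfree1 X.
Proof. by move=> /(_ 1)[]. Qed.

Lemma torfree_syz K P X : short K P X -> proj P -> torfree X -> torfree K.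
Proof. by move=> S pP tX n; apply: (gdim_syz torfree_upto_theory S pP (tX n.+1)). Qed.

Lemma torfree_cov X : torfree X -> exists K P, [/\ short K P X, proj P & torfree K].
Proof.
move=> tX; have [_ [K [P [S pP _]]]] := tX 1%N.
by exists K, P; split=> //; exact: (torfree_syz S pP tX).
Qed.

Lemma torfree_ext : ext_closed torfree.
Proof. by move=> A B N S tA tN n; exact: (gdim_ext torfree_upto_theory S (tA n) (tN n)). Qed.

Lemma torfree_retract : retract_closed torfree.
Proof. by move=> A B r tB n; exact: (gdim_retract torfree_upto_theory r (tB n)). Qed.

Lemma proj_torfree P : proj P -> torfree P.
Proof. by move=> pP n; apply: (gdimC torfree_upto_theory). Qed.

(** Syzygies of N are extensions of A by syzygies of B, so only Tor_1 of the
cokernel has to be checked by hand. *)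
Lemma torfree_cokernel A B N : short A B N -> torfree1 N -> torfree A -> torfree B -> torfree N.
Proof.
by move=> S tN tA tB [//|n]; apply: (gdim_cokernel torfree_upto_theory S tN (tA n) (tB n.+1)).
Qed.

Lemma torfree_theory : dim_theory any proj torfree.
Proof.
split=> //; try exact: proj_ext; try exact: torfree_ext; try exact: torfree_retract;
  try exact: proj_torfree; try exact: zero_proj; exact: proj_torfree.
Qed.

Lemma torfree_kernel A B N : short A B N -> torfree B -> torfree N -> torfree A.
Proof.
move=> S tB tN; apply: (gdim_kernel torfree_theory S (n := 0)) => //.
exact: (@gdimS _ _ _ torfree_cov 0 N tN).
Qed.

Lemma pd_torfree_dim n X : pd n X -> gdim any proj torfree n X.
Proof.
elim: n X => [|n IH] X; first exact: proj_torfree.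
by move=> [_ [K [P [S pP dK]]]]; split=> //; exists K, P; split=> //; apply: IH.
Qed.

End TorsionFree.

(** * Functors and resolutions *)

(** G is a class of objects along whose presentations F is exact; for a
reduction X |-> X/IX it is the class of torfree objects. *)
Section Functor.
Variables (C1 C2 : category) (F : C1 -> C2) (G : C1 -> Prop).
Variables (Cc1 : C1 -> Prop) (Cc2 : C2 -> Prop).
Hypothesis FC : forall P, Cc1 P -> Cc2 (F P).
Hypothesis FG : forall K P X, short K P X -> Cc1 P -> G X ->
  G K /\ short (F K) (F P) (F X).

Lemma gdim_functor n X : G X ->
  gdim any Cc1 Cc1 n X -> gdim any Cc2 Cc2 n (F X).
Proof.
elim: n X => [|n IH] X gX; first exact: FC.
move=> [_ [K [P [S cP dK]]]]; have [gK S'] := FG S cP gX.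
by split=> //; exists (F K), (F P); split=> //; [apply: FC | apply: IH].
Qed.

End Functor.

Section FunctorSyzygy.
Variables (C1 C2 : category) (F : C1 -> C2) (G : C1 -> Prop).
Variables (Cc2 Dc2 : C2 -> Prop).
Hypothesis dt : dim_theory any Cc2 Dc2.
Hypothesis cov : forall X, Dc2 X -> exists K P, [/\ short K P X, Cc2 P & Dc2 K].
Hypothesis FG : forall K P X, short K P X -> fgp P -> G X ->
  G K /\ short (F K) (F P) (F X).

(** Covers are taken in C1, and F sends them to objects of dimension at most p
only, so the dimension of the image drops with each syzygy until it reaches p. *)
Lemma syz_functor p n X Z : (forall P, fgp P -> gdim any Cc2 Dc2 p (F P)) ->
  G X -> syz n X Z -> gdim any Cc2 Dc2 (n + p) (F X) ->
  G Z /\ gdim any Cc2 Dc2 p (F Z).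
Proof.
move=> FP gX s; elim: s p FP gX => {n X Z} [//|n X Y K P _ IH S cP] p FP gX.
rewrite addSnnS => dX.
have [|//|gY dY] := IH p.+1 _ _ dX.
  by move=> Q cQ; apply: (gdimS cov); apply: FP.
have [gK S'] := FG S cP gY; split=> //.
exact: (gdim_kernel dt S' (FP _ cP) dY).
Qed.

End FunctorSyzygy.

(** * Categories of modules over quotient rings *)

Section Modules.
Variable R : pzRingType.

Definition mklin (A B : lmodType R) (f : A -> B) (Hf : linear f) :
  {linear A -> B} := HB.pack f (GRing.isLinear.Build R A B *:%R f Hf).

Lemma linZ (A B : lmodType R) (f : A -> B) : linear f -> forall a, {morph f : x / a *: x}.
Proof. by move=> lf a x; rewrite -[f]/(mklin lf : A -> B) linearZ. Qed.
Lemma lin0 (A B : lmodType R) (f : A -> B) : linear f -> f 0 = 0.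
Proof. by move=> lf; rewrite -[f]/(mklin lf : A -> B) linear0. Qed.
Lemma linD (A B : lmodType R) (f : A -> B) : linear f -> {morph f : x y / x + y}.
Proof. by move=> lf x y; rewrite -[f]/(mklin lf : A -> B) linearD. Qed.
Lemma linB (A B : lmodType R) (f : A -> B) : linear f -> {morph f : x y / x - y}.
Proof. by move=> lf x y; rewrite -[f]/(mklin lf : A -> B) linearB. Qed.

Lemma zero_linear (A B : lmodType R) : linear (fun _ : A => 0 : B).
Proof. by move=> a x y; rewrite scaler0 addr0. Qed.

Section Pullback.
Variables (A B X : lmodType R) (f : {linear A -> X}) (g : {linear B -> X}).
Definition pb_pred : {pred (A * B)%type} := [pred x | f x.1 == g x.2].
Fact pb_closed : subsemimod_closed pb_pred.
Proof.
split=> [|a x]; last by rewrite !inE !linearZ => /eqP->.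
split=> [|x y]; first by rewrite inE !linear0.
by rewrite !inE !linearD => /eqP-> /eqP->.
Qed.
HB.instance Definition _ := GRing.isSubmodClosed.Build R (A * B)%type
  pb_pred pb_closed.
Definition pbmod : lmodType R := submod pb_pred.
Definition pb1 (x : pbmod) : A := (val x).1.
Definition pb2 (x : pbmod) : B := (val x).2.
Lemma pbE x : f (pb1 x) = g (pb2 x).
Proof. by have /eqP := valP x. Qed.
Lemma pb_ex a b : f a = g b -> exists x, pb1 x = a /\ pb2 x = b.
Proof.
move=> fg; have h : (a, b) \in pb_pred by apply/eqP.
by exists (exist _ (a, b) h : pbmod).
Qed.
Lemma pb_inj x y : pb1 x = pb1 y -> pb2 x = pb2 y -> x = y.
Proof.
rewrite /pb1 /pb2 => e1 e2; apply: val_inj.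
by rewrite [LHS]surjective_pairing [RHS]surjective_pairing e1 e2.
Qed.
End Pullback.

Lemma fg_surj (A B : lmodType R) (f : A -> B) : linear f ->
  (forall y, exists x, f x = y) -> finitely_generated A -> finitely_generated B.
Proof.
move=> lf sf [n [e eE]]; exists n, (f \o e) => y.
have [x <-] := sf y; have [c ->] := eE x; exists c.
by rewrite -[LHS]/(mklin lf _) linear_sum; apply: eq_bigr => i _; rewrite linearZ.
Qed.

Lemma fg_ext (A B X : lmodType R) (f : A -> B) (g : B -> X) :
  linear f -> linear g -> (forall y, exists x, g x = y) ->
  (forall x, g x = 0 -> exists y, f y = x) ->
  finitely_generated A -> finitely_generated X -> finitely_generated B.
Proof.
move=> lf lg sg ex [n [e eE]] [m [d dE]].
have [l lE] := choice (fun i => sg (d i)).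
exists (n + m)%N, (fun i : 'I_(n + m) => match fintype.split i with inl j => f (e j) | inr k => l k end).
move=> x; have [c cE] := dE (g x).
have /ex[y yE] : g (x - \sum_(i < m) c i *: l i) = 0.
  rewrite -[LHS]/(mklin lg _) linearB linear_sum [mklin lg x]cE.
  by rewrite -sumrB big1 // => i _; rewrite linearZ /= lE subrr.
have [b bE] := eE y.
exists (fun i : 'I_(n + m) => match fintype.split i with inl j => b j | inr k => c k end).
rewrite big_split_ord /= (eq_bigr (fun i => b i *: f (e i))); last first.
  by move=> i _; rewrite (unsplitK (inl i)).
rewrite [X in _ + X](eq_bigr (fun i => c i *: l i)); last first.
  by move=> i _; rewrite (unsplitK (inr i)).
have <- : f y = \sum_(i < n) b i *: f (e i).
  rewrite bE -[LHS]/(mklin lf _) linear_sum; apply: eq_bigr => i _.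
  by rewrite linearZ.
by rewrite yE subrK.
Qed.

Lemma fg_zero (Z : lmodType R) : (forall x : Z, x = 0) -> finitely_generated Z.
Proof.
by move=> Z0; exists 0, (fun=> 0) => x; exists (fun=> 0); rewrite big_ord0.
Qed.

Section Category.
Variable J : ideal R.

(** Keeping R-modules rather than modules over R/J makes maps between modules
over different quotients of R plain R-linear maps. *)
Record kmod := KMod {
  kmod_of :> lmodType R;
  kmodP : forall a (x : kmod_of), a \in J -> a *: x = 0 }.

Definition modhom (A B : kmod) (f : A -> B) : Prop := linear f.

Lemma zero_kmodP (a : R) (x : 'rV[R]_0) : a \in J -> a *: x = 0.
Proof. by move=> _; rewrite thinmx0. Qed.
Definition zero_kmod := KMod zero_kmodP.
Lemma zero_kmod0 (x : zero_kmod) : x = 0. Proof. exact: thinmx0. Qed.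

Lemma pb_kmodP (A B X : kmod) (f : {linear A -> X}) (g : {linear B -> X}) a
  (x : pbmod f g) : a \in J -> a *: x = 0.
Proof.
by move=> Ja; apply: pb_inj; [exact: (kmodP (pb1 x) Ja) | exact: (kmodP (pb2 x) Ja)].
Qed.

Lemma modhomB (A B : kmod) (f : A -> B) : @modhom A B f -> {morph f : x y / x - y}.
Proof. exact: linB. Qed.

Lemma modhom_mono (A B X : kmod) (i : B -> X) (h : A -> B) :
  modhom i -> injective i -> modhom (i \o h) -> modhom h.
Proof. by move=> li ii lih a x y; apply: ii; rewrite li; exact: lih. Qed.

Lemma mod_pullback (A B X : kmod) (f : A -> X) (g : B -> X) : modhom f -> modhom g ->
    exists (W : kmod) (p : W -> A) (q : W -> B),
    [/\ modhom p, modhom q,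
        forall a b, f a = g b <-> exists w, p w = a /\ q w = b,
        forall x y, p x = p y -> q x = q y -> x = y
      & forall (D : kmod) (h : D -> W), modhom (p \o h) -> modhom (q \o h) -> modhom h].
Proof.
move=> lf lg; pose W := KMod (@pb_kmodP A B X (mklin lf) (mklin lg)).
exists W, (@pb1 _ _ _ (mklin lf) (mklin lg)), (@pb2 _ _ _ (mklin lf) (mklin lg)).
split=> //.
- move=> a b; split=> [ab|[w [<- <-]]].
    exact: (@pb_ex _ _ _ (mklin lf) (mklin lg) a b ab).
  exact: (@pbE _ _ _ (mklin lf) (mklin lg)).
- exact: pb_inj.
- move=> D h lp lq a x y.
  by apply: pb_inj; [exact: lp | exact: lq].
Qed.

Definition modcat : category.
refine (@Category kmod (fun X => X : zmodType) modhom
  (fun X => finitely_generated X) modhomB _ _ _ _ modhom_mono _ mod_pullback _ _ _).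
- by [].
- by move=> A B X f g lf lg a x y; rewrite /= lf lg.
- by move=> A B a x y; rewrite scaler0 addr0.
- move=> A B f g lf lg a x y; rewrite lf lg scalerBr.
  by rewrite opprD addrACA.
- by exists zero_kmod; exact: zero_kmod0.
- exact: fg_zero.
- exact: fg_surj.
- exact: fg_ext.
Defined.

End Category.

Section IdealAction.
Variable I : ideal R.
Implicit Types X Y : lmodType R.

Inductive imul (X : lmodType R) : X -> Prop :=
| imul0 : imul 0
| imulD x y : imul x -> imul y -> imul (x + y)
| imulZ a x : a \in I -> imul (a *: x).

Lemma imulS X a (x : X) : imul x -> imul (a *: x).
Proof.
elim=> [|{}x y _ ix _ iy|b {}x Ib]; first by rewrite scaler0; exact: imul0.
  by rewrite scalerDr; exact: imulD.
by rewrite scalerA; apply: imulZ; exact: Defs.idealMl.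
Qed.

Lemma imulB X (x y : X) : imul x -> imul y -> imul (x - y).
Proof. by move=> ix iy; rewrite -scaleN1r; apply: imulD => //; exact: imulS. Qed.

Lemma imulN X (x : X) : imul (- x) -> imul x.
Proof. by rewrite -[x in X in _ -> X]opprK -[- - x]sub0r; apply: imulB; exact: imul0. Qed.

Lemma imul_hom X Y (f : X -> Y) : linear f -> forall x, imul x -> imul (f x).
Proof.
move=> lf x; rewrite -[f]/(mklin lf : X -> Y).
elim=> [|{}x y _ ix _ iy|a {}x Ia]; first by rewrite linear0; exact: imul0.
  by rewrite linearD; exact: imulD.
by rewrite linearZ; exact: imulZ.
Qed.

Lemma imul_surj X Y (f : X -> Y) : linear f -> (forall y, exists x, f x = y) ->
  forall y, imul y -> exists2 x, imul x & f x = y.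
Proof.
move=> lf sf y; rewrite -[f]/(mklin lf : X -> Y).
elim=> [|_ _ _ [x ix <-] _ [y' iy <-]|a {}y Ia].
- by exists 0; [exact: imul0 | rewrite linear0].
- by exists (x + y'); [exact: imulD | rewrite linearD].
- by have [x <-] := sf y; exists (a *: x); [exact: imulZ | rewrite linearZ].
Qed.

Definition ideal_sub J : subfunctor (modcat J) :=
  @Subfunctor (modcat J) (fun A => @imul A) (fun A => @imulB A)
    (fun A B => @imul_hom A B) (fun A B => @imul_surj A B).

Definition imul_pred X : {pred X} := [pred x : X | `[< imul x >]].
Fact imul_closed X : subsemimod_closed (@imul_pred X).
Proof.
split=> [|a x /asboolP ix]; last by apply/asboolP; exact: imulS.
split=> [|x y /asboolP ix /asboolP iy]; apply/asboolP; first exact: imul0.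
exact: imulD.
Qed.
HB.instance Definition _ X := GRing.isSubmodClosed.Build R X (@imul_pred X)
  (@imul_closed X).

Definition qmod X : lmodType R := quotmod (@imul_pred X).
Definition qpi X : X -> qmod X := @quotmod_pi R X (@imul_pred X).

Lemma qpi_linear X : linear (@qpi X).
Proof. by move=> a x y; rewrite /qpi quotmod_piD quotmod_piZ. Qed.

Lemma qpi_surj X (y : qmod X) : exists x, qpi x = y.
Proof. by exists (repr y); exact: quotmod_reprK. Qed.

Lemma qpi_eq X (x y : X) : qpi x = qpi y <-> imul (x - y).
Proof.
by rewrite /qpi; split=> [/quotmod_pi_eq/asboolP|h] //; apply/quotmod_pi_eq/asboolP.
Qed.

Lemma qpi_eq0 X (x : X) : qpi x = 0 <-> imul x.
Proof.
have -> : 0 = qpi (0 : X) by rewrite -[RHS]/(mklin (@qpi_linear X) _) linear0.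
by rewrite qpi_eq subr0.
Qed.

End IdealAction.
End Modules.

(** * Reduction modulo an ideal *)

Lemma submod_val_linear (A : pzRingType) (X : lmodType A) (U : submodClosed X) :
  linear (fun b : submod U => val b).
Proof. by []. Qed.

Section Quotients.
Variable R : pzRingType.
Implicit Types (I J : ideal R).

Lemma quotmod_pi_linear (X : lmodType R) (U : submodClosed X) :
  linear (@quotmod_pi R X U).
Proof. by move=> a x y; rewrite quotmod_piD quotmod_piZ. Qed.

Lemma quotmod_pi_surj (X : lmodType R) (U : submodClosed X) (y : quotmod U) :
  exists x, quotmod_pi U x = y.
Proof. by exists (repr y); exact: quotmod_reprK. Qed.

Lemma quotmod_desc (X Z : lmodType R) (U : submodClosed X) (f : X -> Z) :
  linear f -> (forall x, x \in U -> f x = 0) ->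
  exists2 h : quotmod U -> Z, linear h & forall x, h (quotmod_pi U x) = f x.
Proof.
move=> lf f0; pose h (y : quotmod U) := f (repr y).
have hE x : h (quotmod_pi U x) = f x.
  apply/eqP; rewrite -subr_eq0 -(linB lf); apply/eqP/f0/quotmod_pi_eq.
  exact: quotmod_reprK.
exists h => // a x y.
have [x' <-] := quotmod_pi_surj x; have [y' <-] := quotmod_pi_surj y.
by rewrite -(@quotmod_pi_linear X U a x' y') !hE lf.
Qed.

Lemma qmod_desc I (X Z : lmodType R) (f : X -> Z) :
  linear f -> (forall x, imul I x -> f x = 0) ->
  exists2 h : qmod I X -> Z, linear h & forall x, h (qpi I x) = f x.
Proof. by move=> lf f0; apply: quotmod_desc => // x /asboolP/f0. Qed.

Lemma imul_kmod I J (X : kmod J) : (forall a, a \in I -> a \in J) ->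
  forall x : X, imul I x -> x = 0.
Proof.
move=> IJ x; elim=> // [y z _ -> _ ->|a y Ia]; first by rewrite addr0.
exact/kmodP/IJ.
Qed.

Section Restriction.
Variables (J J' : ideal R).
Hypothesis JJ' : forall a, a \in J -> a \in J'.

Lemma kres_subproof (X : kmod J') a (x : X) : a \in J -> a *: x = 0.
Proof. by move=> /JJ'; exact: kmodP. Qed.
Definition kres (X : modcat J') : modcat J := KMod (@kres_subproof X).

Lemma kres_short K N X : short K N X -> short (kres K) (kres N) (kres X).
Proof. by move=> [i [g S]]; exists i, g. Qed.

Lemma kres_retract A B : retract A B -> retract (kres A) (kres B).
Proof. by move=> [i [g S]]; exists i, g. Qed.

Lemma kres_torfree1 I X :
  torfree1 (ideal_sub I J) (kres X) -> torfree1 (ideal_sub I J') X.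
Proof. by move=> t K N i g S; apply: (t (kres K) (kres N) i g S). Qed.

End Restriction.

(** Reduction X |-> X/IX from R/J-modules to R/J'-modules.  The last hypothesis
says that J' = I + J; the cases used are J = 0, and J = I1 with I = I2. *)
Section Reduction.
Variables (I J J' : ideal R).
Hypothesis JJ' : forall a, a \in J -> a \in J'.
Hypothesis IJ' : forall a, a \in I -> a \in J'.
Hypothesis J'E : forall (X : kmod J) a (x : X), a \in J' -> imul I (a *: x).

Lemma kquo_subproof (X : kmod J) a (x : qmod I X) : a \in J' -> a *: x = 0.
Proof.
move=> J'a; have [y <-] := qpi_surj x.
by rewrite -(linZ (@qpi_linear _ I X)); apply/qpi_eq0/J'E.
Qed.
Definition kquo (X : modcat J) : modcat J' := KMod (@kquo_subproof X).

Lemma kquo_map (X Y : modcat J) (f : car X -> car Y) : hom f ->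
  exists2 h : car (kquo X) -> car (kquo Y), hom h &
    forall x, h (qpi I x) = qpi I (f x).
Proof.
move=> lf; apply: (@qmod_desc I X (kquo Y : kmod J') (fun x => qpi I (f x))).
  by move=> a x y; rewrite lf (@qpi_linear _ I Y).
by move=> x ix; apply/qpi_eq0; apply: imul_hom ix.
Qed.

Lemma kquo_ses (K N X : modcat J) (i : car K -> car N) (g : car N -> car X) :
  ses i g -> (forall k, imul I (i k) -> imul I k) ->
  exists (i' : car (kquo K) -> car (kquo N)) (g' : car (kquo N) -> car (kquo X)),
   [/\ forall x, i' (qpi I x) = qpi I (i x), forall x, g' (qpi I x) = qpi I (g x)
     & ses i' g'].
Proof.
move=> [hi hg ii sg ex] tX.
have [i' hi' i'E] := kquo_map hi; have [g' hg' g'E] := kquo_map hg.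
exists i', g'; split=> //; split=> //.
- apply: (@hom_inj _ (kquo K) (kquo N) i' hi') => x.
  by have [y <-] := qpi_surj x; rewrite i'E => /qpi_eq0 h; apply/qpi_eq0/tX.
- move=> y; have [x <-] := qpi_surj y; have [z <-] := sg x.
  by exists (qpi I z).
- move=> y; have [x <-] := qpi_surj y; split=> [|[z <-]].
    rewrite g'E => /qpi_eq0 /(imul_surj hg sg)[z iz zE].
    have [k kE] : exists k, i k = x - z by apply/ex; rewrite (homB hg) zE subrr.
    exists (qpi I k); rewrite i'E kE; apply/qpi_eq.
    by rewrite addrAC subrr sub0r; apply: imulN; rewrite opprK.
  have [k <-] := qpi_surj z; rewrite i'E g'E.
  by have -> : g (i k) = 0 by [apply/ex; exists k]; apply/qpi_eq0; exact: imul0.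
Qed.

Lemma kquo_short K N X : short K N X -> torfree1 (ideal_sub I J) X ->
  short (kquo K) (kquo N) (kquo X).
Proof.
move=> [i [g S]] tX; have [i' [g' [_ _ S']]] := kquo_ses S (tX _ _ _ _ S).
by exists i', g'.
Qed.

(** Reduction is left adjoint to the inclusion of R/J'-modules, which preserves
surjections. *)
Lemma kquo_proj P : proj P -> proj (kquo P).
Proof.
move=> pP A B g f hg sg hf.
have hf' : @hom (modcat J) P (kres JJ' B) (f \o @qpi _ I P).
  by move=> a x y /=; rewrite (@qpi_linear _ I P) hf.
have [h hh hE] := pP (kres JJ' A) (kres JJ' B) g _ hg sg hf'.
have [h' hh' h'E] := qmod_desc (I := I) hh (fun x ix =>
  imul_kmod (X := A) IJ' (imul_hom hh ix)).
exists h' => // x; have [y <-] := qpi_surj x.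
by rewrite h'E hE.
Qed.

(** The reduced sequence splits because X/IX is projective, and its retraction
lifts along K -> K/IK because P is projective. *)
Lemma kquo_split (K P X : modcat J) (k : car K -> car P) (p : car P -> car X) :
  ses k p -> proj P -> torfree1 (ideal_sub I J) X -> proj (kquo X) ->
  proj (kquo K) /\ exists2 h : car P -> car K, hom h & forall x, imul I (h (k x) - x).
Proof.
move=> S pP tX qX.
have [k' [p' [k'E p'E S']]] := kquo_ses S (tX _ _ _ _ S).
have [s [r [hs hr _ rE _]]] := ses_split S' qX; split.
  apply: (proj_retract (B := kquo P)); last exact: kquo_proj.
  by exists k', r; split=> //; case: S'.
pose qK := kres JJ' (kquo K).
have hq : @hom (modcat J) K qK (@qpi R I _) by exact: qpi_linear.
have hf : @hom (modcat J) P qK (r \o @qpi R I _).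
  by move=> a x y /=; rewrite (@qpi_linear _ I) hr.
have [h hh hE] := pP _ _ _ _ hq (@qpi_surj _ I _) hf.
exists h => // x; apply/qpi_eq; rewrite [LHS]hE /= -k'E; exact: rE.
Qed.

Lemma kquo_fgp P : fgp P -> fgp (kquo P).
Proof.
move=> [pP fP]; split; first exact: kquo_proj.
exact: fg_surj (@qpi_linear _ I P) (@qpi_surj _ I P) fP.
Qed.

Lemma kquo_perf n X : torfree (ideal_sub I J) X -> perf n X -> perf n (kquo X).
Proof.
apply: (gdim_functor (F := kquo)) => [|K P Y S [pP _] tY]; first exact: kquo_fgp.
by split; [apply: torfree_syz S pP tY | apply: kquo_short S (torfree_torfree1 tY)].
Qed.

Lemma kquo_pd n X : torfree (ideal_sub I J) X -> pd n X -> pd n (kquo X).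
Proof.
apply: (gdim_functor (F := kquo)) => [|K P Y S pP tY]; first exact: kquo_proj.
by split; [apply: torfree_syz S pP tY | apply: kquo_short S (torfree_torfree1 tY)].
Qed.

Lemma kquo_syz n X Z : syz n X Z -> torfree (ideal_sub I J) X -> pd n (kquo X) ->
  torfree (ideal_sub I J) Z /\ proj (kquo Z).
Proof.
move=> s tX; rewrite -[n in gdim _ _ _ n _]addn0 => dX.
have := syz_functor (F := kquo) (G := torfree (ideal_sub I J)) (pd_theory _)
  (self_cover (@zero_proj _)) _ (p := 0) _ tX s dX; apply.
  move=> K P Y S [pP _] tY.
  by split; [apply: torfree_syz S pP tY | apply: kquo_short S (torfree_torfree1 tY)].
by move=> P [pP _]; exact: kquo_proj.
Qed.

End Reduction.

Section Regular.
Variable J : ideal R.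

Lemma regmod_subproof a (x : quotient_lmod J) : a \in J -> a *: x = 0.
Proof.
move=> Ja; have [y <-] := quotmod_pi_surj x.
rewrite -(linZ (@quotmod_pi_linear _ _)) -(lin0 (@quotmod_pi_linear _ _)).
by apply/quotmod_pi_eq; rewrite subr0; exact: (@Defs.idealMr _ J (y : R) a Ja).
Qed.
Definition regmod : modcat J := KMod regmod_subproof.
Definition regmod_pi (r : R) : regmod := quotmod_pi (ideal_left J) (r : R^o).

Lemma regmod_pi_eq0 r : regmod_pi r = 0 <-> r \in J.
Proof.
rewrite -[0](lin0 (@quotmod_pi_linear _ (ideal_left J))).
by rewrite /regmod_pi quotmod_pi_eq subr0.
Qed.

Lemma regmod_pi_surj (x : regmod) : exists r, regmod_pi r = x.
Proof. by have [y <-] := quotmod_pi_surj x; exists y. Qed.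

Lemma regmod_piZ a b : a *: regmod_pi b = regmod_pi (a * b).
Proof. by rewrite /regmod_pi -(linZ (@quotmod_pi_linear _ _)). Qed.

Lemma regmod_map (X : modcat J) (x : car X) :
  exists2 h : car regmod -> car X, hom h & forall r : R, h (regmod_pi r) = (r *: (x : kmod_of X)).
Proof.
apply: (@quotmod_desc R^o X (ideal_left J) (fun r : R^o => (r : R) *: (x : kmod_of X))).
  by move=> a b c; rewrite scalerDl scalerA.
by move=> a Ja; exact: kmodP.
Qed.

Lemma regmod_fgp : fgp regmod.
Proof.
split=> [A B g f hg sg hf|].
  have [a aE] := sg (f (regmod_pi 1)).
  have [h hh hE] := regmod_map a; exists h => // x.
  have [r <-] := regmod_pi_surj x; rewrite hE (linZ hg) aE -(linZ hf).
  by rewrite regmod_piZ mulr1.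
exists 1%N, (fun=> regmod_pi 1) => x; have [r <-] := regmod_pi_surj x.
by exists (fun=> r); rewrite big_ord1 regmod_piZ mulr1.
Qed.

(** The cover is a sum of copies of R/J, obtained by adding one copy for each
generator, so it lies in every extension closed class that contains R/J. *)
Lemma fin_cover (D : modcat J -> Prop) : (forall Z, is_zero Z -> D Z) ->
  D regmod -> ext_closed D -> forall X : modcat J, fin X ->
  exists (W : modcat J) (f : car W -> car X), [/\ D W, fgp W, hom f & surj f].
Proof.
move=> D0 D1 De X [n [e eE]].
suff [W [f [dW fW hf fE]]] : exists (W : modcat J) (f : car W -> car X),
    [/\ D W, fgp W, hom f & forall i, exists w, f w = e i].
  exists W, f; split=> // x; have [c ->] := eE x.
  have [w wE] := choice fE.
  exists (\sum_(i < n) c i *: (w i : kmod_of W)).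
  rewrite -[LHS]/(mklin hf _) linear_sum; apply: eq_bigr => i _.
  by rewrite linearZ [mklin hf _]wE.
elim: n e {eE} => [|n IH] e.
  exists (zero_kmod J), (fun=> 0); split; try by [].
  - by apply: D0; exact: zero_kmod0.
  - by apply: zero_fgp; exact: zero_kmod0.
  - exact: hom_zero.
  - by case.
have [W [f [dW fW hf fE]]] := IH (fun i => e (lift ord0 i)).
have [h hh hE] := regmod_map (e ord0).
have [Q [p [q [[hp hq _ _] [u [v [hu hv uE vE _]]] _ _ sQ]]]] := has_prod regmod W.
exists Q, (fun x => h (p x) + f (q x)); split.
- exact: De sQ D1 dW.
- exact: fgp_ext sQ regmod_fgp fW.
- exact: hom_add (hom_comp hp hh) (hom_comp hq hf).
- move=> i; case: (unliftP ord0 i) => [j ->|->].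
    have [w <-] := fE j; exists (v w).
    by rewrite (vE w).1 (vE w).2 (homf0 hh) add0r.
  exists (u (regmod_pi 1)); rewrite (uE _).1 (uE _).2 (homf0 hf) addr0 hE.
  by rewrite scale1r.
Qed.

Lemma fin_fgp_cover X : @fin (modcat J) X ->
  exists K P, short K P X /\ fgp P.
Proof.
move=> fX; have [|P [f [_ fP hf sf]]] := fin_cover (@zero_fgp _) regmod_fgp _ fX.
  exact: fgp_ext.
by have [K S] := ker_short hf sf; exists K, P.
Qed.

Lemma fgp_class (D : modcat J -> Prop) : (forall Z, is_zero Z -> D Z) ->
  D regmod -> ext_closed D -> retract_closed D -> forall P, fgp P -> D P.
Proof.
move=> D0 D1 De Dr P [pP fP].
have [W [f [dW _ hf sf]]] := fin_cover D0 D1 De fP.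
have [K [k S]] := ker_ses hf sf; have [s [r [hs _ sE _ _]]] := ses_split S pP.
by apply: Dr dW; exists s, f.
Qed.

End Regular.
End Quotients.

(** * Two ideals with zero intersection *)

Section ZeroIdeal.
Variable R : pzRingType.

Definition zero_ideal_mem : {pred R} := pred1 0.
Lemma zero_ideal0 : 0 \in zero_ideal_mem. Proof. by rewrite inE. Qed.
Lemma zero_idealD x y :
  x \in zero_ideal_mem -> y \in zero_ideal_mem -> x + y \in zero_ideal_mem.
Proof. by rewrite !inE => /eqP-> /eqP->; rewrite addr0. Qed.
Lemma zero_idealMl a x : x \in zero_ideal_mem -> a * x \in zero_ideal_mem.
Proof. by rewrite !inE => /eqP->; rewrite mulr0. Qed.
Lemma zero_idealMr a x : x \in zero_ideal_mem -> x * a \in zero_ideal_mem.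
Proof. by rewrite !inE => /eqP->; rewrite mul0r. Qed.
Definition zero_ideal := Ideal zero_ideal0 zero_idealD zero_idealMl zero_idealMr.

Lemma zero_ideal_kill (X : lmodType R) a (x : X) : a \in zero_ideal -> a *: x = 0.
Proof. by move=> /eqP->; rewrite scale0r. Qed.
Definition mod0 (X : lmodType R) : modcat zero_ideal := KMod (@zero_ideal_kill X).

Lemma zero_ideal_sub (I : ideal R) a : a \in zero_ideal -> a \in I.
Proof. by move=> /eqP->; exact: Defs.ideal0. Qed.

Lemma imul_regular (I : ideal R) (x : R^o) : imul I x -> (x : R) \in I.
Proof.
elim=> [|y z _ Iy _ Iz|a y Ia]; [exact: Defs.ideal0|exact: Defs.idealD|exact: Defs.idealMr].
Qed.

Lemma freemod_proj X : proj (mod0 (freemod R X)).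
Proof.
move=> A B g f hg sg hf.
have [h hE] := @free_projective R X A B (mklin hg) (mklin hf) sg.
by exists h => //; exact: linearP.
Qed.

Lemma free_coord_linear (X : choiceType) (x : X) :
  linear (fun f : freemod R X => val f x : R^o).
Proof.
by move=> a f g; exact: (congr1 (fun h => h x)
  (@submod_val_linear R (X -> R^o) (@free_pred R X) a f g)).
Qed.

Lemma freemod_cover (X : modcat zero_ideal) :
  exists2 f : car (mod0 (freemod R (kmod_of X))) -> car X, hom f & surj f.
Proof.
exists (free_eval (kmod_of X)); first exact: linearP.
exact: free_eval_surj.
Qed.

Lemma proj_free (P : modcat zero_ideal) : proj P ->
  retract P (mod0 (freemod R (kmod_of P))).
Proof.
move=> pP; have [f hf sf] := freemod_cover P.
have [K [k S]] := ker_ses hf sf; have [s [r [hs _ sE _ _]]] := ses_split S pP.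
by exists s, f.
Qed.

End ZeroIdeal.

Section Intersection.
Variables (R : pzRingType) (I1 I2 : ideal R).
Hypothesis I1I2 : forall x : R, x \in I1 -> x \in I2 -> x = 0.
Let Z := zero_ideal R.

(** In a free module this is the condition on the ideals, applied to each
coordinate. *)
Lemma proj_imul_cap (P : modcat Z) (x : car P) : proj P ->
  imul I1 x -> imul I2 x -> x = 0.
Proof.
move=> /proj_free[s [r [hs hr rs]]] i1 i2.
rewrite -(rs x); suff -> : s x = 0 by rewrite (homf0 hr).
apply: val_inj; apply/funext => y.
have h I : imul I x -> (val (s x) y : R) \in I.
  move=> ix; apply: imul_regular.
  exact: (imul_hom (@free_coord_linear _ _ y) (imul_hom hs ix)).
exact: I1I2 (h _ i1) (h _ i2).
Qed.
End Intersection.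

Section Quo.
Variables (R : pzRingType) (I : ideal R).
Let Z := zero_ideal R.
Fact quo_ok (X : kmod Z) a (x : X) : a \in I -> imul I (a *: x).
Proof. exact: imulZ. Qed.
Definition quo : modcat Z -> modcat I := kquo quo_ok.
Let ZI := @zero_ideal_sub R I.
Let II (a : R) (Ia : a \in I) := Ia.

Lemma quo_proj P : proj P -> proj (quo P).
Proof. exact: (kquo_proj ZI II). Qed.
Lemma quo_fgp P : fgp P -> fgp (quo P).
Proof. exact: (kquo_fgp ZI II). Qed.
Lemma quo_perf n X : torfree (ideal_sub I Z) X -> perf n X -> perf n (quo X).
Proof. exact: (kquo_perf ZI II). Qed.
Lemma quo_pd n X : torfree (ideal_sub I Z) X -> pd n X -> pd n (quo X).
Proof. exact: (kquo_pd ZI II). Qed.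
Lemma quo_syz n X Y : syz n X Y -> torfree (ideal_sub I Z) X -> pd n (quo X) ->
  torfree (ideal_sub I Z) Y /\ proj (quo Y).
Proof. exact: (kquo_syz ZI II). Qed.
Lemma quo_split (K P X : modcat Z) (k : car K -> car P) (p : car P -> car X) :
  ses k p -> proj P -> torfree1 (ideal_sub I Z) X -> proj (quo X) ->
  proj (quo K) /\ exists2 h : car P -> car K, hom h & forall x, imul I (h (k x) - x).
Proof. exact: (kquo_split ZI II). Qed.

End Quo.

Section Patching.
Variables (R : pzRingType) (I1 I2 : ideal R).
Hypothesis I1I2 : forall x : R, x \in I1 -> x \in I2 -> x = 0.
Let Z := zero_ideal R.

Lemma ideal_mul0 a b : a \in I1 -> b \in I2 -> a * b = 0.
Proof. by move=> Ia Ib; apply: I1I2; [exact: Defs.idealMr | exact: Defs.idealMl]. Qed.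

Lemma imul_mul0 (X : lmodType R) a (x : X) : a \in I1 -> imul I2 x -> a *: x = 0.
Proof.
move=> Ia; elim=> [|y z _ iy _ iz|b y Ib]; first by rewrite scaler0.
  by rewrite scalerDr iy iz addr0.
by rewrite scalerA ideal_mul0 // scale0r.
Qed.

(** The inclusion k : K -> P of a syzygy has a retraction h modulo I2K.  If k x
lies in I1P, then x - h (k x) lies in I2K, and its image lies in I1P and in I2P,
so it vanishes; hence x = h (k x) lies in I1K.  Both hypotheses pass to K. *)
Lemma torfree_other_ideal (X : modcat Z) : torfree (ideal_sub I2 Z) X -> proj (quo I2 X) ->
  torfree (ideal_sub I1 Z) X.
Proof.
move=> tX pX; pose D Y := torfree (ideal_sub I2 Z) Y /\ proj (quo I2 Y).
apply: (torfree_coind (D := D)); last by split.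
move=> {tX pX} {}X [tX qX]; have [K [P [[k [p S]] pP tK]]] := torfree_cov tX.
have [qK [h hh hE]] := quo_split S pP (torfree_torfree1 tX) qX.
have hk : hom k by case: S.
split; last by exists K, P; split=> //; exists k, p.
apply: (torfree1_pres S pP) => x i1.
have i1h : imul I1 (h (k x)) := imul_hom hh i1.
suff : x - h (k x) = 0 by move/eqP; rewrite subr_eq0 => /eqP->.
have [_ _ ki _ _] := S; apply: ki; rewrite (homf0 hk).
apply: (proj_imul_cap I1I2 pP).
  by rewrite (homB hk); apply: imulB => //; exact: (imul_hom hk i1h).
apply: (imul_hom hk); rewrite -opprB -sub0r; apply: imulB => //; exact: imul0.
Qed.

Lemma retraction_split (J : ideal R) (K N X : modcat J) (i : car K -> car N)
    (g : car N -> car X) (r : car N -> car K) :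
  ses i g -> hom r -> (forall k, r (i k) = k) -> retract X N.
Proof.
move=> [hi hg ii sg ex] hr ri; have [t tE] := choice sg.
pose s x := t x - i (r (t x)).
have sE y : s (g y) = y - i (r y).
  have [k kE] : exists k, i k = t (g y) - y by apply/ex; rewrite (homB hg) tE subrr.
  have -> : s (g y) = y + (t (g y) - y) - i (r (y + (t (g y) - y))).
    by rewrite [y + _]addrC subrK.
  by rewrite -kE (homD hr) ri (homD hi) opprD addrACA subrr addr0.
exists s, g; split=> //.
  move=> a x y; have [x' <-] := sg x; have [y' <-] := sg y.
  by rewrite -hg !sE hr hi scalerBr opprD addrACA.
move=> x; rewrite /s (homB hg) tE; have -> : g (i (r (t x))) = 0; last exact: subr0.
by apply/ex; exists (r (t x)).
Qed.

(** Patching in the sense of Milnor.  If h1 and h2 are retractions of i : K -> P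
up to I1K and I2K, then (1 - h2 i)(1 - h1 i) maps K into I1 I2 K = 0. *)
Lemma proj_patch (K P X : modcat Z) : short K P X -> proj P ->
  torfree1 (ideal_sub I1 Z) X -> torfree1 (ideal_sub I2 Z) X ->
  proj (quo I1 X) -> proj (quo I2 X) -> proj X.
Proof.
move=> [i [g S]] pP t1 t2 q1 q2.
have [_ [h1 hh1 h1E]] := quo_split S pP t1 q1.
have [_ [h2 hh2 h2E]] := quo_split S pP t2 q2.
have hi : hom i by case: S.
(* 1 - h i = (1 - h2 i)(1 - h1 i) *)
pose h y := h1 y + h2 (y - i (h1 y)).
have hh : hom h.
  apply: hom_add hh1 (hom_comp (hom_sub (hom_id _) (hom_comp hh1 hi)) hh2).
apply: (proj_retract (B := P)) => //.
apply: (retraction_split S hh) => x.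
have phi0 z : imul I1 z -> h2 (i z) = z.
  elim=> [|u v _ iu _ iv|a u Ia]; first by rewrite (homf0 hi) (homf0 hh2).
    by rewrite (homD hi) (homD hh2) iu iv.
  apply/eqP; rewrite -subr_eq0 (linZ hi) (linZ hh2) -scalerBr.
  by rewrite (imul_mul0 Ia) // ; exact: h2E.
rewrite /h; have -> : i x - i (h1 (i x)) = i (x - h1 (i x)) by rewrite (homB hi).
rewrite phi0; first by rewrite addrC subrK.
rewrite -opprB -sub0r; apply: imulB => //; exact: imul0.
Qed.

End Patching.

Section Milnor.
Variables (R : pzRingType) (I1 I2 : ideal R).
Hypothesis I1I2 : forall x : R, x \in I1 -> x \in I2 -> x = 0.
Let Z := zero_ideal R.

(** The order of the two reductions matters: only projectivity modulo I2 makes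
the syzygy torfree for I1. *)
Theorem pd_le_milnor s t (X : modcat Z) n : perf n X -> torfree (ideal_sub I2 Z) X ->
  (forall m (Y : modcat I1), perf m Y -> pd s Y) ->
  (forall m (Y : modcat I2), perf m Y -> pd t Y) -> pd (t + s) X.
Proof.
move=> dX tX s1 s2.
have [Y sY [m dY]] := perf_syz t dX.
have [tY qY] := quo_syz sY tX (s2 _ _ (quo_perf tX dX)).
have t1Y := torfree_other_ideal I1I2 tY qY.
have [W sW [k dW]] := perf_syz s dY.
have [t1W q1W] := quo_syz sW t1Y (s1 _ _ (quo_perf t1Y dY)).
have [t2W q2W] := quo_syz sW tY (gdim_leq (self_cover (@zero_proj _)) (leq0n s) qY).
apply: syz_pd sY _; rewrite -[s]addn0; apply: syz_pd sW _.
have [K [P [sW' [pP _] _]]] := perf_cov dW.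
exact: (proj_patch I1I2 sW' pP (torfree_torfree1 t1W) (torfree_torfree1 t2W) q1W q2W).
Qed.

End Milnor.

(** * From R and R/(I1 + I2) to R/I1 *)

Section Products.
Variables (R : pzRingType) (J : ideal R).

Lemma kprod_subproof (A B : kmod J) a (x : (A * B)%type) : a \in J -> a *: x = 0.
Proof. by move=> Ja; case: x => x y; congr (_, _); exact: kmodP. Qed.
Definition kprod (A B : modcat J) : modcat J := KMod (@kprod_subproof A B).

Lemma kprod_short (A B : modcat J) : short A (kprod A B) B.
Proof.
exists (fun a => (a, 0)), snd; split=> //.
- by move=> a x y; congr (_, _); rewrite /= scaler0 addr0.
- by move=> x y [].
- by move=> y; exists (0, y).
- move=> [x y]; split=> [/= ->|[a []] //]; first by exists x.
Qed.

Lemma kprod_retract (A B : modcat J) : retract A (kprod A B).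
Proof.
exists (fun a => (a, 0)), fst; split=> //.
by move=> a x y; congr (_, _); rewrite /= scaler0 addr0.
Qed.

Lemma kprod_map (X A B : modcat J) (f : car X -> car A) (g : car X -> car B) :
  hom f -> hom g -> @hom (modcat J) X (kprod A B) (fun x => (f x, g x)).
Proof. by move=> hf hg a x y; congr (_, _); [exact: hf | exact: hg]. Qed.

Lemma imul_pair (I : ideal R) (A B : lmodType R) (x : (A * B)%type) :
  imul I x <-> imul I x.1 /\ imul I x.2.
Proof.
split=> [ix|[]].
  by split; [exact: (@imul_hom _ I (A * B)%type A fst) | exact: (@imul_hom _ I (A * B)%type B snd)].
case: x => a b /= ia ib.
have -> : (a, b) = (a, 0) + (0, b) :> (A * B)%type by congr (_, _); rewrite /= ?addr0 ?add0r.
apply: imulD.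
  apply: (@imul_hom _ I A (A * B)%type (fun a => (a, 0))) ia => c x y.
  by congr (_, _); rewrite /= scaler0 addr0.
apply: (@imul_hom _ I B (A * B)%type (fun b => (0, b))) ib => c x y.
by congr (_, _); rewrite /= scaler0 addr0.
Qed.

Lemma pd_cover n (X : modcat J) : pd n X -> exists K P, short K P X /\ proj P.
Proof.
case: n => [pX|n [_ [K [P [S pP _]]]]]; last by exists K, P.
by have [Z _ S] := short_zero X; exists Z, X.
Qed.

End Products.

Section IdealSum.
Variables (R : pzRingType) (I1 I2 : ideal R).
Let M := ideal_add I1 I2.

Lemma ideal_add_l a : a \in I1 -> a \in M.
Proof. by move=> Ia; apply/asboolP; exists a, 0; rewrite Defs.ideal0 addr0. Qed.
Lemma ideal_add_r a : a \in I2 -> a \in M.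
Proof. by move=> Ia; apply/asboolP; exists 0, a; rewrite Defs.ideal0 add0r. Qed.

Fact quoM_ok (X : kmod I1) a (x : X) : a \in M -> imul I2 (a *: x).
Proof.
move=> /asboolP[b [c [Ib Ic ->]]]; rewrite scalerDl (kmodP _ Ib) add0r.
exact: imulZ.
Qed.
Definition quoM : modcat I1 -> modcat M := kquo quoM_ok.

Lemma quoM_perf n X : torfree (ideal_sub I2 I1) X -> perf n X -> perf n (quoM X).
Proof. exact: (kquo_perf ideal_add_l ideal_add_r). Qed.
Lemma quoM_syz n X Y : syz n X Y -> torfree (ideal_sub I2 I1) X -> pd n (quoM X) ->
  torfree (ideal_sub I2 I1) Y /\ proj (quoM Y).
Proof. exact: (kquo_syz ideal_add_l ideal_add_r). Qed.

Lemma quoM_split (K P X : modcat I1) (k : car K -> car P) (p : car P -> car X) :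
  ses k p -> proj P -> torfree1 (ideal_sub I2 I1) X -> proj (quoM X) ->
  proj (quoM K) /\ exists2 h : car P -> car K, hom h & forall x, imul I2 (h (k x) - x).
Proof. exact: (kquo_split ideal_add_l ideal_add_r). Qed.

(** In K_0(M), M = R/(I1 + I2), the class of Y/I2Y is the alternating sum of
the reductions of a resolution of Y over R/I1, so it is a difference of classes that
lift.  The pair (u1, u2) : D -> Y + D' is an isomorphism modulo I2; passing from a
syzygy of Y to Y exchanges the roles of D and D'. *)
Lemma stable_lift n (Y : modcat I1) : perf n Y -> torfree (ideal_sub I2 I1) Y ->
  proj (quoM Y) ->
  exists (D D' : modcat I1) (u1 : car D -> car Y) (u2 : car D -> car D'),
  [/\ fgp D /\ fgp D', hom u1 /\ hom u2,
    forall x, imul I2 (u1 x) -> imul I2 (u2 x) -> imul I2 x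
    & forall y e, exists x, imul I2 (y - u1 x) /\ imul I2 (e - u2 x)].
Proof.
elim: n Y => [|n IH] Y dY tY qY.
  exists Y, (zero_kmod I1), id, (fun=> 0); split=> //.
  - by split=> //; apply: zero_fgp; exact: zero_kmod0.
  - by split; [exact: hom_id | exact: hom_zero].
  - move=> y e; exists y; rewrite subrr [e - 0]zero_kmod0.
    by split; exact: imul0.
have [_ [K [P [[k [p S]] [pP fP] dK]]]] := dY.
have [qK [h hh hE]] := quoM_split S pP (torfree_torfree1 tY) qY.
have [hk hp _ sp exp] := S.
have sK : short K P Y by exists k, p.
have [D [D' [v1 [v2 [[[pD fD] [pD' fD']] [hv1 hv2] vi vs]]]]] :=
  IH K dK (torfree_syz sK pP tY) qK.
(* by induction (v1, v2) : D -> K + D' is an isomorphism modulo I2, and P/I2P is the sum of Y/I2Y and K/I2K, through h *)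
pose D1 := kprod P D'.
have pD1 : fgp D1 by apply: fgp_ext (kprod_short _ _) _ _; split.
have hfst : @hom (modcat I1) D1 P fst by [].
have hsnd : @hom (modcat I1) D1 D' snd by [].
pose T := kres ideal_add_l (quoM (kprod K D')).
have hg : @hom (modcat I1) D T (fun d => qpi I2 ((v1 d, v2 d) : kmod_of (kprod K D'))).
  exact: (hom_comp (c := modcat I1) (A := D) (B := kprod K D') (C := T)
    (kprod_map hv1 hv2) (@qpi_linear _ I2 _)).
have hf : @hom (modcat I1) D1 T (fun x => qpi I2 ((h x.1, x.2) : kmod_of (kprod K D'))).
  have h1 : @hom (modcat I1) D1 K (fun x => h x.1) := hom_comp hfst hh.
  exact: (hom_comp (c := modcat I1) (A := D1) (B := kprod K D') (C := T)
    (kprod_map h1 hsnd) (@qpi_linear _ I2 _)).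
have sg : @surj (modcat I1) D T (fun d => qpi I2 ((v1 d, v2 d) : kmod_of (kprod K D'))).
  move=> y; have [[z e] <-] := qpi_surj y; have [d [d1 d2]] := vs z e.
  exists d; apply/esym/qpi_eq; exact/imul_pair.
have [w hw wE] := pD1.1 _ _ _ _ hg sg hf.
have {wE}wE x : imul I2 (v1 (w x) - h x.1) /\ imul I2 (v2 (w x) - x.2).
  by have /qpi_eq/imul_pair[] := wE x.
exists D1, D, (fun x => p x.1), w; split=> //.
- by split=> //; exact: hom_comp hfst hp.
- move=> [x d] /= ip iw; apply/imul_pair.
  have iv1 : imul I2 (v1 (w (x, d))) := imul_hom hv1 iw.
  have iv2 : imul I2 (v2 (w (x, d))) := imul_hom hv2 iw.
  have [/= w1 w2] := wE (x, d).
  have ih : imul I2 (h x).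
    by rewrite -[h x](subKr (v1 (w (x, d)))); apply: imulB.
  have id : imul I2 d by rewrite -[d](subKr (v2 (w (x, d)))); apply: imulB.
  split=> //=; have [y iy yE] := imul_surj hp sp ip.
  have [z zE] : exists z, k z = x - y by apply/exp; rewrite (homB hp) yE subrr.
  have -> : x = k z + y by rewrite zE subrK.
  apply: imulD => //; apply: (imul_hom hk).
  rewrite -[z](subKr (h (k z))); apply: imulB => //.
  by rewrite zE (homB hh); apply: imulB => //; apply: imul_hom iy.
- move=> y e; have [x0 <-] := sp y.
  pose x := x0 + k (v1 e - h x0).
  have px : p x = p x0.
    rewrite /x (homD hp); have -> : p (k (v1 e - h x0)) = 0; last exact: addr0.
    by apply/exp; exists (v1 e - h x0).
  exists (x, v2 e); rewrite /= px subrr; split; first exact: imul0.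
  have [/= w1 w2] := wE (x, v2 e).
  have hx : imul I2 (h x - v1 e).
    have -> : h x - v1 e = h (k (v1 e - h x0)) - (v1 e - h x0).
      by rewrite /x (homD hh) opprB [RHS]addrA (addrC (h x0)).
    exact: hE.
  apply: vi.
    rewrite (homB hv1) -opprB -(subrKA (h x)) -sub0r; apply: imulB; first exact: imul0.
    exact: imulD.
  by rewrite (homB hv2) -opprB -sub0r; apply: imulB; first exact: imul0.
Qed.

End IdealSum.

Section ToQuotientRing.
Variables (R : pzRingType) (I1 I2 : ideal R).
Hypothesis I1I2 : forall x : R, x \in I1 -> x \in I2 -> x = 0.
Let Z := zero_ideal R.
Let M := ideal_add I1 I2.
Let res : modcat I1 -> modcat Z := kres (@zero_ideal_sub R I1).
Let torfree2 : modcat Z -> Prop := torfree (ideal_sub I2 Z).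

(** With F -> Y a projective cover over R, let W be the pullback of F and D over
Y.  As u is an isomorphism modulo I2, W/I2W = F/I2F is projective, so W is torfree
for I1 and W/I1W has dimension at most p over R/I1.  The sequence
0 -> W/I1W -> F/I1F + D -> Y -> 0 is exact because every element of F is congruent
modulo I2F to one that comes from W, and I1 I2 = 0. *)
Lemma pd_of_lift p (Y D : modcat I1) (u : car D -> car Y) : hom u ->
  (forall x, imul I2 (u x) -> imul I2 x) ->
  (forall y, exists x, imul I2 (y - u x)) ->
  proj D -> pd p (res D) -> torfree2 (res D) -> pd p (res Y) -> torfree2 (res Y) ->
  pd p.+1 Y.
Proof.
move=> hu ui us pD dD tD dY tY.
have [L [F [[l [g S]] pF]]] := pd_cover dY; have [_ hg _ sg exg] := S.
have hu' : @hom (modcat Z) (res D) (res Y) u := hu.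
have [W [p1 [p2 [hp1 hp2 pE pinj _]]]] := has_pullback hg hu'.
have gu w : g (p1 w) = u (p2 w) by apply/pE; exists w.
pose FD := kprod F (res D).
have hFD : @hom (modcat Z) FD (res Y) (fun x => g x.1 - u x.2).
  by apply: hom_sub; [exact: (hom_comp (c := modcat Z) (A := FD) (B := F) (f := fst))
    | exact: (hom_comp (c := modcat Z) (A := FD) (B := res D) (f := snd))].
have SW : @ses (modcat Z) W FD (res Y) (fun w => (p1 w, p2 w)) (fun x => g x.1 - u x.2).
  split=> //.
  - exact: kprod_map.
  - by move=> x y [e1 e2]; exact: pinj.
  - move=> y; have [x xE] := sg y; exists (x, 0) => /=.
    by rewrite (homf0 hu) subr0.
  - move=> [x d] /=; split=> [/eqP|[w [<- <-]]]; last by rewrite gu subrr.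
    by rewrite subr_eq0 => /eqP/pE[w [<- <-]]; exists w.
have sW : short W FD (res Y) by exists (fun w => (p1 w, p2 w)), (fun x => g x.1 - u x.2).
have dW : pd p W.
  apply: (gdim_kernel (pd_theory _) sW); last exact: (gdimS (self_cover (@zero_proj _)) dY).
  by apply: (gdim_ext (pd_theory _) (kprod_short _ _)) => //; exact: gdimC (pd_theory _) _ _ pF.
have tW : torfree2 W.
  apply: (torfree_kernel sW) => //.
  by apply: torfree_ext (kprod_short _ _) _ _ => //; exact: proj_torfree.
(* reduction modulo I2 turns W -> F into an isomorphism *)
have qW : proj (quo I2 W).
  have [h hh hE] := kquo_map (@quo_ok R I2) hp1.
  apply: (proj_retract (B := quo I2 F)); last exact: quo_proj.
  have [//||//] := @bij_retract (modcat I2) (quo I2 W) (quo I2 F) h hh.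
    apply: hom_inj => // x; have [w <-] := qpi_surj x; rewrite hE => /qpi_eq0 i1.
    apply/qpi_eq0/(torfree_torfree1 tY SW)/imul_pair; split=> //=.
    by apply: ui; rewrite -gu; apply: imul_hom i1.
  move=> x; have [y <-] := qpi_surj x; have [d id] := us (g y).
  have [z iz zE] := imul_surj hg sg id.
  have [w [w1 _]] : exists w, p1 w = y - z /\ p2 w = d.
    by apply/pE; rewrite (homB hg) zE subKr.
  exists (qpi I2 w); rewrite hE w1; apply/qpi_eq/imulN.
  by rewrite opprB opprB addrC subrK.
have t1W := torfree_other_ideal I1I2 tW qW.
have dW1 : pd p (quo I1 W) := quo_pd t1W dW.
have imW x : imul I1 x -> exists2 w, imul I1 w & p1 w = x /\ p2 w = 0.
  elim=> [|y z _ [v iv [v1 v2]] _ [w iw [w1 w2]]|a y Ia].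
  - by exists 0; [exact: imul0 | rewrite (homf0 hp1) (homf0 hp2)].
  - exists (v + w); first exact: imulD.
    by rewrite (homD hp1) (homD hp2) v1 v2 w1 w2 addr0.
  - have [d id] := us (g y); have [z iz zE] := imul_surj hg sg id.
    have [w [w1 _]] : exists w, p1 w = y - z /\ p2 w = d.
      by apply/pE; rewrite (homB hg) zE subKr.
    exists (a *: (w : kmod_of W)); first exact: imulZ.
    rewrite (linZ hp1) (linZ hp2) w1 scalerBr (imul_mul0 I1I2 Ia iz) subr0.
    by split=> //; exact: (@kmodP R I1 D a (p2 w) Ia).
pose T := kprod (quo I1 F) D.
have hT : linear (fun w : kmod_of W => (qpi I1 (p1 w), p2 w) : kmod_of T).
  by move=> a x y; congr (_, _); rewrite ?hp1 ?hp2 ?(@qpi_linear _ I1).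
have [|i hi iE] := qmod_desc (I := I1) hT.
  move=> w iw; congr (_, _).
    by apply/qpi_eq0; apply: imul_hom iw.
  by apply: (imul_kmod (X := D)) (imul_hom hp2 iw).
have [|g' hg' g'E] := qmod_desc (I := I1) (Z := kmod_of Y) hg.
  by move=> x ix; apply: (imul_kmod (X := Y)) (imul_hom hg ix).
have hs : @hom (modcat I1) T Y (fun x => g' x.1 - u x.2).
  by apply: hom_sub; [exact: (hom_comp (c := modcat I1) (A := T) (B := quo I1 F) (f := fst))
    | exact: (hom_comp (c := modcat I1) (A := T) (B := D) (f := snd))].
split=> //; exists (quo I1 W), T; split=> //; last first.
  by apply: proj_ext (kprod_short _ _) _ pD; exact: quo_proj.
exists i, (fun x => g' x.1 - u x.2); split=> //.
- apply: (@hom_inj (modcat I1) (quo I1 W) T i hi) => x.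
  have [w <-] := qpi_surj x; rewrite iE => -[/qpi_eq0/imW[w' iw' [w1 w2]] pw].
  by apply/qpi_eq0; rewrite (_ : w = w') //; apply: pinj; rewrite ?w1 ?w2.
- move=> y; have [x xE] := sg y; exists (qpi I1 x, 0) => /=.
  by rewrite g'E (homf0 hu) subr0.
- move=> [x d] /=; split=> [|[w']].
    have [y <-] := qpi_surj x; rewrite g'E => /eqP; rewrite subr_eq0 => /eqP/pE.
    by move=> [w [<- <-]]; exists (qpi I1 w).
  by have [w <-] := qpi_surj w'; rewrite iE => -[<- <-]; rewrite g'E gu subrr.
Qed.

Variables (p k : nat).
Hypothesis S_pd : pd p (res (regmod I1)).
Hypothesis S_perf : perf k (res (regmod I1)).
Hypothesis S_torfree : torfree2 (res (regmod I1)).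

(** R/I1 has these properties, and finitely generated projectives are retracts
of its powers. *)
Lemma res_fgp P : fgp P -> [/\ pd p (res P), perf k (res P) & torfree2 (res P)].
Proof.
pose D X := [/\ pd p (res X), perf k (res X) & torfree2 (res X)].
apply: (fgp_class (D := D)) => [X X0||A B N s [a1 a2 a3] [n1 n2 n3]|A B r [a1 a2 a3]].
- have Z0 : is_zero (res X) := X0.
  split; [exact: gdimC (pd_theory _) _ _ (zero_proj Z0)| |exact: proj_torfree (zero_proj Z0)].
  exact: gdimC (perf_theory _) _ _ (zero_fgp Z0).
- by split.
- have s' := kres_short (@zero_ideal_sub R I1) s; split.
  + exact: gdim_ext (pd_theory _) _ _ _ _ s' a1 n1.
  + exact: gdim_ext (perf_theory _) _ _ _ _ s' a2 n2.
  + exact: torfree_ext s' a3 n3.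
- have r' := kres_retract (@zero_ideal_sub R I1) r; split.
  + exact: gdim_retract (pd_theory _) _ _ _ r' a1.
  + exact: gdim_retract (perf_theory _) _ _ _ r' a2.
  + exact: torfree_retract r' a3.
Qed.

Lemma res_perf n Y : perf n Y -> perf (n + k) (res Y).
Proof.
elim: n Y => [|n IH] Y; first by case/res_fgp.
move=> [_ [K [P [s fP dK]]]]; have [_ dP _] := res_fgp fP.
apply: (gdim_cokernel_any (perf_theory _) (kres_short (@zero_ideal_sub R I1) s) (IH _ dK)).
by apply: (gdim_leq (self_cover (@zero_fgp _))) dP; rewrite leqW // leq_addl.
Qed.

(** A presentation over R/I1 is also one over R. *)
Lemma torfree_of_res n Y : perf n Y -> torfree2 (res Y) -> torfree (ideal_sub I2 I1) Y.
Proof.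
move=> dY tY; apply: (torfree_coind (D := fun Y => (exists n, perf n Y) /\ torfree2 (res Y))); last first.
  by split=> //; exists n.
move=> {n dY tY}{}Y [[n dY] tY]; split.
  exact: (kres_torfree1 (torfree_torfree1 tY)).
have [K [P [s fP dK]]] := perf_cov dY; exists K, P; split=> //; first by case: fP.
split; first by exists n.-1.
have [_ _ tP] := res_fgp fP.
exact: torfree_kernel (kres_short (@zero_ideal_sub R I1) s) tP tY.
Qed.

Lemma res_exact K P X : short K P X -> fgp P -> any X ->
  any K /\ short (res K) (res P) (res X).
Proof. by move=> S _ _; split=> //; exact: kres_short. Qed.

Lemma res_syz n Y Y' : syz n Y Y' -> pd (n + p) (res Y) -> pd p (res Y').
Proof.
move=> s d; have FP P : fgp P -> pd p (res P) by case/res_fgp.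
by have [] := syz_functor (pd_theory _) (self_cover (@zero_proj _)) res_exact FP I s d.
Qed.

Lemma res_syz_tf n Y Y' : syz n Y Y' -> gdim any proj torfree2 n (res Y) -> torfree2 (res Y').
Proof.
move=> s; rewrite -(addn0 n) => d.
have FP P : fgp P -> gdim any proj torfree2 0 (res P) by case/res_fgp.
by have [] := syz_functor (torfree_theory _) (@torfree_cov _ _) res_exact FP I s d.
Qed.

(** The R-projective dimension drops to p after r syzygies and stays there,
while Tor over R vanishes in degrees above r. *)
Theorem pd_quotient_ring r m n (Y : modcat I1) : perf n Y ->
  (forall j (X : modcat Z), perf j X -> pd r X) ->
  (forall j (X : modcat M), perf j X -> pd m X) ->
  pd (r + (m + p.+1)) Y.
Proof.
move=> dY HR HM.
have dr : pd r (res Y) := HR _ _ (res_perf dY).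
have leq := gdim_leq (self_cover (@zero_proj (modcat Z))).
have [Y1 s1 [n1 dY1]] := perf_syz r dY.
have p1 : pd p (res Y1) by apply: res_syz s1 (leq _ _ _ _ dr); exact: leq_addr.
have t1 : torfree2 (res Y1) := res_syz_tf s1 (pd_torfree_dim _ dr).
have tI := torfree_of_res dY1 t1.
have [Y2 s2 [n2 dY2]] := perf_syz m dY1.
have p2 : pd p (res Y2) by apply: res_syz s2 (leq _ _ _ _ p1); exact: leq_addl.
have t2 : torfree2 (res Y2).
  apply: res_syz_tf s2 _.
  exact: (gdim_leq (@torfree_cov _ _) (leq0n m) (t1 : gdim any proj torfree2 0 (res Y1))).
have [tI2 q2] := quoM_syz s2 tI (HM _ _ (quoM_perf tI dY1)).
apply: syz_pd s1 _; apply: syz_pd s2 _.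
have [D [D' [u1 [u2 [[fD fD'] [hu1 hu2] ui us]]]]] := stable_lift dY2 tI2 q2.
apply: (gdim_retract (pd_theory _) (kprod_retract Y2 D')).
have sY := kprod_short Y2 D'.
have sY' := kres_short (@zero_ideal_sub R I1) sY.
have [pD1 _ pD3] := res_fgp fD; have [pD'1 _ pD'3] := res_fgp fD'.
apply: (@pd_of_lift p (kprod Y2 D') D (fun x => (u1 x, u2 x)) (kprod_map hu1 hu2) _ _ _ pD1 pD3).
- by move=> x /imul_pair[/= i1 i2]; exact: ui.
- move=> [y e]; have [x [x1 x2]] := us y e; exists x; exact/imul_pair.
- by case: fD.
- exact: gdim_ext (pd_theory _) _ _ _ _ sY' p2 pD'1.
- exact: torfree_ext sY' t2 pD'3.
Qed.

End ToQuotientRing.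

(** * Modules over a triangular matrix ring *)

Section Rep.
Variables (R : pzRingType) (I1 I2 : ideal R).
Let M := ideal_add I1 I2.

(** A left module over the triangular matrix ring with diagonal entries R/I1,
R/I2 and corner R/(I1 + I2) is an R/I1-module U, an R/I2-module V and an R-linear map
from V to U. *)
Record rep := Rep {
  rV : kmod I2;
  rU : kmod I1;
  rphi : rV -> rU;
  rphi_linear : linear rphi }.

Definition rcar (N : rep) : zmodType := (rV N * rU N)%type.

Definition rhom (A B : rep) (f : rcar A -> rcar B) : Prop :=
  exists (fV : rV A -> rV B) (fU : rU A -> rU B),
  [/\ linear fV, linear fU, forall v, fU (rphi v) = rphi (fV v)
    & forall x, f x = (fV x.1, fU x.2)].

Section PB.
Variables (A B X : rep) (fV : {linear rV A -> rV X}) (fU : {linear rU A -> rU X}).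
Variables (gV : {linear rV B -> rV X}) (gU : {linear rU B -> rU X}).
Hypothesis fE : forall v, fU (rphi v) = rphi (fV v).
Hypothesis gE : forall v, gU (rphi v) = rphi (gV v).
Lemma rpb_subproof (x : pbmod fV gV) :
  (rphi (pb1 x), rphi (pb2 x)) \in pb_pred fU gU.
Proof. by rewrite inE /= fE gE pbE. Qed.
Definition rpb_phi (x : pbmod fV gV) : pbmod fU gU :=
  exist _ (rphi (pb1 x), rphi (pb2 x)) (rpb_subproof x).
Lemma rpb_linear : linear rpb_phi.
Proof.
by move=> a x y; apply: pb_inj; [exact: (@rphi_linear A) | exact: (@rphi_linear B)].
Qed.
Definition rpb : rep := @Rep (KMod (@pb_kmodP _ _ _ _ _ fV gV))
  (KMod (@pb_kmodP _ _ _ _ _ fU gU)) rpb_phi rpb_linear.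
End PB.

Lemma rpullback (A B X : rep) (f : rcar A -> rcar X) (g : rcar B -> rcar X) :
  rhom f -> rhom g ->
  exists (W : rep) (p : rcar W -> rcar A) (q : rcar W -> rcar B),
  [/\ rhom p, rhom q,
      forall a b, f a = g b <-> exists w, p w = a /\ q w = b,
      forall x y, p x = p y -> q x = q y -> x = y
    & forall (D : rep) (h : rcar D -> rcar W), rhom (p \o h) -> rhom (q \o h) -> rhom h].
Proof.
move=> [fV [fU [lfV lfU fVU fE]]] [gV [gU [lgV lgU gVU gE]]].
pose W := @rpb A B X (mklin lfV) (mklin lfU) (mklin lgV) (mklin lgU) fVU gVU.
pose p (x : rcar W) : rcar A :=
  (@pb1 _ _ _ _ (mklin lfV) (mklin lgV) x.1, @pb1 _ _ _ _ (mklin lfU) (mklin lgU) x.2).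
pose q (x : rcar W) : rcar B :=
  (@pb2 _ _ _ _ (mklin lfV) (mklin lgV) x.1, @pb2 _ _ _ _ (mklin lfU) (mklin lgU) x.2).
exists W, p, q; split=> //.
- by exists (@pb1 _ _ _ _ (mklin lfV) (mklin lgV)), (@pb1 _ _ _ _ (mklin lfU) (mklin lgU)).
- by exists (@pb2 _ _ _ _ (mklin lfV) (mklin lgV)), (@pb2 _ _ _ _ (mklin lfU) (mklin lgU)).
- move=> [a1 a2] [b1 b2]; rewrite fE gE /=; split=> [[e1 e2]|[[w1 w2] [[<- <-] [<- <-]]]].
    have [w1 [w1a w1b]] := @pb_ex _ _ _ _ (mklin lfV) (mklin lgV) _ _ e1.
    have [w2 [w2a w2b]] := @pb_ex _ _ _ _ (mklin lfU) (mklin lgU) _ _ e2.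
    by exists (w1, w2); split; congr (_, _).
  congr (_, _); first exact: (@pbE _ _ _ _ (mklin lfV) (mklin lgV)).
  exact: (@pbE _ _ _ _ (mklin lfU) (mklin lgU)).
- by move=> [x1 x2] [y1 y2] [e1 e2] [e3 e4]; congr (_, _); apply: pb_inj.
- move=> D h [pV [pU [lpV lpU pVU pE]]] [qV [qU [lqV lqU qVU qE]]].
  have pE1 x : pb1 (h x).1 = pV x.1 by have [] := pE x.
  have pE2 x : pb1 (h x).2 = pU x.2 by have [] := pE x.
  have qE1 x : pb2 (h x).1 = qV x.1 by have [] := qE x.
  have qE2 x : pb2 (h x).2 = qU x.2 by have [] := qE x.
  exists (fun v => (h (v, 0)).1), (fun u => (h (0, u)).2); split.
  + move=> a x y; apply: pb_inj.
      by rewrite pE1 /= lpV -[pV x](pE1 (x, 0)) -[pV y](pE1 (y, 0)).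
    by rewrite qE1 /= lqV -[qV x](qE1 (x, 0)) -[qV y](qE1 (y, 0)).
  + move=> a x y; apply: pb_inj.
      by rewrite pE2 /= lpU -[pU x](pE2 (0, x)) -[pU y](pE2 (0, y)).
    by rewrite qE2 /= lqU -[qU x](qE2 (0, x)) -[qU y](qE2 (0, y)).
  + move=> v; apply: pb_inj.
      by rewrite pE2 /= pVU -[pV v](pE1 (v, 0)).
    by rewrite qE2 /= qVU -[qV v](qE1 (v, 0)).
  + move=> x; rewrite [LHS]surjective_pairing; congr (_, _); apply: pb_inj.
    * by rewrite !pE1.
    * by rewrite !qE1.
    * by rewrite !pE2.
    * by rewrite !qE2.
Qed.

Lemma rhom_mono (A B X : rep) (i : rcar B -> rcar X) (h : rcar A -> rcar B) :
  rhom i -> injective i -> rhom (i \o h) -> rhom h.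
Proof.
move=> [iV [iU [liV liU iVU iE]]] ii [gV [gU [lgV lgU gVU gE]]].
have iVi : injective iV.
  move=> x y xy; have := ii (x, 0) (y, 0); rewrite !iE /= xy => /(_ erefl).
  by case.
have iUi : injective iU.
  move=> x y xy; have := ii (0, x) (0, y); rewrite !iE /= xy => /(_ erefl).
  by case.
have gE1 x : iV (h x).1 = gV x.1 by have := gE x; rewrite /= iE => -[].
have gE2 x : iU (h x).2 = gU x.2 by have := gE x; rewrite /= iE => -[].
exists (fun v => (h (v, 0)).1), (fun u => (h (0, u)).2); split.
- move=> a x y; apply: iVi.
  by rewrite gE1 /= lgV liV -[gV x](gE1 (x, 0)) -[gV y](gE1 (y, 0)).
- move=> a x y; apply: iUi.
  by rewrite gE2 /= lgU liU -[gU x](gE2 (0, x)) -[gU y](gE2 (0, y)).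
- by move=> v; apply: iUi; rewrite gE2 /= gVU iVU -[gV v](gE1 (v, 0)).
- move=> x; rewrite [LHS]surjective_pairing; congr (_, _).
    by apply: iVi; rewrite !gE1.
  by apply: iUi; rewrite !gE2.
Qed.

Definition rfin (N : rep) := finitely_generated (rV N) /\ finitely_generated (rU N).

Lemma rhomB (A B : rep) (f : rcar A -> rcar B) : rhom f -> {morph f : x y / x - y}.
Proof.
by move=> [fV [fU [lV lU _ fE]]] x y; rewrite !fE /= (linB lV) (linB lU).
Qed.

Definition repcat : category.
refine (@Category rep rcar rhom rfin rhomB _ _ _ _ rhom_mono _ rpullback _ _ _).
- by move=> A; exists id, id; split=> // -[].
- move=> A B X f g [fV [fU [lfV lfU fVU fE]]] [gV [gU [lgV lgU gVU gE]]].
  exists (gV \o fV), (gU \o fU); split=> [a x y|a x y|v|x] /=.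
  + by rewrite lfV lgV.
  + by rewrite lfU lgU.
  + by rewrite fVU gVU.
  + by rewrite fE gE.
- move=> A B; exists (fun=> 0), (fun=> 0); split=> //; try exact: zero_linear.
  by move=> v; rewrite (lin0 (@rphi_linear B)).
- move=> A B f g [fV [fU [lfV lfU fVU fE]]] [gV [gU [lgV lgU gVU gE]]].
  exists (fun x => fV x - gV x), (fun x => fU x - gU x); split=> [a x y|a x y|v|x].
  + by rewrite lfV lgV scalerBr opprD addrACA.
  + by rewrite lfU lgU scalerBr opprD addrACA.
  + by rewrite fVU gVU (linB (@rphi_linear B)).
  + by rewrite fE gE.
- exists (@Rep (zero_kmod I2) (zero_kmod I1) _ (@zero_linear _ _ _)).
  by move=> [x y]; congr (_, _); exact: zero_kmod0.
- move=> N N0; split; apply: fg_zero => x.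
    by have [] := N0 (x, 0).
  by have [] := N0 (0, x).
- move=> A B f [fV [fU [lV lU _ fE]]] sf [fgV fgU]; split.
    apply: (fg_surj lV) fgV => y; have [x] := sf (y, 0); rewrite fE => -[<- _].
    by exists x.1.
  apply: (fg_surj lU) fgU => y; have [x] := sf (0, y); rewrite fE => -[_ <-].
  by exists x.2.
- move=> A B X f g [fV [fU [lfV lfU fVU fE]]] [gV [gU [lgV lgU gVU gE]]] sg ex.
  move=> [aV aU] [xV xU]; split.
    apply: (fg_ext lfV lgV) => // [y|y gy].
      by have [x] := sg (y, 0); rewrite gE => -[<- _]; exists x.1.
    have [|x] := ex (y, 0); first by rewrite gE /= gy (lin0 lgU).
    by rewrite fE => -[<- _]; exists x.1.
  apply: (fg_ext lfU lgU) => // [y|y gy].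
    by have [x] := sg (0, y); rewrite gE => -[_ <-]; exists x.2.
  have [|x] := ex (0, y); first by rewrite gE /= gy (lin0 lgV).
  by rewrite fE => -[_ <-]; exists x.2.
Defined.

Lemma rep_sub_hom (A B : rep) (f : rcar A -> rcar B) : rhom f ->
  forall x, imul I2 x.2 -> imul I2 (f x).2.
Proof. by move=> [fV [fU [_ lU _ fE]]] x ix; rewrite fE; apply: imul_hom ix. Qed.

Lemma rep_sub_surj (A B : rep) (f : rcar A -> rcar B) : rhom f ->
  (forall y, exists x, f x = y) ->
  forall y, imul I2 y.2 -> exists2 x, imul I2 x.2 & f x = y.
Proof.
move=> [fV [fU [lV lU _ fE]]] sf [v u] /= iu.
have sU y : exists x, fU x = y.
  by have [x] := sf (0, y); rewrite fE => -[_ <-]; exists x.2.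
have [x ix xE] := imul_surj lU sU iu.
have [w] := sf (v, 0); rewrite fE => -[wE _].
by exists (w.1, x); rewrite // fE /= wE xE.
Qed.

(** The corresponding quotient is the functor (V -> U) |-> U/I2U. *)
Definition rep_sub : subfunctor repcat := @Subfunctor repcat
  (fun A (x : rcar A) => imul I2 x.2) (fun A x y => @imulB R I2 (rU A) x.2 y.2)
  rep_sub_hom rep_sub_surj.

End Rep.

Section RepTheory.
Variables (R : pzRingType) (I1 I2 : ideal R).
Let M := ideal_add I1 I2.
Notation rc := (repcat I1 I2).
Let cV (N : rc) : modcat I2 := rV N.
Let cU (N : rc) : modcat I1 := rU N.

Lemma rep_ses (K N X : rc) (iV : car (cV K) -> car (cV N)) (gV : car (cV N) -> car (cV X))
    (iU : car (cU K) -> car (cU N)) (gU : car (cU N) -> car (cU X)) :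
  ses iV gV -> ses iU gU ->
  (forall v, iU (rphi v) = rphi (iV v)) -> (forall v, gU (rphi v) = rphi (gV v)) ->
  @ses rc K N X (fun x => (iV x.1, iU x.2)) (fun x => (gV x.1, gU x.2)).
Proof.
move=> [liV lgV iVi sV exV] [liU lgU iUi sU exU] ci cg; split.
- by exists iV, iU.
- by exists gV, gU.
- by move=> [x1 x2] [y1 y2] [/iVi-> /iUi->].
- by move=> [y1 y2]; have [x1 <-] := sV y1; have [x2 <-] := sU y2; exists (x1, x2).
- move=> [x1 x2]; split=> [[/exV[y1 <-] /exU[y2 <-]]|[[y1 y2] [<- <-]]].
    by exists (y1, y2).
  by congr (_, _); [apply/exV; exists y1 | apply/exU; exists y2].
Qed.

Lemma rep_short_V (K N X : rc) : short K N X -> short (cV K) (cV N) (cV X).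
Proof.
move=> [i [g [[iV [iU [liV liU ci iE]]] [gV [gU [lgV lgU cg gE]]] ii sg ex]]].
exists iV, gV; split=> //.
- move=> x y xy; have := ii (x, 0) (y, 0); rewrite !iE /= xy => /(_ erefl).
  by case.
- by move=> y; have [x] := sg (y, 0); rewrite gE => -[<- _]; exists x.1.
- move=> x; have e := ex (x, 0); rewrite gE /= (lin0 lgU) in e; split=> [gx|[k <-]].
    by have [|k] := iffLR e; [rewrite gx | rewrite iE => -[<- _]; exists k.1].
  have [] : (gV (iV k), gU 0) = 0; last by [].
  by rewrite -[LHS](gE (iV k, 0)); apply/ex; exists (k, 0); rewrite iE /= (lin0 liU).
Qed.

Lemma rep_short_U (K N X : rc) : short K N X -> short (cU K) (cU N) (cU X).
Proof.
move=> [i [g [[iV [iU [liV liU ci iE]]] [gV [gU [lgV lgU cg gE]]] ii sg ex]]].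
exists iU, gU; split=> //.
- move=> x y xy; have := ii (0, x) (0, y); rewrite !iE /= xy => /(_ erefl).
  by case.
- by move=> y; have [x] := sg (0, y); rewrite gE => -[_ <-]; exists x.2.
- move=> x; have e := ex (0, x); rewrite gE /= (lin0 lgV) in e; split=> [gx|[k <-]].
    by have [|k] := iffLR e; [rewrite gx | rewrite iE => -[_ <-]; exists k.2].
  have [] : (gV 0, gU (iU k)) = 0; last by [].
  by rewrite -[LHS](gE (0, iU k)); apply/ex; exists (0, k); rewrite iE /= (lin0 liV).
Qed.

Definition embT (V : modcat I2) : rc :=
  @Rep _ _ _ V (zero_kmod I1) _ (@zero_linear _ _ _).
(** The left adjoint of (V -> U) |-> U. *)
Definition embS (U : modcat I1) : rc :=
  @Rep _ _ _ (zero_kmod I2) U _ (@zero_linear _ _ _).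
(** An R/(I1 + I2)-module X, as the identity of X. *)
Definition diag (X : modcat M) : rc :=
  @Rep _ I1 I2 (kres (@ideal_add_r R I1 I2) X) (kres (@ideal_add_l R I1 I2) X) id
    (fun _ _ _ => erefl).

Lemma qmod_kmodP (I J : ideal R) (X : kmod J) a (x : qmod I X) :
  a \in I -> a *: x = 0.
Proof.
by move=> Ia; have [y <-] := qpi_surj x; rewrite -(linZ (@qpi_linear _ I X));
  apply/qpi_eq0/imulZ.
Qed.
(** The left adjoint of (V -> U) |-> V. *)
Definition can (V : modcat I2) : rc :=
  @Rep _ I1 I2 V (KMod (@qmod_kmodP I1 I2 V)) (@qpi R I1 V) (@qpi_linear _ _ _).

(** The functor (V -> U) |-> V is left adjoint to V |-> (V -> 0), which preserves
surjections. *)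
Lemma proj_V (N : rc) : proj N -> proj (cV N).
Proof.
move=> pN A B g f lg sg lf.
have [||| h [hV [hU [lhV _ _ hE]]] gh] := pN (embT A) (embT B)
  (fun x => (g x.1, 0)) (fun x => (f x.1, 0)).
- exists g, (fun=> 0); split=> //; try exact: zero_linear.
- move=> [y z]; have [x <-] := sg y; exists (x, 0); congr (_, _).
  by rewrite [z]zero_kmod0.
- exists f, (fun=> 0); split=> //; try exact: zero_linear.
- exists hV => // x; have := gh (x, 0); rewrite hE => -[]; exact.
Qed.

Lemma proj_embS (U : modcat I1) : proj U -> proj (embS U).
Proof.
move=> pU A B g f [gV [gU [lgV lgU cg gE]]] sg [fV [fU [lfV lfU cf fE]]].
have sU : @surj (modcat I1) (cU A) (cU B) gU.
  by move=> y; have [x] := sg (0, y); rewrite gE => -[_ <-]; exists x.2.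
have [h lh hE] := pU (cU A) (cU B) gU fU lgU sU lfU.
exists (fun x => (0, h x.2)).
  exists (fun=> 0), h; split=> // [|v]; first exact: zero_linear.
  by rewrite /= (lin0 lh) (lin0 (@rphi_linear _ _ _ A)).
move=> [x y]; rewrite gE fE /= (lin0 lgV) hE; congr (_, _).
by rewrite [x]zero_kmod0 (lin0 lfV).
Qed.

Lemma proj_can (V : modcat I2) : proj V -> proj (can V).
Proof.
move=> pV A B g f [gV [gU [lgV lgU cg gE]]] sg [fV [fU [lfV lfU cf fE]]].
have sV : @surj (modcat I2) (cV A) (cV B) gV.
  by move=> y; have [x] := sg (y, 0); rewrite gE => -[<- _]; exists x.1.
have [h lh hE] := pV (cV A) (cV B) gV fV lgV sV lfV.
have lh' : linear (fun v : kmod_of V => rphi (h v) : kmod_of (cU A)).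
  by move=> a x y; rewrite lh (@rphi_linear _ _ _ A).
have [|k lk kE] := qmod_desc (I := I1) lh'.
  by move=> x ix; apply: (imul_kmod (X := cU A)) (imul_hom lh' ix).
exists (fun x => (h x.1, k x.2)); first by exists h, k; split=> // v; rewrite kE.
move=> [x y]; rewrite gE fE /= hE; congr (_, _); have [z <-] := qpi_surj y.
by rewrite kE cg hE -cf.
Qed.

Lemma fgp_embS (U : modcat I1) : fgp U -> fgp (embS U).
Proof.
move=> [pU fU]; split; first exact: proj_embS.
by split=> //; apply: fg_zero; exact: zero_kmod0.
Qed.

Lemma fgp_can (V : modcat I2) : fgp V -> fgp (can V).
Proof.
move=> [pV fV]; split; first exact: proj_can.
by split=> //; apply: fg_surj (@qpi_linear _ I1 _) (@qpi_surj _ I1 _) fV.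
Qed.

Definition V_zero (N : rc) := forall v : rV N, v = 0.

Lemma V_zero_retract (N : rc) : V_zero N -> retract N (embS (cU N)).
Proof.
move=> N0; exists (fun x => (0, x.2)), (fun x => (0, x.2)); split.
- exists (fun=> 0), id; split=> //; first exact: zero_linear.
  by move=> v; rewrite (N0 v) (lin0 (@rphi_linear _ _ _ N)).
- exists (fun=> 0), id; split=> //; first exact: zero_linear.
  by move=> v; rewrite (lin0 (@rphi_linear _ _ _ N)).
- by move=> [v u]; rewrite /= (N0 v).
Qed.

Lemma proj_U_of_V_zero (N : rc) : V_zero N -> proj N -> proj (cU N).
Proof.
move=> N0 pN A B g f lg sg lf.
have [||| h [hV [hU [_ lhU _ hE]]] gh] := pN (embS A) (embS B)
  (fun x => (0, g x.2)) (fun x => (0, f x.2)).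
- exists (fun=> 0), g; split=> //; first exact: zero_linear.
  by move=> v; rewrite /= (lin0 lg).
- move=> [z y]; have [x <-] := sg y; exists (0, x); congr (_, _).
  by rewrite [z]zero_kmod0.
- exists (fun=> 0), f; split=> //; first exact: zero_linear.
  by move=> v; rewrite (N0 v) (lin0 (@rphi_linear _ _ _ N)) /= (lin0 lf).
- exists hU => // x; have := gh (0, x); rewrite hE => -[]; exact.
Qed.

Lemma embS_short (K N X : modcat I1) : short K N X ->
  short (embS K) (embS N) (embS X).
Proof.
move=> [i [g [li lg ii sg ex]]].
exists (fun x => (0, i x.2)), (fun x => (0, g x.2)).
have S0 : @ses (modcat I2) (zero_kmod I2) (zero_kmod I2) (zero_kmod I2) (fun=> 0) (fun=> 0).
  split; try exact: zero_linear.
  - by move=> x y _; rewrite [x]zero_kmod0 [y]zero_kmod0.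
  - by move=> y; exists 0; rewrite [y]zero_kmod0.
  - by move=> x; split=> // _; exists 0; rewrite [x]zero_kmod0.
apply: (@rep_ses (embS K) (embS N) (embS X) _ _ i g S0) => //.
  by move=> v; rewrite /= (lin0 li).
by move=> v; rewrite /= (lin0 lg).
Qed.

Lemma pd_embS n (U : modcat I1) : pd n U -> pd n (embS U).
Proof.
apply: (gdim_functor (F := embS) (G := any)) => //; first exact: proj_embS.
by move=> K P X S _ _; split=> //; exact: embS_short.
Qed.

(** As U is finitely generated, objects 0 -> U can be covered by objects of the
same form. *)
Lemma perf_U_of_V_zero n (N : rc) : V_zero N -> perf n N -> perf n (cU N).
Proof.
elim: n N => [|n IH] N N0.
  by move=> [pN [_ fU]]; split=> //; exact: proj_U_of_V_zero.
move=> dN; have [_ fU] := perf_fin dN.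
have [L [P [SP fP]]] := @fin_fgp_cover _ _ (cU N) fU.
have [p [g S]] := SP; have [_ lg _ sg _] := S.
have hg : @hom rc (embS P) N (fun x => (0, g x.2)).
  exists (fun=> 0), g; split=> //; first exact: zero_linear.
  by move=> v; rewrite (lin0 lg) (lin0 (@rphi_linear _ _ _ N)).
have shg : @surj rc (embS P) N (fun x => (0, g x.2)).
  by move=> [v u]; have [x <-] := sg u; exists (0, x); rewrite (N0 v).
have [K SK] := ker_short hg shg.
have dK := gdim_syz (perf_theory _) SK (fgp_embS fP) dN.
have K0 : V_zero K.
  move=> v; have [i [q [_ _ ii _ _]]] := rep_short_V SK.
  by apply: ii; rewrite [LHS]zero_kmod0 [RHS]zero_kmod0.
split=> //; exists (cU K), P; split=> //; first exact: (rep_short_U SK).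
exact: IH.
Qed.

(** After t syzygies V is projective, and then V -> V/I1V together with a cover
of U leaves a kernel of the form 0 -> U'. *)
Lemma pd_rep s t n (N : rc) : perf n N ->
  (forall m (Y : modcat I1), perf m Y -> pd s Y) ->
  (forall m (Y : modcat I2), perf m Y -> pd t Y) -> pd (t + s.+1) N.
Proof.
move=> dN s1 s2.
have FV P : fgp P -> fgp (cV P).
  by move=> [pP [fV _]]; split=> //; exact: proj_V.
have exV K P X : short K P X -> any X -> any K /\ short (cV K) (cV P) (cV X).
  by move=> S _; split=> //; exact: rep_short_V.
have dV : pd (t + 0) (cV N).
  rewrite addn0; apply: s2; apply: (gdim_functor FV (G := any)) dN => // K P X S _.
  exact: exV S.
have [N' sN' [k dN']] := perf_syz t dN.
have FP P : fgp P -> pd 0 (cV P) by case/FV.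
have exV' K P X : short K P X -> fgp P -> any X -> any K /\ short (cV K) (cV P) (cV X).
  by move=> S _; exact: exV S.
have [_ pV] := syz_functor (pd_theory (modcat I2)) (self_cover (@zero_proj _)) exV' FP I sN' dV.
apply: syz_pd sN' _; have [fV fU] := perf_fin dN'.
have [L [P [[_ [g [_ lg _ sg _]]] fP]]] := @fin_fgp_cover _ _ (cU N') fU.
have [D [p [q [[hp hq sp sq] [i [j [hi hj iE jE Si]]] pqi univ sD]]]] :=
  has_prod (can (cV N')) (embS P).
have fD : fgp D by apply: fgp_ext sD _ _; [exact: fgp_can | exact: fgp_embS].
have [c lc cE] : exists2 c : car (cU (can (cV N'))) -> car (cU N'), hom c &
    forall v, c (qpi I1 v) = rphi v.
  apply: qmod_desc; first exact: (@rphi_linear _ _ _ N').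
  by move=> x ix; apply: (imul_kmod (X := cU N')) (imul_hom (@rphi_linear _ _ _ N') ix).
have h1 : @hom rc (can (cV N')) N' (fun x => (x.1, c x.2)).
  by exists id, c; split=> // v; rewrite cE.
have h2 : @hom rc (embS P) N' (fun x => (0, g x.2)).
  exists (fun=> 0), g; split=> //; first exact: zero_linear.
  by move=> v; rewrite (lin0 lg) (lin0 (@rphi_linear _ _ _ N')).
pose F (x : car D) : car N' := ((p x).1, c (p x).2) + (0, g (q x).2).
have hF : hom F := hom_add (hom_comp hp h1) (hom_comp hq h2).
have sF : surj F.
  move=> [v u]; have [w wE] := sg (u - rphi v).
  exists (i (v, qpi I1 v) + j (0, w)).
  rewrite /F (homD hp) (homD hq) (iE _).1 (iE _).2 (jE _).1 (jE _).2 add0r addr0 /=.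
  by congr (_, _); rewrite /= ?addr0 // cE wE addrC subrK.
have [K [a SK']] := ker_ses hF sF.
have SK : short K D N' by exists a, F.
have dN'' := gdimS (self_cover (@zero_fgp _)) dN'.
have dK := gdim_syz (perf_theory _) SK fD dN''.
split=> //; exists K, D; split=> //; first by case: fD.
have K0 : V_zero K.
  move=> v; have [[aV [aU [laV laU ca aE]]] _ ai _ aex] := SK'.
  have [rV0 [pU [_ lpU _ pE]]] := hp; have [qV [qU [_ lqU _ qE]]] := hq.
  suff : a (v, 0) = a 0 by move=> /ai[].
  have a0 : a 0 = 0 by rewrite [LHS]aE /= (lin0 laV) (lin0 laU).
  have : F (a (v, 0)) = 0 by apply/aex; exists (v, 0).
  rewrite /F a0 aE /= (lin0 laU) pE qE /= (lin0 lpU) (lin0 lqU) => -[].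
  rewrite addr0 => pv _; apply: pqi.
    by rewrite (homf0 hp) pE /= pv (lin0 lpU).
  by rewrite (homf0 hq) qE /= (lin0 lqU) [qV _]zero_kmod0.
apply: (gdim_retract (pd_theory _) (V_zero_retract K0)).
by apply: pd_embS; apply: s1; apply: perf_U_of_V_zero dK.
Qed.

End RepTheory.

(** The left adjoint of [diag]. *)
Section Phi.
Variables (R : pzRingType) (I1 I2 : ideal R).
Let M := ideal_add I1 I2.
Notation rc := (repcat I1 I2).
Let cU (N : rc) : modcat I1 := rU N.
Let torfree_rep : rc -> Prop := torfree (rep_sub I1 I2).

Definition Phi (N : rc) : modcat M := quoM I2 (cU N).

Lemma Phi_proj (N : rc) : proj N -> proj (Phi N).
Proof.
move=> pN A B g f lg sg lf.
pose fU (u : kmod_of (cU N)) : kmod_of B := f (qpi I2 u).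
have lfU : linear fU by move=> a x y; rewrite /fU (@qpi_linear _ I2) lf.
have h1 : @hom rc (diag A) (diag B) (fun x => (g x.1, g x.2)) by exists g, g.
have h2 : @hom rc N (diag B) (fun x => (fU (rphi x.1), fU x.2)).
  exists (fun v => fU (rphi v)), fU; split=> // a x y.
  by rewrite (@rphi_linear _ _ _ N) lfU.
have s1 : @surj rc (diag A) (diag B) (fun x => (g x.1, g x.2)).
  by move=> [y z]; have [x <-] := sg y; have [x' <-] := sg z; exists (x, x').
have [h [hV [hU [_ lhU _ hE]]] gh] := pN _ _ _ _ h1 s1 h2.
have [|k lk kE] := qmod_desc (I := I2) lhU.
  by move=> x ix; apply: (imul_kmod (X := A) (@ideal_add_r R I1 I2)) (imul_hom lhU ix).
exists k => // x; have [u <-] := qpi_surj x; rewrite kE.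
by have := gh (0, u); rewrite hE => -[].
Qed.

Lemma Phi_short (K N X : rc) : short K N X -> torfree1 (rep_sub I1 I2) X ->
  short (Phi K) (Phi N) (Phi X).
Proof.
move=> [i [g S]] tX.
have tX' := tX _ _ _ _ S.
move: S => [[iV [iU [liV liU ci iE]]] [gV [gU [lgV lgU cg gE]]] ii sg ex].
have S : @ses (modcat I1) (cU K) (cU N) (cU X) iU gU.
  split=> //.
  - move=> x y xy; have := ii (0, x) (0, y); rewrite !iE /= xy => /(_ erefl).
    by case.
  - by move=> y; have [x] := sg (0, y); rewrite gE => -[_ <-]; exists x.2.
  - move=> x; have e := ex (0, x); rewrite gE /= (lin0 lgV) in e; split=> [gx|[k <-]].
      by have [|k] := iffLR e; [rewrite gx | rewrite iE => -[_ <-]; exists k.2].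
    have [] : (gV 0, gU (iU k)) = 0; last by [].
    by rewrite -[LHS](gE (0, iU k)); apply/ex; exists (0, k); rewrite iE /= (lin0 liV).
have [|i' [g' [_ _ S']]] := kquo_ses (@quoM_ok R I1 I2) S; last by exists i', g'.
by move=> k ik; apply: (tX' (0, k)); rewrite iE.
Qed.

Lemma Phi_pd n (N : rc) : torfree_rep N -> pd n N -> pd n (Phi N).
Proof.
apply: (gdim_functor (F := Phi)) => [|K P X S pP tX]; first exact: Phi_proj.
by split; [apply: torfree_syz S pP tX | apply: Phi_short S (torfree_torfree1 tX)].
Qed.

Lemma Phi_diag (X : modcat M) : retract X (Phi (diag X)).
Proof.
have := @bij_retract (modcat M) X (Phi (diag X)) (@qpi _ I2 X).
case=> //; first exact: qpi_linear.
  apply: hom_inj; first exact: qpi_linear.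
  by move=> x /qpi_eq0; exact: (imul_kmod (X := X) (@ideal_add_r R I1 I2)).
exact: qpi_surj.
Qed.

(** An element u of N_U has the same image in X as some v in N_V.  As I2
annihilates V, b u = b (u - phi v) for b in I2, where u - phi v is in the kernel. *)
Lemma torfree1_diag (X : modcat M) : torfree1 (rep_sub I1 I2) (diag X).
Proof.
move=> K N i g S k.
have [hi hg ii sg ex] := S.
have [gV [gU [lgV lgU cg gE]]] := hg; have [iV [iU [liV liU ci iE]]] := hi.
rewrite /= iE /= => ik.
suff : forall u : rU N, imul I2 u -> exists2 u', imul I2 u' & u = iU u'.
  move=> /(_ _ ik)[u iu uE]; suff -> : k.2 = u by [].
  suff : (0, k.2) = (0, u) :> rcar K by case.
  by apply: ii; rewrite !iE /= uE.
move=> u; elim=> [|_ _ _ [x ix ->] _ [y iy ->]|a {}u Ia].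
- by exists 0; [exact: imul0 | rewrite (lin0 liU)].
- by exists (x + y); [exact: imulD | rewrite (linD liU)].
- have [[v u'] gv] := sg (gU u, 0).
  move: gv; rewrite gE => -[gv _].
  have /ex[l lE] : g (0, u - rphi v) = 0.
    rewrite gE /= (lin0 lgV) (linB lgU) cg; congr (_, _).
    by rewrite /= gv subrr.
  exists (a *: l.2); first exact: imulZ.
  have := lE; rewrite iE => -[_ lE2].
  rewrite (linZ liU) lE2 scalerBr.
  by rewrite -(linZ (@rphi_linear _ _ _ N)) (kmodP v Ia) (lin0 (@rphi_linear _ _ _ N)) subr0.
Qed.

End Phi.

(** * From R/I1 and R/I2 to R/(I1 + I2) *)

Section Sigma.
Variables (R : pzRingType) (I1 I2 : ideal R).
Let Z := zero_ideal R.
Variables (K P : kmod Z) (i : {linear K -> P}).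

Definition sig_pred : {pred P} :=
  [pred x | `[< exists a b, [/\ imul I1 a, imul I2 b & x = a + i b] >]].
Fact sig_closed : subsemimod_closed sig_pred.
Proof.
split=> [|r x /asboolP[a [b [ia ib ->]]]]; last first.
  apply/asboolP; exists (r *: a), (r *: b).
  by rewrite scalerDr linearZ; split=> //; exact: imulS.
split=> [|x y /asboolP[a [b [ia ib ->]]] /asboolP[c [d [ic id ->]]]]; apply/asboolP.
  by exists 0, 0; rewrite linear0 addr0; split=> //; exact: imul0.
by exists (a + c), (b + d); rewrite linearD addrACA; split=> //; exact: imulD.
Qed.
HB.instance Definition _ := GRing.isSubmodClosed.Build R P sig_pred sig_closed.

Definition sig_mod : lmodType R := quotmod sig_pred.
Definition sig_pi (x : P) : sig_mod := quotmod_pi sig_pred x.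
Lemma sig_pi_linear : linear sig_pi. Proof. exact: quotmod_pi_linear. Qed.
Lemma sig_pi_surj y : exists x, sig_pi x = y. Proof. exact: quotmod_pi_surj. Qed.
Lemma sig_pi_eq0 x : sig_pi x = 0 <->
  exists a b, [/\ imul I1 a, imul I2 b & x = a + i b].
Proof.
rewrite -(lin0 sig_pi_linear); split=> [/quotmod_pi_eq|h].
  by rewrite subr0 => /asboolP.
by apply/quotmod_pi_eq; rewrite subr0; apply/asboolP.
Qed.

Lemma sig_kmodP a (x : sig_mod) : a \in I1 -> a *: x = 0.
Proof.
move=> Ia; have [y <-] := sig_pi_surj x; rewrite -(linZ sig_pi_linear).
by apply/sig_pi_eq0; exists (a *: y), 0; rewrite linear0 addr0; split=> //;
  [exact: imulZ | exact: imul0].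
Qed.

Definition sig_phi (x : qmod I2 K) : sig_mod := sig_pi (i (repr x)).
Lemma sig_phiE x : sig_phi (qpi I2 x) = sig_pi (i x).
Proof.
apply/eqP; rewrite -subr_eq0 -(linB sig_pi_linear) -linearB; apply/eqP/sig_pi_eq0.
exists 0, (repr (qpi I2 x) - x); rewrite add0r; split=> //; first exact: imul0.
by apply/qpi_eq; exact: quotmod_reprK.
Qed.
Lemma sig_phi_linear : linear sig_phi.
Proof.
move=> a x y; have [x' <-] := qpi_surj x; have [y' <-] := qpi_surj y.
by rewrite -(@qpi_linear _ I2) !sig_phiE linearP sig_pi_linear.
Qed.

(** For K = I1 and P = 0 this is I1 -> 0, and all its syzygies for suitable
covers are given by the same formula, by [sigma_short]. *)
Definition sigma : repcat I1 I2 :=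
  @Rep _ I1 I2 (quo I2 K) (KMod sig_kmodP) sig_phi sig_phi_linear.

End Sigma.

Section SigmaResolution.
Variables (R : pzRingType) (I1 I2 : ideal R).
Hypothesis I1I2 : forall x : R, x \in I1 -> x \in I2 -> x = 0.
Let Z := zero_ideal R.
Notation rc := (repcat I1 I2).
Notation sigma := (sigma I1 I2).
Notation sig_pi := (sig_pi I1 I2).
Let torfree2 : modcat Z -> Prop := torfree (ideal_sub I2 Z).
Let torfree_rep : rc -> Prop := torfree (rep_sub I1 I2).

Section Middle.
Variables Q P : modcat Z.
Definition mid_U : modcat I1 := kprod (rU (can I1 (quo I2 Q))) (quo I1 P).
Definition mid_phi (v : kmod_of (quo I2 Q)) : kmod_of mid_U := (qpi I1 v, 0).
Lemma mid_phi_linear : linear mid_phi.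
Proof.
move=> a x y; congr (_, _); first exact: qpi_linear.
by rewrite /= scaler0 addr0.
Qed.
(** An extension of V -> V/I1V, for V = Q/I2Q, by 0 -> P/I1P. *)
Definition mid : rc := @Rep _ I1 I2 (quo I2 Q) mid_U mid_phi mid_phi_linear.

Lemma mid_short : short (embS I2 (quo I1 P)) mid (can I1 (quo I2 Q)).
Proof.
exists (fun x => (0, (0, x.2))), (fun x => (x.1, x.2.1)).
apply: (@rep_ses _ _ _ (embS I2 (quo I1 P)) mid (can I1 (quo I2 Q))
  (fun=> 0) id (fun x => (0, x)) fst) => //.
- split=> //; try exact: zero_linear.
  + by move=> x y _; rewrite [x]zero_kmod0 [y]zero_kmod0.
  + by move=> y; exists y.
  + by move=> x; split=> [->|[k <-]] //; exists 0.
- split=> //.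
  + by move=> a x y; congr (_, _); rewrite /= scaler0 addr0.
  + by move=> x y [].
  + by move=> y; exists (y, 0).
  + by move=> [x y]; split=> [/= ->|[k <-]] //; exists y.
- by move=> v; rewrite /= /mid_phi (lin0 (@qpi_linear _ I1 _)).
Qed.

Lemma fgp_mid : fgp Q -> fgp P -> fgp mid.
Proof.
move=> fQ fP; apply: fgp_ext mid_short _ _.
  by apply: fgp_embS; exact: quo_fgp.
by apply: fgp_can; exact: quo_fgp.
Qed.
End Middle.

(** The cover maps (x, y) in Q + P to i (q x) + y.  Its kernel in U consists of
the classes of (x, - i (q x)), for x in Q: a relation i (q x) + y = a + i b can be
corrected by an element of I2Q over b.  The class of x is unique up to I1Q + I2L: if
i (q y) lies in I1P for some y in I2Q, it also lies in I2P, hence vanishes, and then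
y lies in L /\ I2Q = I2L. *)
Lemma sigma_short (L Q K P : modcat Z) (l : {linear kmod_of L -> kmod_of Q})
    (q : {linear kmod_of Q -> kmod_of K}) (i : {linear kmod_of K -> kmod_of P}) :
  @ses (modcat Z) L Q K l q -> torfree1 (ideal_sub I2 Z) K -> fgp Q -> fgp P ->
  (forall b, imul I2 b -> i b = 0 -> b = 0) ->
  short (sigma l) (mid Q P) (sigma i) /\ torfree1 (rep_sub I1 I2) (sigma i).
Proof.
move=> S tK fQ fP ib0; have [_ _ li sq exq] := S.
have ql x : q (l x) = 0 by apply/exq; exists x.
have [l' [q' [l'E q'E S']]] := kquo_ses (@quo_ok R I2) S (tK _ _ _ _ S).
pose f0 (x : kmod_of Q) : kmod_of (mid_U Q P) :=
  (qpi I1 (qpi I2 x), - qpi I1 (i (q x))).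
have lf0 : linear f0.
  move=> a x y; congr (_, _); first by rewrite !(@qpi_linear _ _ _).
  by rewrite /= !linearP (@qpi_linear _ _ _) opprD scalerN.
have q0 (I : ideal R) (X : lmodType R) (x : X) : imul I x -> qpi I x = 0.
  by move=> ix; apply/qpi_eq0.
have [|iU liU iUE] := quotmod_desc (U := sig_pred I1 I2 l) lf0.
  move=> x /asboolP[a [b [ia ib ->]]]; congr (_, _).
    rewrite (linD (@qpi_linear _ _ _)) [qpi I2 (l b)]q0; last exact: (imul_hom (@linearP _ _ _ _ l)) ib.
    by rewrite addr0; apply: q0; apply: imul_hom (@qpi_linear _ _ _) _ ia.
  rewrite /= !linearD /= ql linear0 addr0 q0 ?oppr0 //.
  by apply: imul_hom (linearP i) _ _; apply: imul_hom (linearP q) _ ia.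
pose A1 (v : kmod_of (quo I2 Q)) := sig_phi I1 i (q' v).
have lq' : linear q' by have [_ h _ _ _] := S'; exact: h.
have lA1 : linear A1 by move=> a x y; rewrite /A1 lq' (@sig_phi_linear R I1 I2 K P i).
have [|A lA AE] := qmod_desc (I := I1) lA1.
  by move=> x ix; apply: (imul_kmod (X := rU (sigma i))) (imul_hom lA1 ix).
have [|B lB BE] := qmod_desc (I := I1) (@sig_pi_linear R I1 I2 K P i).
  by move=> x ix; apply: (imul_kmod (X := rU (sigma i))) (imul_hom (@sig_pi_linear R I1 I2 K P i) ix).
have AE' x : A (qpi I1 (qpi I2 x)) = sig_pi i (i (q x)).
  by rewrite AE /A1 q'E sig_phiE.
pose gU (y : kmod_of (mid_U Q P)) : kmod_of (rU (sigma i)) := A y.1 + B y.2.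
have lgU : linear gU.
  by move=> a x y; rewrite /gU lA lB scalerDr addrACA.
have qq0 x : qpi I1 (qpi I2 x) = 0 -> exists2 a, imul I1 a & imul I2 (x - a).
  move=> /qpi_eq0 /(imul_surj (@qpi_linear _ I2 _) (@qpi_surj _ I2 _))[a ia aE].
  by exists a => //; apply/qpi_eq.
have SU : @ses (modcat I1) (rU (sigma l)) (mid_U Q P) (rU (sigma i)) iU gU.
  split=> //.
  - apply: (@hom_inj (modcat I1) (rU (sigma l)) (mid_U Q P) iU liU) => x'.
    have [x <-] := sig_pi_surj x'; rewrite [X in X = 0 -> _]iUE => -[/qq0[a ia ixa] /eqP].
    rewrite oppr_eq0 => /eqP/qpi_eq0 iqx.
    have iq0 : i (q (x - a)) = 0.
      apply: (proj_imul_cap I1I2 (proj1 fP)).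
        rewrite !linearB; apply: imulB => //.
        by apply: imul_hom (linearP i) _ _; apply: imul_hom (linearP q) _ ia.
      by apply: imul_hom (linearP i) _ _; apply: imul_hom (linearP q) _ ixa.
    have /exq[z zE] : q (x - a) = 0.
      by apply: ib0 => //; apply: imul_hom (linearP q) _ ixa.
    apply/sig_pi_eq0; exists a, z; split=> //; last by rewrite zE addrC subrK.
    by apply: (tK _ _ _ _ S); rewrite /= zE.
  - move=> y; have [p <-] := sig_pi_surj y; exists (0, qpi I1 p).
    by rewrite /gU /= BE (lin0 lA) add0r.
  - move=> [y z]; have [y' <-] := qpi_surj y; have [x <-] := qpi_surj y'.
    have [p <-] := qpi_surj z; rewrite /gU /= AE' BE -(linD (@sig_pi_linear R I1 I2 K P i)).
    split=> [/sig_pi_eq0[a [b [ia ib abE]]]|[w']].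
      have [b' ib' b'E] := imul_surj (linearP q) sq ib.
      exists (sig_pi l (x - b')); rewrite [LHS]iUE; congr (_, _).
        congr qpi; apply/qpi_eq; by rewrite addrAC subrr sub0r; apply: imulN; rewrite opprK.
      apply/eqP; rewrite eq_sym -subr_eq0 opprK -(linD (@qpi_linear _ I1 _)).
      apply/eqP/q0; suff -> : p + i (q (x - b')) = a by [].
      by rewrite !linearB /= b'E addrA [p + _]addrC abE addrK.
    have [w <-] := sig_pi_surj w'; rewrite iUE => -[e1 e2].
    rewrite (linD (@sig_pi_linear R I1 I2 K P i)) -AE' -BE -e1 -e2 AE'.
    by rewrite -[- _]sub0r (linB lB) BE (lin0 lB) sub0r subrr.
have SS : @ses rc (sigma l) (mid Q P) (sigma i)
    (fun x => (l' x.1, iU x.2)) (fun x => (q' x.1, gU x.2)).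
  apply: rep_ses => //.
  - move=> v; have [x <-] := qpi_surj v; rewrite /= sig_phiE [LHS]iUE /mid_phi.
    by rewrite l'E /f0 ql linear0 [qpi I1 0]q0 ?oppr0 //; exact: imul0.
  - by move=> v; rewrite /= /gU /mid_phi /= AE (lin0 lB) addr0.
split; first by exists (fun x => (l' x.1, iU x.2)), (fun x => (q' x.1, gU x.2)).
apply: (torfree1_pres SS) => [|[v y]] /=; first by case: (fgp_mid fQ fP).
have [x <-] := sig_pi_surj y; rewrite iUE => /imul_pair[/= ix _].
have [a ia ixa] : exists2 a, imul I1 a & imul I2 (x - a).
  apply: qq0; elim: ix => // [z w _ -> _ ->|b z Ib]; first by rewrite addr0.
  have [z' <-] := qpi_surj z; rewrite -(linZ (@qpi_linear _ I1 _)).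
  by rewrite (kmodP (z' : kmod_of (quo I2 Q)) Ib) (lin0 (@qpi_linear _ I1 _)).
have -> : sig_pi l x = sig_pi l (x - a).
  rewrite (linB (@sig_pi_linear R I1 I2 L Q l)).
  suff -> : sig_pi l a = 0 by rewrite subr0.
  by apply/sig_pi_eq0; exists a, 0; rewrite linear0 addr0; split=> //; exact: imul0.
by apply: imul_hom (@sig_pi_linear R I1 I2 L Q l) _ ixa.
Qed.

End SigmaResolution.

Section ToSumQuotientRing.
Variables (R : pzRingType) (I1 I2 : ideal R).
Hypothesis I1I2 : forall x : R, x \in I1 -> x \in I2 -> x = 0.
Let Z := zero_ideal R.
Let M := ideal_add I1 I2.
Notation rc := (repcat I1 I2).
Notation sigma := (sigma I1 I2).
Let torfree2 : modcat Z -> Prop := torfree (ideal_sub I2 Z).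
Let torfree_rep : rc -> Prop := torfree (rep_sub I1 I2).

Lemma fgp_sigma0 (L Q : modcat Z) (l : {linear kmod_of L -> kmod_of Q}) :
  is_zero L -> fgp Q -> fgp (sigma l).
Proof.
move=> L0 fQ; apply: (fgp_retract (B := embS I2 (quo I1 Q))); last first.
  by apply: fgp_embS; exact: quo_fgp.
have [|f lf fE] := quotmod_desc (U := sig_pred I1 I2 l) (@qpi_linear _ I1 Q).
  move=> x /asboolP[a [b [ia _ ->]]]; rewrite (L0 b) linear0 addr0.
  exact/qpi_eq0.
have [|g lg gE] := qmod_desc (I := I1) (@sig_pi_linear R I1 I2 L Q l).
  by move=> x ix; apply: (imul_kmod (X := rU (sigma l)))
    (imul_hom (@sig_pi_linear R I1 I2 L Q l) ix).
have V0 (v : rV (sigma l)) : v = 0.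
  have [x <-] := qpi_surj v; rewrite (L0 x); apply/qpi_eq0; exact: imul0.
exists (fun x => (0, f x.2)), (fun x => (0, g x.2)); split.
- exists (fun=> 0), f; split=> //; first exact: zero_linear.
  by move=> v; rewrite (V0 v) (lin0 (@rphi_linear _ _ _ (sigma l))) (lin0 lf).
- exists (fun=> 0), g; split=> //; first exact: zero_linear.
  by move=> v; rewrite (lin0 (@rphi_linear _ _ _ (sigma l))) (lin0 lg).
- move=> [v u] /=; congr (_, _); first by rewrite (V0 v).
  by have [x <-] := sig_pi_surj u; rewrite [f _]fE gE.
Qed.

(** The inclusion of a syzygy is injective, so the induction continues with
sigma of that inclusion. *)
Lemma sigma_perf n (K P : modcat Z) (i : {linear kmod_of K -> kmod_of P}) :
  perf n K -> torfree2 K -> fgp P -> (forall b, imul I2 b -> i b = 0 -> b = 0) ->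
  perf n.+1 (sigma i) /\ torfree_rep (sigma i).
Proof.
elim: n K P i => [|n IH] K P i dK tK fP ib0.
  have [L L0 [l0 [q0 S]]] := short_zero K; have [hl hq _ _ _] := S.
  pose l := mklin (hl : linear l0); pose q := mklin (hq : linear q0).
  have [s t1] := sigma_short (l := l) (q := q) I1I2 S (torfree_torfree1 tK) dK fP ib0.
  have fl := fgp_sigma0 l L0 dK; split.
    by split=> //; exists (sigma l), (mid I1 I2 K P); split=> //; exact: fgp_mid.
  by apply: torfree_cokernel s t1 _ _; apply: proj_torfree; [case: fl | case: (fgp_mid I1 I2 dK fP)].
have [_ [L [Q [s fQ dL]]]] := dK; have [l0 [q0 S]] := s; have [hl hq li _ _] := S.
pose l := mklin (hl : linear l0); pose q := mklin (hq : linear q0).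
have [s' t1] := sigma_short (l := l) (q := q) I1I2 S (torfree_torfree1 tK) fQ fP ib0.
have [|dl tl] := IH L Q l dL (torfree_syz s (proj1 fQ) tK) fQ.
  by move=> b _ lb; apply: li; rewrite [LHS]lb (homf0 hl).
split.
  by split=> //; exists (sigma l), (mid I1 I2 Q P); split=> //; exact: fgp_mid.
by apply: torfree_cokernel s' t1 tl _; apply: proj_torfree; case: (fgp_mid I1 I2 fQ fP).
Qed.

Let res : modcat I1 -> modcat Z := kres (@zero_ideal_sub R I1).
Variable k : nat.
Hypothesis S_perf : perf k (res (regmod I1)).
Hypothesis S_torfree : torfree2 (res (regmod I1)).

Lemma fgp_R : fgp (mod0 R^o).
Proof.
split=> [A B g f lg sg lf|].
  have [a aE] := sg (f 1).
  exists (fun r : R^o => (r : R) *: (a : kmod_of A)).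
    by move=> b c d; rewrite scalerDl scalerA.
  by move=> x; rewrite (linZ lg) aE -(linZ lf); congr f; exact: mulr1.
exists 1%N, (fun=> 1) => x; exists (fun=> x); rewrite big_ord1.
exact/esym/mulr1.
Qed.

Lemma ideal_ses : @ses (modcat Z) (mod0 (ideal_lmod I1)) (mod0 R^o) (res (regmod I1))
  (fun x : ideal_lmod I1 => val x) (@regmod_pi R I1).
Proof.
split=> //.
- exact: quotmod_pi_linear.
- exact: regmod_pi_surj.
- move=> x; rewrite regmod_pi_eq0; split=> [Ix|[y <-]]; last exact: (valP y).
  by exists (exist _ x Ix : ideal_lmod I1).
Qed.

Lemma ideal_short : short (mod0 (ideal_lmod I1)) (mod0 R^o) (res (regmod I1)).
Proof. by exists (fun x : ideal_lmod I1 => val x), (@regmod_pi R I1); exact: ideal_ses. Qed.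

(** Since I1 /\ I2 = 0, the kernel of R/I2 -> R/(I1 + I2) is I1, and the diagonal
object of R/(I1 + I2) is the cokernel of (I1 -> 0) -> (R/I2 -> R/(I1 + I2)). *)
Lemma diag_regmod : (exists n, perf n (diag (regmod M))) /\ torfree_rep (diag (regmod M)).
Proof.
have dI : perf k (mod0 (ideal_lmod I1)).
  exact: (gdim_syz (perf_theory _) ideal_short fgp_R
    (gdimS (self_cover (@zero_fgp _)) S_perf)).
have tI : torfree2 (mod0 (ideal_lmod I1)) := torfree_syz ideal_short (proj1 fgp_R) S_torfree.
pose K := mod0 (ideal_lmod I1).
pose i : {linear kmod_of K -> kmod_of (zero_kmod Z)} := mklin (@zero_linear R _ _).
have I20 (b : ideal_lmod I1) : imul I2 b -> b = 0.
  move=> ib; apply: val_inj; apply: I1I2; first exact: (valP b).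
  apply: imul_regular; apply: (@imul_hom _ I2 (ideal_lmod I1) R^o val) => //.
have [||ds ts] := @sigma_perf k K (zero_kmod Z) i dI tI.
- by apply: zero_fgp; exact: zero_kmod0.
- by move=> b ib _; exact: I20.
have vI1 (x : ideal_lmod I1) : val x \in I1 := valP x.
have lval : linear (fun x : ideal_lmod I1 => regmod_pi I2 (val x)).
  by move=> a x y; exact: quotmod_pi_linear.
have [|f lf fE] := qmod_desc (I := I2) lval.
  by move=> x ix; rewrite (I20 x ix) (lin0 lval).
have lmM : linear (fun r : R^o => regmod_pi M r) by exact: quotmod_pi_linear.
have [|g lg gE] := quotmod_desc (U := ideal_left I2) lmM.
  by move=> x Ix; apply/regmod_pi_eq0; exact: ideal_add_r.
have gE' r : g (regmod_pi I2 r) = regmod_pi M r := gE r.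
have [|h lh hE] := qmod_desc (I := I1) (Z := kmod_of (regmod M)) lg.
  by move=> x ix; apply: (imul_kmod (X := regmod M) (@ideal_add_l _ I1 I2)) (imul_hom lg ix).
have SV : @ses (modcat I2) (rV (sigma i)) (regmod I2) (rV (diag (regmod M))) f g.
  split=> //.
  - apply: (@hom_inj (modcat I2) (quo I2 (mod0 (ideal_lmod I1))) (regmod I2) f lf) => x'.
    have [x <-] := qpi_surj x'; rewrite fE => /regmod_pi_eq0 Ix.
    by apply/qpi_eq0; have -> : x = 0; [exact/val_inj/I1I2 | exact: imul0].
  - by move=> y; have [r <-] := regmod_pi_surj y; exists (regmod_pi I2 r).
  - move=> x'; have [r <-] := regmod_pi_surj x'; rewrite gE'; split=> [/regmod_pi_eq0|[y]].
      move=> /asboolP[a [b [Ia Ib ->]]].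
      exists (qpi I2 (exist _ a Ia : ideal_lmod I1)); rewrite fE /=.
      by apply/quotmod_pi_eq; rewrite opprD addrA subrr sub0r; exact: Defs.idealN.
    have [x <-] := qpi_surj y; rewrite fE -gE' => <-; rewrite gE'.
    by apply/regmod_pi_eq0/ideal_add_l.
have U0 (u : rU (sigma i)) : u = 0.
  have [x <-] := sig_pi_surj u; rewrite [x]zero_kmod0.
  exact: (lin0 (@sig_pi_linear _ I1 I2 _ _ i)).
have SU : @ses (modcat I1) (rU (sigma i)) (rU (can I1 (regmod I2))) (rU (diag (regmod M)))
    (fun=> 0) h.
  split=> //; first exact: zero_linear.
  - by move=> x y _; rewrite (U0 x) (U0 y).
  - by move=> y; have [r <-] := regmod_pi_surj y; exists (qpi I1 (regmod_pi I2 r)); rewrite hE.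
  - move=> x'; have [x <-] := qpi_surj x'; have [r <-] := regmod_pi_surj x.
    rewrite hE gE'; split=> [/regmod_pi_eq0/asboolP[a [b [Ia Ib ->]]]|[_ /esym/qpi_eq0 ir]].
      exists 0; apply/esym/qpi_eq0.
      have -> : regmod_pi I2 (a + b) = a *: regmod_pi I2 1; last exact: imulZ.
      rewrite regmod_piZ mulr1; apply/quotmod_pi_eq.
      by rewrite addrAC subrr add0r.
    by rewrite -gE'; apply: (imul_kmod (X := regmod M) (@ideal_add_l _ I1 I2)) (imul_hom lg ir).
have S : short (sigma i) (can I1 (regmod I2)) (diag (regmod M)).
  exists (fun x => (f x.1, 0)), (fun x => (g x.1, h x.2)).
  apply: (@rep_ses R I1 I2 (sigma i) (can I1 (regmod I2)) (diag (regmod M)) f g (fun=> 0) h SV SU) => [v|v]; last by rewrite [LHS]hE.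
  have [x <-] := qpi_surj v; rewrite fE /=; apply/esym/qpi_eq0.
  have -> : regmod_pi I2 (val x) = (val x : R) *: regmod_pi I2 1 by rewrite regmod_piZ mulr1.
  exact: imulZ.
have fc : fgp (can I1 (regmod I2)) by apply: fgp_can; exact: regmod_fgp.
split.
  exists k.+2; apply: (gdim_cokernel_any (perf_theory _) S ds).
  exact: gdimC (perf_theory _) _ _ fc.
by apply: (torfree_cokernel S (@torfree1_diag _ _ _ _) ts); apply: proj_torfree; case: fc.
Qed.

Lemma diag_short (K N X : modcat M) : short K N X -> short (diag K) (diag N) (diag X).
Proof.
move=> [i [g S]]; exists (fun x => (i x.1, i x.2)), (fun x => (g x.1, g x.2)).
by apply: rep_ses; [exact: S | exact: S | |].
Qed.

Lemma diag_retract (A B : modcat M) : retract A B -> retract (diag A) (diag B).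
Proof.
move=> [i [r [hi hr ri]]]; exists (fun x => (i x.1, i x.2)), (fun x => (r x.1, r x.2)).
split; [by exists i, i | by exists r, r | by move=> [x y]; rewrite /= !ri].
Qed.

Lemma diag_perf n (X : modcat M) : perf n X ->
  (exists n, perf n (diag X)) /\ torfree_rep (diag X).
Proof.
have leq := gdim_leq (self_cover (@zero_fgp rc)).
have fgpD P : fgp P -> (exists n, perf n (diag P)) /\ torfree_rep (diag P).
  apply: (fgp_class (D := fun X => (exists n, perf n (diag X)) /\ torfree_rep (diag X))).
  - move=> A A0; have Z0 : is_zero (diag A).
      by move=> [x y]; congr (_, _); apply: A0.
    split; last exact: proj_torfree (zero_proj Z0).
    by exists 0; exact: zero_fgp.
  - exact: diag_regmod.
  - move=> A B N s [[a dA] tA] [[m dN] tN]; have s' := diag_short s; split.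
      exists (maxn a m); apply: (gdim_ext (perf_theory _) s').
        by apply: leq dA; exact: leq_maxl.
      by apply: leq dN; exact: leq_maxr.
    exact: torfree_ext s' tA tN.
  - move=> A B r [[m dB] tB]; have r' := diag_retract r; split.
      by exists m; exact: gdim_retract (perf_theory _) _ _ _ r' dB.
    exact: torfree_retract r' tB.
elim: n X => [|n IH] X; first exact: fgpD.
move=> [_ [K [P [s fP dK]]]]; have [[a dK'] tK'] := IH K dK.
have [[b dP'] tP'] := fgpD P fP; have s' := diag_short s; split.
  exists (maxn a b).+1; apply: (gdim_cokernel_any (perf_theory _) s').
    by apply: leq dK'; exact: leq_maxl.
  by apply: leq dP'; rewrite leqW // leq_maxr.
exact: (torfree_cokernel s' (@torfree1_diag _ _ _ _) tK' tP').
Qed.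

Theorem pd_sum_quotient_ring s t n (X : modcat M) : perf n X ->
  (forall m (Y : modcat I1), perf m Y -> pd s Y) ->
  (forall m (Y : modcat I2), perf m Y -> pd t Y) -> pd (t + s.+1) X.
Proof.
move=> dX s1 s2; have [[m dD] tD] := diag_perf dX.
apply: gdim_retract (pd_theory _) _ _ _ (Phi_diag X) _.
by apply: Phi_pd tD _; exact: pd_rep dD s1 s2.
Qed.

End ToSumQuotientRing.

(** * Tensor products *)

Section TensorTheory.
Variable R : pzRingType.
Implicit Types (M F : lmodType R^c) (N X : lmodType R).

Definition pure M N (m : M) (n : N) : tensor M N := tensor_pi (tensor_gen m n).

Lemma morphB0 (A B : zmodType) (f : A -> B) : {morph f : x y / x - y} -> f 0 = 0.
Proof. by move=> fB; rewrite -(subrr (0 : A)) fB subrr. Qed.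

Lemma tensor_piD M N : {morph @tensor_pi R M N : x y / x + y}.
Proof.
have p0 : tensor_pi (0 : {freeg (M * N)}) = 0 by exact: morphB0 (@tensor_piB R M N).
have pN (y : {freeg (M * N)}) : tensor_pi (- y) = - tensor_pi y.
  by rewrite -[- y]sub0r tensor_piB p0 sub0r.
by move=> x y; rewrite -[y in LHS]opprK tensor_piB pN opprK.
Qed.

Lemma pureDl M N (m m' : M) (n : N) : pure (m + m') n = pure m n + pure m' n.
Proof. by rewrite /pure -tensor_piD; apply/tensor_pi_eq/TensorDl. Qed.
Lemma pureDr M N (m : M) (n n' : N) : pure m (n + n') = pure m n + pure m n'.
Proof. by rewrite /pure -tensor_piD; apply/tensor_pi_eq/TensorDr. Qed.
Lemma pureA M N (m : M) (r : R) (n : N) :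
  pure ((r : R^c) *: m) n = pure m (r *: n).
Proof. exact/tensor_pi_eq/TensorA. Qed.
Lemma pure0l M N (n : N) : pure (0 : M) n = 0.
Proof. by apply: (addrI (pure 0 n)); rewrite -pureDl !addr0. Qed.
Lemma pure0r M N (m : M) : pure m (0 : N) = 0.
Proof. by apply: (addrI (pure m 0)); rewrite -pureDr !addr0. Qed.
Lemma pureBl M N (m m' : M) (n : N) : pure (m - m') n = pure m n - pure m' n.
Proof. by apply: (addIr (pure m' n)); rewrite -pureDl !subrK. Qed.
Lemma pureBr M N (m : M) (n n' : N) : pure m (n - n') = pure m n - pure m n'.
Proof. by apply: (addIr (pure m n')); rewrite -pureDr !subrK. Qed.

Lemma tensor_ind M N (P : tensor M N -> Prop) :
  P 0 -> (forall x y, P x -> P y -> P (x - y)) -> (forall m n, P (pure m n)) ->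
  forall x, P x.
Proof.
move=> P0 PB Pp x; rewrite -(tensor_reprK x).
have pi0 : tensor_pi (0 : {freeg (M * N)}) = 0 by exact: morphB0 (@tensor_piB R M N).
have PN y : P y -> P (- y) by move=> Py; rewrite -sub0r; apply: (PB).
have PD y z : P y -> P z -> P (y + z).
  by move=> Py Pz; rewrite -(opprK z); apply/PB/PN.
elim/freeg_ind_dom0: (repr x) => [|k [m n] D _ _ PD']; first by rewrite pi0.
rewrite tensor_piD; apply: (PD) => //.
have Pn (j : nat) : P (tensor_pi (<< j%:Z *g (m, n) >>)).
  elim: j => [|j IH]; first by rewrite freegU0 pi0.
  by rewrite -addn1 PoszD -freegUD tensor_piD; apply: (PD) => //; exact: Pp.
case: k => j; first exact: Pn.
rewrite NegzE -freegUN -[X in tensor_pi X]sub0r tensor_piB pi0 sub0r.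
exact: PN (Pn _).
Qed.

(** Additivity modulo a subgroup is what maps defined by set-theoretic sections
satisfy; this form yields right exactness without forming quotient groups. *)
Lemma tensor_univ_mod M N (T : zmodType) (H : T -> Prop) (b : M -> N -> T) :
  H 0 -> (forall x y, H x -> H y -> H (x - y)) ->
  (forall m m' n, H (b (m + m') n - (b m n + b m' n))) ->
  (forall m n n', H (b m (n + n') - (b m n + b m n'))) ->
  (forall m (r : R) n, H (b ((r : R^c) *: m) n - b m (r *: n))) ->
  exists f : tensor M N -> T,
    (forall x y, H (f (x - y) - (f x - f y))) /\ forall m n, H (f (pure m n) - b m n).
Proof.
move=> H0 HB bl br bA.
pose g (x : {freeg (M * N)}) : T :=
  fglift (fun mn : M * N => b mn.1 mn.2 : zmodule T) x.
have gB : {morph g : x y / x - y} by exact: (@lift_is_additive _ _ (zmodule T)).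
have g0 : g 0 = 0 := morphB0 gB.
have gD : {morph g : x y / x + y}.
  by move=> x y; rewrite -{1}(opprK y) gB -(sub0r y) gB g0 sub0r opprK.
have gU m n : g (tensor_gen m n) = b m n.
  by rewrite /g /tensor_gen liftU /= scale1r.
have gH x : tensor_rel x -> H (g x).
  elim=> [m m' n|m n n'|m r n||{}x y _ Hx _ Hy]; rewrite ?gB ?gD ?gU ?g0 //.
  exact: HB.
have HD x y : H x -> H y -> H (x + y).
  by move=> Hx Hy; rewrite -(opprK y) -[- y]sub0r; apply: (HB) => //; apply: HB.
have gE x : H (g (repr (tensor_pi x)) - g x).
  by rewrite -gB; apply/gH/tensor_pi_eq/tensor_reprK.
exists (fun x => g (repr x)); split=> [x y|m n]; last by rewrite -gU; exact: gE.
rewrite -gB -[x in repr (x - _)]tensor_reprK -[y in repr (_ - y)]tensor_reprK.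
by rewrite -tensor_piB; exact: gE.
Qed.

Lemma tensor_univ M N (T : zmodType) (b : M -> N -> T) :
  (forall m m' n, b (m + m') n = b m n + b m' n) ->
  (forall m n n', b m (n + n') = b m n + b m n') ->
  (forall m (r : R) n, b ((r : R^c) *: m) n = b m (r *: n)) ->
  exists f : tensor M N -> T,
    {morph f : x y / x - y} /\ forall m n, f (pure m n) = b m n.
Proof.
move=> bl br bA.
have [|x y -> ->|m m' n|m n n'|m r n|f [fB fU]] :=
    @tensor_univ_mod M N T (fun x => x = 0) b.
- by [].
- by rewrite subrr.
- by rewrite bl subrr.
- by rewrite br subrr.
- by rewrite bA subrr.
by exists f; split=> [x y|m n]; apply/eqP; rewrite -subr_eq0 ?fB ?fU.
Qed.

Lemma tensor_map_pure M N N' (f : {linear N -> N'}) (m : M) n :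
  tensor_map M f (pure m n) = pure m (f n).
Proof. by rewrite /pure tensor_map_pi tensor_map_preU. Qed.

Lemma tensor_map_B M N N' (f : {linear N -> N'}) :
  {morph tensor_map M f : x y / x - y}.
Proof. exact: tensor_map_is_zmod_morphism. Qed.

Lemma tensor_ext M N (T : zmodType) (f g : tensor M N -> T) :
  {morph f : x y / x - y} -> {morph g : x y / x - y} ->
  (forall m n, f (pure m n) = g (pure m n)) -> forall x, f x = g x.
Proof.
move=> fB gB fg; apply: tensor_ind => //; first by rewrite !morphB0.
by move=> x y fx fy; rewrite fB gB fx fy.
Qed.

Lemma tensor_mapl M M' N (u : M -> M') : linear u ->
  exists f : tensor M N -> tensor M' N,
    {morph f : x y / x - y} /\ forall m n, f (pure m n) = pure (u m) n.
Proof.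
move=> lu; apply: tensor_univ => [m m' n|m n n'|m r n].
- by rewrite (linD lu) pureDl.
- exact: pureDr.
- by rewrite (linZ lu) pureA.
Qed.

(** A section s of g defines a map back that is inverse to M (x) g modulo the
image of M (x) i. *)
Lemma tensor_right_exact M N' N X (i : {linear N' -> N}) (g : {linear N -> X}) :
  (forall y, exists x, g x = y) -> (forall x, g x = 0 -> exists k, i k = x) ->
  forall x, tensor_map M g x = 0 -> exists y, tensor_map M i y = x.
Proof.
move=> sg ex; have [s sE] := choice sg.
pose H (x : tensor M N) := exists y, tensor_map M i y = x.
have H0 : H 0 by exists 0; rewrite (morphB0 (@tensor_map_B _ _ _ _)).
have HB x y : H x -> H y -> H (x - y).
  by move=> [x' <-] [y' <-]; exists (x' - y'); rewrite tensor_map_B.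
have Hk m n : g n = 0 -> H (pure m n).
  by move=> /ex[k <-]; exists (pure m k); rewrite tensor_map_pure.
have [|||||f [fB fU]] := @tensor_univ_mod M X _ H (fun m z => pure m (s z)).
- by [].
- by [].
- by move=> m m' n; rewrite pureDl subrr.
- move=> m n n'; rewrite -pureDr -pureBr; apply: Hk.
  by rewrite linearB linearD /= !sE subrr.
- move=> m r n; rewrite pureA -pureBr; apply: Hk.
  by rewrite linearB linearZ /= !sE subrr.
have HD x y : H x -> H y -> H (x + y).
  by move=> Hx Hy; rewrite -(opprK y) -[- y]sub0r; apply: (HB) => //; apply: HB.
have key : forall x, H (f (tensor_map M g x) - x).
  have f0 : H (f 0) by have := fB 0 0; rewrite !subrr subr0.
  apply: tensor_ind => [|x y Hx Hy|m n].
  - by rewrite (morphB0 (@tensor_map_B _ _ _ _)) subr0.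
  - rewrite tensor_map_B; set a := tensor_map M g x; set b := tensor_map M g y.
    have -> : f (a - b) - (x - y) =
        (f (a - b) - (f a - f b)) + ((f a - x) - (f b - y)).
      rewrite [X in _ = _ + X](_ : _ = (f a - f b) - (x - y)) ?subrKA //.
      by rewrite !opprD !opprK addrACA.
    by apply: HD => //; apply: HB.
  - rewrite tensor_map_pure -(subrKA (pure m (s (g n)))); apply: HD => //.
    by rewrite -pureBr; apply: Hk; rewrite linearB /= sE subrr.
move=> x gx; have := key x; rewrite gx => h.
have f0 : H (f 0) by have := fB 0 0; rewrite !subrr subr0.
by rewrite -[x](subKr (f 0)); apply: HB.
Qed.

(** The analogue for a presentation of the left factor; the maps of tensor
products are given by their values on pure tensors. *)
Lemma tensor_right_exactl M' F M N (u : M' -> F) (v : F -> M)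
    (fu : tensor M' N -> tensor F N) (fv : tensor F N -> tensor M N) :
  linear u -> linear v ->
  {morph fu : x y / x - y} -> (forall m n, fu (pure m n) = pure (u m) n) ->
  {morph fv : x y / x - y} -> (forall m n, fv (pure m n) = pure (v m) n) ->
  (forall y, exists x, v x = y) -> (forall x, v x = 0 -> exists k, u k = x) ->
  forall x, fv x = 0 -> exists y, fu y = x.
Proof.
move=> lu lv fuB fuU fvB fvU sv ex; have [s sE] := choice sv.
pose H (x : tensor F N) := exists y, fu y = x.
have H0 : H 0 by exists 0; rewrite (morphB0 fuB).
have HB x y : H x -> H y -> H (x - y).
  by move=> [x' <-] [y' <-]; exists (x' - y'); rewrite fuB.
have Hk m n : v m = 0 -> H (pure m n).
  by move=> /ex[k <-]; exists (pure k n); rewrite fuU.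
have [|||||f [fB fU]] := @tensor_univ_mod M N _ H (fun m n => pure (s m) n).
- by [].
- by [].
- move=> m m' n; rewrite -pureDl -pureBl; apply: Hk.
  by rewrite (linB lv) (linD lv) !sE subrr.
- by move=> m n n'; rewrite pureDr subrr.
- move=> m r n; rewrite -pureA -pureBl; apply: Hk.
  by rewrite (linB lv) (linZ lv) !sE subrr.
have HD x y : H x -> H y -> H (x + y).
  by move=> Hx Hy; rewrite -(opprK y) -[- y]sub0r; apply: (HB) => //; apply: HB.
have key : forall x, H (f (fv x) - x).
  have f0 : H (f 0) by have := fB 0 0; rewrite !subrr subr0.
  apply: tensor_ind => [|x y Hx Hy|m n].
  - by rewrite (morphB0 fvB) subr0.
  - rewrite fvB; set a := fv x; set b := fv y.
    have -> : f (a - b) - (x - y) =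
        (f (a - b) - (f a - f b)) + ((f a - x) - (f b - y)).
      rewrite [X in _ = _ + X](_ : _ = (f a - f b) - (x - y)) ?subrKA //.
      by rewrite !opprD !opprK addrACA.
    by apply: HD => //; apply: HB.
  - rewrite fvU -(subrKA (pure (s (v m)) n)); apply: HD => //.
    by rewrite -pureBl; apply: Hk; rewrite (linB lv) sE subrr.
move=> x gx; have := key x; rewrite gx => h.
have f0 : H (f 0) by have := fB 0 0; rewrite !subrr subr0.
by rewrite -[x](subKr (f 0)); apply: HB.
Qed.

Lemma tensor_surjl F M N (v : F -> M) (fv : tensor F N -> tensor M N) :
  {morph fv : x y / x - y} -> (forall m n, fv (pure m n) = pure (v m) n) ->
  (forall y, exists x, v x = y) -> forall y, exists x, fv x = y.
Proof.
move=> fvB fvU sv; apply: tensor_ind => [|_ _ [x <-] [y <-]|m n].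
- by exists 0; rewrite (morphB0 fvB).
- by exists (x - y); rewrite fvB.
- by have [m' <-] := sv m; exists (pure m' n); rewrite fvU.
Qed.

Lemma free_coords (X : choiceType) (f : freemod R X) (s : seq X) : uniq s ->
  (forall x, val f x != 0 -> x \in s) ->
  f = \sum_(x <- s) (val f x : R) *: free_basis R x.
Proof.
move=> us fs; rewrite -{1}(free_lift_id f) (@free_liftE _ _ _ _ _ [set` s]%classic).
- by rewrite -fsbig_seq.
- exact: finite_seq.
- by move=> x /= fx; apply: fs.
Qed.

Lemma free_tensor_coord M (X : choiceType) : exists c : X -> tensor M (freemod R X) -> M,
  (forall x, {morph c x : a b / a - b}) /\
  forall x m f, c x (pure m f) = ((val f x : R) : R^c) *: m.
Proof.
have h x : exists c : tensor M (freemod R X) -> M, {morph c : a b / a - b} /\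
    forall m (f : freemod R X), c (pure m f) = ((val f x : R) : R^c) *: m.
  apply: tensor_univ => [m m' f|m f g|m r f].
  - exact: scalerDr.
  - exact: scalerDl.
  - by rewrite scalerA; congr (_ *: _).
have [c cE] := choice h; exists c; split=> x; by case: (cE x).
Qed.

Lemma free_tensor_eq0 M (X : choiceType) (c : X -> tensor M (freemod R X) -> M) :
  (forall x, {morph c x : a b / a - b}) ->
  (forall x m f, c x (pure m f) = ((val f x : R) : R^c) *: m) ->
  forall z, (forall x, c x z = 0) -> z = 0.
Proof.
move=> cB cU z cz.
(* any larger support is allowed, so that the two terms of a difference can share one *)
suff [s sE] : exists s : seq X, forall s' : seq X, uniq s' -> {subset s <= s'} ->
    z = \sum_(x <- s') pure (c x z) (free_basis R x).
  rewrite (sE (undup s)) ?undup_uniq //; last by move=> x; rewrite mem_undup.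
  by rewrite big1 // => x _; rewrite cz pure0l.
elim/tensor_ind: z {cz} => [|a b [s sE] [t tE]|m f].
- exists [::] => s' _ _; rewrite big1 // => x _.
  by rewrite (morphB0 (cB x)) pure0l.
- exists (s ++ t) => s' us' sub.
  rewrite {1}(sE s') //; last by move=> x xs; apply: sub; rewrite mem_cat xs.
  rewrite {1}(tE s') //; last by move=> x xs; apply: sub; rewrite mem_cat xs orbT.
  by rewrite -sumrB; apply: eq_bigr => x _; rewrite cB pureBl.
- have [s sE] : exists s : seq X, forall x, val f x != 0 -> x \in s.
    have /finite_seqP[s sE] := free_finite f.
    by exists s => x fx; have : [set` s]%classic x by rewrite -sE.
  exists s => s' us' sub; rewrite {1}(free_coords (f := f) us'); last first.
    by move=> x /sE/sub.
  have big r : pure m (\sum_(x <- r) (val f x : R) *: free_basis R x) =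
      \sum_(x <- r) pure m ((val f x : R) *: free_basis R x).
    elim: r => [|x r IH]; first by rewrite !big_nil pure0r.
    by rewrite !big_cons pureDr IH.
  by rewrite big; apply: eq_bigr => x _; rewrite cU pureA.
Qed.

Lemma free_tensor_inj M' F (X : choiceType) (u : M' -> F)
    (fu : tensor M' (freemod R X) -> tensor F (freemod R X)) :
  linear u -> injective u ->
  {morph fu : x y / x - y} -> (forall m n, fu (pure m n) = pure (u m) n) ->
  forall x, fu x = 0 -> x = 0.
Proof.
move=> lu iu fuB fuU z fz.
have [c [cB cU]] := free_tensor_coord M' X; have [d [dB dU]] := free_tensor_coord F X.
apply: (free_tensor_eq0 cB cU) => x; apply: iu; rewrite (lin0 lu).
have -> : u (c x z) = d x (fu z); last by rewrite fz (morphB0 (dB x)).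
apply: (tensor_ext (f := fun z => u (c x z)) (g := fun z => d x (fu z))).
- by move=> a b; rewrite cB (linB lu).
- by move=> a b; rewrite fuB dB.
- by move=> m n; rewrite cU fuU dU (linZ lu).
Qed.

End TensorTheory.

(** * Flat dimension and Tor *)

Section TorIndependence.
Variable R : pzRingType.
Implicit Types (M F : lmodType R^c).
Let Z := zero_ideal R.

(** Projective left modules are flat, being retracts of free ones. *)
Lemma proj_tensor_inj M' F (P : modcat Z) (u : M' -> F)
    (fu : tensor M' (kmod_of P) -> tensor F (kmod_of P)) : proj P ->
  linear u -> injective u ->
  {morph fu : x y / x - y} -> (forall m n, fu (pure m n) = pure (u m) n) ->
  forall x, fu x = 0 -> x = 0.
Proof.
move=> /proj_free[s [r [hs hr rs]]] lu iu fuB fuU z fz.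
pose s' := mklin (hs : linear s); pose r' := mklin (hr : linear r).
have [fv [fvB fvU]] := tensor_mapl (freemod R (kmod_of P)) lu.
have h : tensor_map F s' (fu z) = fv (tensor_map M' s' z).
  apply: (tensor_ext (f := fun z => tensor_map F s' (fu z))
    (g := fun z => fv (tensor_map M' s' z))) => [a b|a b|m n].
  - by rewrite fuB tensor_map_B.
  - by rewrite tensor_map_B fvB.
  - by rewrite fuU !tensor_map_pure fvU.
have s0 : tensor_map M' s' z = 0.
  apply: (free_tensor_inj lu iu fvB fvU); rewrite -h fz.
  exact: morphB0 (@tensor_map_B _ _ _ _ _).
have <- : tensor_map M' r' (tensor_map M' s' z) = z.
  apply: (tensor_ext (f := fun z => tensor_map M' r' (tensor_map M' s' z)) (g := id))
    => [a b|//|m n]; first by rewrite !tensor_map_B.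
  by rewrite !tensor_map_pure /=; congr pure; exact: rs.
by rewrite s0; exact: morphB0 (@tensor_map_B _ _ _ _ _).
Qed.

(** Tor_1(M, X) = 0, stated for all presentations of X at once. *)
Definition tor1_zero M (X : modcat Z) := forall (K N : modcat Z)
  (i : {linear kmod_of K -> kmod_of N}) (g : {linear kmod_of N -> kmod_of X}),
  @ses (modcat Z) K N X i g -> forall x, tensor_map M i x = 0 -> x = 0.

Lemma flat_tor1 M X : flat M -> tor1_zero M X.
Proof.
move=> fM K N i g [_ _ ii _ _] x ix; apply: (fM _ _ i ii).
by rewrite ix (morphB0 (@tensor_map_B _ _ _ _ _)).
Qed.

Definition flatk (M : modcat (zero_ideal R^c)) := flat (kmod_of M).

(** For M' -> F -> M with F flat and Y a syzygy of Y',
Tor_1(M, Y) = Tor_2(M, Y') = Tor_1(M', Y'); the chase below spells this out. *)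
Lemma tor1_syz n (M : modcat (zero_ideal R^c)) (X Y : modcat Z) :
  gdim any flatk flatk n M -> syz n X Y -> tor1_zero (kmod_of M) Y.
Proof.
elim: n M Y => [|n IH] M Y; first by move=> fM _; exact: flat_tor1.
move=> [_ [M' [F [[u [v [lu lv iu sv exv]]] fF dM']]]] s.
have [Y' [P [s' [a [b S']] pP]]] : exists Y' P, [/\ syz n X Y', short Y P Y' & proj P].
  inversion s as [|n' X' Y' K' P sY S fP]; subst.
  by exists Y', P; split=> //; case: fP.
have tY' := IH M' Y' dM' s'.
have [la lb _ _ _] := S'; pose a' := mklin (la : linear a); pose b' := mklin (lb : linear b).
move=> K N i g [_ _ ii sg exg] x ix.
have tl W := tensor_mapl W lu; have tr W := tensor_mapl W lv.
have [uK [uKB uKU]] := tl (kmod_of K); have [uN [uNB uNU]] := tl (kmod_of N).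
have [uY [uYB uYU]] := tl (kmod_of Y); have [uP [uPB uPU]] := tl (kmod_of P).
have [vK [vKB vKU]] := tr (kmod_of K); have [vN [vNB vNU]] := tr (kmod_of N).
have natu (V W : lmodType R) (f : {linear V -> W}) (w : kmod_of M' -> kmod_of F)
    (fV : tensor (kmod_of M') V -> tensor (kmod_of F) V)
    (fW : tensor (kmod_of M') W -> tensor (kmod_of F) W) : {morph fV : x y / x - y} -> (forall m n, fV (pure m n) = pure (w m) n) ->
    {morph fW : x y / x - y} -> (forall m n, fW (pure m n) = pure (w m) n) ->
    forall z, tensor_map (kmod_of F) f (fV z) = fW (tensor_map (kmod_of M') f z).
  move=> fVB fVU fWB fWU.
  apply: (tensor_ext (f := fun z => tensor_map (kmod_of F) f (fV z))
    (g := fun z => fW (tensor_map (kmod_of M') f z))) => [p q|p q|m k].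
  - by rewrite fVB tensor_map_B.
  - by rewrite tensor_map_B fWB.
  - by rewrite fVU !tensor_map_pure fWU.
have nat' z : tensor_map (kmod_of M) i (vK z) = vN (tensor_map (kmod_of F) i z).
  apply: (tensor_ext (f := fun z => tensor_map (kmod_of M) i (vK z))
    (g := fun z => vN (tensor_map (kmod_of F) i z))) => [p q|p q|m k].
  - by rewrite vKB tensor_map_B.
  - by rewrite tensor_map_B vNB.
  - by rewrite vKU !tensor_map_pure vNU.
have exv' z : v z = 0 -> exists k, u k = z by move/exv.
have exg' z : g z = 0 -> exists k, i k = z by move/exg.
have [y yE] := tensor_surjl vKB vKU sv x.
have [e eE] : exists e, uN e = tensor_map (kmod_of F) i y.
  apply: (tensor_right_exactl lu lv uNB uNU vNB vNU sv exv').
  by rewrite -nat' yE.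
have ge : tensor_map (kmod_of M') g e = 0.
  apply: (tY' _ _ a' b' S').
  apply: (proj_tensor_inj pP lu iu uPB uPU).
  rewrite -(natu _ _ a' u _ _ uYB uYU uPB uPU) -(natu _ _ g u _ _ uNB uNU uYB uYU) eE.
  have -> : tensor_map (kmod_of F) g (tensor_map (kmod_of F) i y) = 0.
    apply: (tensor_ext (f := fun y => tensor_map (kmod_of F) g (tensor_map (kmod_of F) i y))
      (g := fun=> 0)) => [p q|p q|m k]; rewrite ?tensor_map_B ?subrr //.
    rewrite !tensor_map_pure; have -> : g (i k) = 0 by apply/exg; exists k.
    by rewrite pure0r.
  exact: morphB0 (@tensor_map_B _ _ _ _ _).
have [k kE] := tensor_right_exact sg exg' ge.
have yk : y = uK k.
  apply: (fF _ _ i ii); rewrite (natu _ _ i u _ _ uKB uKU uNB uNU) kE eE //.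
rewrite -yE yk.
apply: (tensor_ext (f := fun k => vK (uK k)) (g := fun=> 0)) => [p q|p q|m l].
- by rewrite uKB vKB.
- by rewrite subrr.
- rewrite uKU vKU; have -> : v (u m) = 0 by apply/exv; exists m.
  exact: pure0l.
Qed.

(** If i k is in IN, then 1 (x) k vanishes in R/I (x) N, hence in R/I (x) K,
which maps to K/IK. *)
Lemma tor1_torfree (I : ideal R) (X : modcat Z) :
  tor1_zero (quotient_rmod I) X -> torfree1 (ideal_sub I Z) X.
Proof.
move=> tX K N i g S k ik; have [li lg ii sg ex] := S.
pose i' := mklin (li : linear i); pose g' := mklin (lg : linear g).
pose one : quotient_rmod I := @quotmod_pi R^c (R^c)^o (ideal_right I) (1 : R).
have one0 (a : R) : a \in I -> ((a : R^c) *: one) = 0.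
  move=> Ia; rewrite /one -(linZ (@quotmod_pi_linear _ _ _)).
  rewrite -(lin0 (@quotmod_pi_linear R^c (R^c)^o (ideal_right I))).
  by apply/quotmod_pi_eq; rewrite subr0; exact: (@Defs.idealMl _ I (1 : R) a Ia).
have pone0 (n : kmod_of N) : imul I n -> pure one n = 0.
  elim=> [|x y _ ix _ iy|a x Ia]; first exact: pure0r.
    by rewrite pureDr ix iy addr0.
  by rewrite -pureA one0 // pure0l.
have pk : pure one (k : kmod_of K) = 0.
  by apply: (tX _ _ i' g' S); rewrite tensor_map_pure; apply: pone0.
pose rep (m : quotient_rmod I) : R := repr m.
have repE m : @quotmod_pi R^c (R^c)^o (ideal_right I) (rep m) = m by exact: quotmod_reprK.
have Ieq (a b : R) : @quotmod_pi R^c (R^c)^o (ideal_right I) a = @quotmod_pi R^c (R^c)^o (ideal_right I) b ->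
    forall x : kmod_of K, qpi I (a *: x) = qpi I (b *: x).
  move=> /quotmod_pi_eq ab x; apply/qpi_eq; rewrite -scalerBl; exact: imulZ.
have [|||f [fB fU]] := @tensor_univ R (quotient_rmod I) (kmod_of K) (qmod I (kmod_of K))
    (fun m x => qpi I (rep m *: x)).
- move=> m m' n; rewrite -(linD (@qpi_linear _ I _)) -scalerDl; apply: Ieq.
  by rewrite repE (linD (@quotmod_pi_linear _ _ _)) !repE.
- by move=> m n n'; rewrite scalerDr (linD (@qpi_linear _ I _)).
- move=> m r n; rewrite scalerA; apply: Ieq; rewrite repE.
  by rewrite -[in LHS](repE m) -(linZ (@quotmod_pi_linear _ _ _)).
apply/qpi_eq0; have := fU one k; rewrite pk (morphB0 fB) => ->.
rewrite -[k in LHS]scale1r; apply: Ieq; exact/esym/repE.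
Qed.

End TorIndependence.

(** * The groups Tor(I2, I1) *)

Section TorHypothesis.
Variables (R : pzRingType) (I1 I2 : ideal R).
Hypothesis I1I2 : forall x : R, x \in I1 -> x \in I2 -> x = 0.
Let Z := zero_ideal R.

Lemma tensor_homology_exact (M : lmodType R^c) (N : lmodType R)
    (P : resolution N) i (y : tensor M (P i)) :
  (forall x : tensor_homology M P i, x = 0) ->
  y \in @tensor_cycle_pred R M N P i ->
  exists w, tensor_map M (res_diff P i) w = y.
Proof.
move=> H0 cy; pose c : tensor_cycle M P i := exist _ y cy.
pose pi0 (c : tensor_cycle M P i) : tensor_homology M P i :=
  (\pi_{ideal_quot (@tensor_bound_pred R M N P i : zmodClosed (tensor_cycle M P i))} c)%qT.
have : pi0 c = pi0 0 by rewrite (H0 (pi0 c)) (H0 (pi0 0)).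
move=> /eqP; rewrite -Quotient.idealrBE subr0 => /asboolP.
by [].
Qed.

Lemma ideal_incl_linear : linear (fun b : ideal_rmod I2 => val b : (R^c)^o).
Proof. exact: (@submod_val_linear R^c (R^c)^o (ideal_right I2)). Qed.
Lemma ideal_incl_inj : injective (fun b : ideal_rmod I2 => val b : (R^c)^o).
Proof. exact: val_inj. Qed.

Lemma ideal_mult (X : lmodType R) :
  exists mu : tensor (ideal_rmod I2) X -> X,
    {morph mu : x y / x - y} /\ forall b x, mu (pure b x) = (val b : R) *: x.
Proof.
apply: tensor_univ => [b b' x|b x y|b r x].
- by rewrite -scalerDl.
- by rewrite scalerDr.
- by rewrite scalerA; congr (_ *: _); exact: (linZ ideal_incl_linear r b).
Qed.

Lemma regular_mult (X : lmodType R) : exists m : tensor (R^c)^o X -> X,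
  [/\ {morph m : x y / x - y}, forall r x, m (pure r x) = (r : R) *: x
    & forall w, m w = 0 -> w = 0].
Proof.
have [|||m [mB mU]] := @tensor_univ R (R^c)^o X X (fun r x => (r : R) *: x).
- by move=> a b x; rewrite -scalerDl.
- by move=> a x y; rewrite scalerDr.
- by move=> a r x; rewrite scalerA.
exists m; split=> // w mw.
have one : w = pure (1 : (R^c)^o) (m w).
  apply: (tensor_ext (f := id) (g := fun w => pure (1 : (R^c)^o) (m w)))
    => [//|x y|r x]; first by rewrite mB pureBr.
  rewrite mU -pureA; congr pure.
  exact/esym/(@mulr1 R^c r).
by rewrite one mw pure0r.
Qed.

Section Mult.
Variables (X : lmodType R) (mu : tensor (ideal_rmod I2) X -> X).
Hypothesis muB : {morph mu : x y / x - y}.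
Hypothesis muU : forall b x, mu (pure b x) = (val b : R) *: x.

Lemma ideal_mult_imul z : imul I2 (mu z).
Proof.
elim/tensor_ind: z => [|x y ix iy|b x].
- by rewrite (morphB0 muB); exact: imul0.
- by rewrite muB; exact: imulB.
- by rewrite muU; apply: imulZ; exact: (valP b).
Qed.

Lemma ideal_mult_surj x : imul I2 x -> exists z, mu z = x.
Proof.
elim=> [|_ _ _ [y <-] _ [z <-]|a y Ia]; first by exists 0; rewrite (morphB0 muB).
  by exists (y - (0 - z)); rewrite !muB (morphB0 muB) sub0r opprK.
by exists (pure (exist _ a Ia : ideal_rmod I2) y); rewrite muU.
Qed.

(** The multiplication is I2 (x) X -> R (x) X = X, and X is flat. *)
Lemma ideal_mult_inj : proj (mod0 X) -> forall z, mu z = 0 -> z = 0.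
Proof.
move=> pX z muz.
have [f [fB fU]] := tensor_mapl X ideal_incl_linear.
apply: (proj_tensor_inj (P := mod0 X) pX ideal_incl_linear ideal_incl_inj fB fU).
have [m [mB mU m0]] := regular_mult X; apply: m0; rewrite -muz.
apply: (tensor_ext (f := fun z => m (f z)) (g := mu)) => [x y|//|b x].
  by rewrite fB mB.
by rewrite fU mU muU.
Qed.
End Mult.

Lemma ideal_mult_nat (X Y : lmodType R) (f : {linear X -> Y})
    (mu : tensor (ideal_rmod I2) X -> X) (nu : tensor (ideal_rmod I2) Y -> Y) :
  {morph mu : x y / x - y} -> (forall b x, mu (pure b x) = (val b : R) *: x) ->
  {morph nu : x y / x - y} -> (forall b x, nu (pure b x) = (val b : R) *: x) ->
  forall z, nu (tensor_map (ideal_rmod I2) f z) = f (mu z).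
Proof.
move=> muB muU nuB nuU; apply: (tensor_ext
  (f := fun z => nu (tensor_map (ideal_rmod I2) f z)) (g := fun z => f (mu z))).
- by move=> x y; rewrite tensor_map_B nuB.
- by move=> x y; rewrite muB linearB.
- by move=> b x; rewrite tensor_map_pure nuU muU linearZ.
Qed.

Lemma tensor_cycle_syzygy (N : lmodType R) i
    (z : tensor (ideal_rmod I2) (free_resolution N i))
    (mu : tensor (ideal_rmod I2) (free_resolution N i) -> free_resolution N i) :
  {morph mu : x y / x - y} -> (forall b x, mu (pure b x) = (val b : R) *: x) ->
  free_eval (syzygy N i) (mu z) = 0 ->
  z \in @tensor_cycle_pred R (ideal_rmod I2) _ (free_resolution N) i.
Proof.
case: i z mu => [//|j] z mu muB muU zk; apply/eqP.
have [nu [nuB nuU]] := ideal_mult (freemod R (syzygy N j)).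
have pF : proj (mod0 (freemod R (syzygy N j))) by exact: freemod_proj.
apply: (ideal_mult_inj nuB nuU pF).
rewrite (ideal_mult_nat (res_diff (free_resolution N) j) muB muU nuB nuU z).
by rewrite -[LHS]/(val (free_eval (syzygy N j.+1) (mu z))) zk.
Qed.

Lemma syzygy_ses (X : lmodType R) :
  @ses (modcat Z) (mod0 (submod (@free_ker R X))) (mod0 (freemod R X)) (mod0 X)
    (fun x : submod (@free_ker R X) => val x) (free_eval X).
Proof.
split.
- exact: submod_val_linear.
- exact: linearP.
- exact: val_inj.
- exact: free_eval_surj.
- move=> x; split=> [x0|[k <-]]; last by apply/eqP; exact: (valP k).
  have kx : x \in @free_ker R X by apply/eqP.
  by exists (exist _ x kx : submod (@free_ker R X)).
Qed.

(** Let z be an element of I2 F_i in the kernel.  It is the product of a tensor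
in I2 (x) F_i, which is a cycle since I2 (x) F_(i-1) embeds in F_(i-1), hence a
boundary; so z is the image of an element of I2 F_(i+1). *)
Lemma torfree_of_Tor :
  (forall (i : nat) (x : Tor i (ideal_rmod I2) (ideal_lmod I1)), x = 0) ->
  torfree (ideal_sub I2 Z) (mod0 (ideal_lmod I1)).
Proof.
move=> Tor0; pose S := syzygy (ideal_lmod I1).
apply: (torfree_coind (D := fun X => exists i, X = mod0 (S i))); last by exists 0.
move=> _ [i ->].
have SS := syzygy_ses (S i).
have pF : proj (mod0 (freemod R (S i))) by exact: freemod_proj.
split; last first.
  exists (mod0 (S i.+1)), (mod0 (freemod R (S i))); split=> //; last by exists i.+1.
  by exists (fun x : submod (@free_ker R (S i)) => \val x), (free_eval (S i)).
apply: (torfree1_pres SS pF) => k /=.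
move=> ik; have [mu [muB muU]] := ideal_mult (freemod R (S i)).
have [z zE] := ideal_mult_surj muB muU ik.
have cz := tensor_cycle_syzygy (i := i) (z := z) muB muU.
have {}cz := cz (etrans (congr1 _ zE) (eqP (valP k))).
have [w wE] := tensor_homology_exact (Tor0 i) cz.
have [nu [nuB nuU]] := ideal_mult (freemod R (S i.+1)).
have h := ideal_mult_nat (res_diff (free_resolution (ideal_lmod I1)) i) nuB nuU muB muU w.
have -> : k = free_eval (S i.+1) (nu w) :> S i.+1.
  by apply: val_inj; rewrite -[LHS]zE -wE h.
apply: imul_hom (ideal_mult_imul nuB nuU w).
exact: linearP.
Qed.

End TorHypothesis.

(** * Resolutions and finitistic dimensions *)

Lemma enat_inf_le (S : set nat) n :
  (enat_inf S <= Fin n)%EN <-> exists2 m, (m <= n)%N & S m.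
Proof.
rewrite /enat_inf; case: pselect => [exS|nS]; last first.
  by split=> [//|[m _ Sm]]; case: nS; exists m; apply/asboolP.
case: ex_minnP => m /asboolP Sm mmin /=; split=> [mn|[k kn Sk]]; first by exists m.
by apply: leq_trans kn; apply: mmin; apply/asboolP.
Qed.

Lemma gdim_mono (C : category) (Cc Cc' : C -> Prop) n X :
  (forall P, Cc P -> Cc' P) -> gdim any Cc Cc n X -> gdim any Cc' Cc' n X.
Proof.
move=> CC; elim: n X => [|n IH] X; first exact: CC.
by move=> [_ [K [P [S cP dK]]]]; split=> //; exists K, P; split; [|apply: CC|apply: IH].
Qed.

Section Resolutions.
Variable A : pzRingType.
Notation Z := (zero_ideal A).
Variable Pc : lmodType A -> Prop.
Let kc (M : modcat Z) := Pc (kmod_of M).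

(** In length 0 the augmentation is bijective, and closure under retracts
transports the property from the last term to X. *)
Lemma gdim_of_resolution n (X : lmodType A) (P : resolution X) :
  retract_closed kc -> (forall i, Pc (P i)) -> res_length_le P n ->
  gdim any kc kc n (mod0 X).
Proof.
move=> rc; elim: n X P => [|n IH] X P PP lP.
  apply: (rc _ (mod0 (P 0))); last exact: PP.
  have [] // := @bij_retract (modcat Z) (mod0 (P 0)) (mod0 X) (res_aug P).
  - exact: linearP.
  - apply: (@hom_inj (modcat Z) (mod0 (P 0)) (mod0 X)); first exact: linearP.
    by move=> x /res_exact0[y <-]; rewrite (lP 1%N isT y) linear0.
  - exact: res_aug_surj.
have [K [i S]] := @ker_ses (modcat Z) (mod0 (P 0)) (mod0 X) _ (@linearP _ _ _ _ (res_aug P))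
  (@res_aug_surj _ _ P).
have [li lg ii _ exi] := S.
have [|h lh hE] := @ses_lift (modcat Z) K (mod0 (P 0)) (mod0 X) i _ (mod0 (P 1)) _ S
    (@linearP _ _ _ _ (res_diff P 0)).
  by move=> x; apply/res_exact0; exists x.
have h0 x : h x = 0 <-> res_diff P 0 x = 0.
  rewrite -hE; split=> [->|hx]; first exact: (lin0 li).
  by apply: ii; rewrite hx (lin0 li).
have hs y : exists x, (mklin (lh : linear h) : P 1 -> kmod_of K) x = y.
  have /res_exact0[x xE] : res_aug P (i y) = 0 by apply/exi; exists y.
  by exists x; apply: ii; rewrite [LHS]hE.
have h_ex x : (mklin (lh : linear h) : P 1 -> kmod_of K) x = 0 <->
    exists y, res_diff P 1 y = x.
  by rewrite -(res_exactS x); exact: h0.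
pose Q : resolution (kmod_of K) := @Resolution A (kmod_of K) (fun j => P j.+1)
  (fun j => res_diff P j.+1) (mklin (lh : linear h)) hs h_ex
  (fun j => @res_exactS _ _ P j.+1).
have dK := IH (kmod_of K) Q (fun j => PP j.+1) (fun j lj => lP j.+1 lj).
split=> //; exists (mod0 (kmod_of K)), (mod0 (P 0)); split=> //; last exact: PP.
by exists i, (res_aug P).
Qed.

Lemma resolution_of_gdim n (M : modcat Z) : Pc ('rV[A]_0) ->
  gdim any kc kc n M ->
  exists P : resolution (kmod_of M), (forall i, Pc (P i)) /\ res_length_le P n.
Proof.
move=> P0; elim: n M => [|n IH] M.
  move=> dM; pose obj i : lmodType A := if i is j.+1 then 'rV[A]_0 else kmod_of M.
  have obj0 i (x : obj i.+1) : x = 0 by exact: thinmx0.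
  pose d i : {linear obj i.+1 -> obj i} := mklin (@zero_linear A (obj i.+1) (obj i)).
  have sA (y : kmod_of M) : exists x : obj 0, (idfun : {linear obj 0 -> kmod_of M}) x = y.
    by exists y.
  have e0 (x : obj 0) : (idfun : {linear obj 0 -> kmod_of M}) x = 0 <->
      exists y, d 0 y = x.
    by split=> [x0|[y <-]] //; exists 0; exact/esym/x0.
  have eS i (x : obj i.+1) : d i x = 0 <-> exists y, d i.+1 y = x.
    by rewrite (obj0 i x); split=> // _; exists 0.
  exists (@Resolution A (kmod_of M) obj d idfun sA e0 eS); split.
    by case=> [|i] /=; [exact: dM | exact: P0].
  by case=> [//|i] _ x; exact: obj0.
move=> [_ [K [P [[i [g [li lg ii sg ex]]] cP dK]]]].
have [Q [QQ lQ]] := IH K dK.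
have lc : linear (fun x : Q 0 => i (res_aug Q x)).
  by move=> a x y; rewrite linearP li.
pose obj j : lmodType A := if j is l.+1 then Q l else kmod_of P.
pose d j : {linear obj j.+1 -> obj j} :=
  match j return {linear obj j.+1 -> obj j} with
  | 0 => mklin lc | l.+1 => res_diff Q l end.
have sA (y : kmod_of M) : exists x : obj 0, mklin (lg : linear g) x = y by exact: sg.
have e0 (x : obj 0) : mklin (lg : linear g) x = 0 <-> exists y, d 0 y = x.
  split=> [/ex[k kE]|[y <-]]; last by apply/ex; exists (res_aug Q y).
  by have [y yE] := @res_aug_surj _ _ Q k; exists y; rewrite /= yE.
have eS j (x : obj j.+1) : d j x = 0 <-> exists y, d j.+1 y = x.
  case: j x => [|j] x; last exact: res_exactS.
  rewrite -(res_exact0 x) /=; split=> [ix|->]; last exact: (lin0 li).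
  by apply: ii; rewrite ix (lin0 li).
exists (@Resolution A (kmod_of M) obj d (mklin (lg : linear g)) sA e0 eS); split.
  by case=> [|j] /=; [exact: cP | exact: QQ].
by case=> [//|j] nj x; exact: lQ.
Qed.

End Resolutions.

Section Dictionary.
Variable A : pzRingType.
Notation Z := (zero_ideal A).

Lemma projectiveE (M : modcat Z) : projective (kmod_of M) <-> proj M.
Proof.
split=> [pM X Y g f hg sg hf|pM X Y g f sg].
  have [h hE] := pM X Y (mklin (hg : linear g)) (mklin (hf : linear f)) sg.
  by exists h => //; exact: linearP.
have [h lh hE] := pM (mod0 X) (mod0 Y) g f (@linearP _ _ _ _ g) sg (@linearP _ _ _ _ f).
by exists (mklin (lh : linear h)).
Qed.

Lemma mod0_retract (M : modcat Z) : retract M (mod0 (kmod_of M)) /\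
  retract (mod0 (kmod_of M)) M.
Proof. by split; exists id, id. Qed.

Definition proj_fg (M : lmodType A) := projective M /\ finitely_generated M.

Lemma proj_fgE (M : modcat Z) : proj_fg (kmod_of M) <-> fgp M.
Proof. by split=> -[/projectiveE pM fM]. Qed.

Lemma zero_projective : projective 'rV[A]_0.
Proof. by apply/(projectiveE (zero_kmod Z)); exact/zero_proj/zero_kmod0. Qed.

Lemma pdP n (X : lmodType A) : (proj_dim X <= Fin n)%EN <-> pd n (mod0 X).
Proof.
split=> [/enat_inf_le[m mn [P [pP lP]]]|dX].
  apply: (gdim_leq (self_cover (@zero_proj _)) mn).
  apply: (gdim_mono (Cc := fun M : modcat Z => projective (kmod_of M))); first by move=> M /projectiveE.
  apply: gdim_of_resolution pP lP => B C r /projectiveE pC.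
  exact/projectiveE/(proj_retract r).
apply/enat_inf_le; exists n => //.
have [|P PP] := @resolution_of_gdim A (@projective A) n (mod0 X) zero_projective; last by exists P.
by apply: (gdim_mono (Cc := proj)) dX => M /projectiveE.
Qed.

Lemma perfP (X : lmodType A) :
  has_finite_fgproj_res X <-> exists n, perf n (mod0 X).
Proof.
split=> [[P [n [pP lP]]]|[n dX]].
  exists n; apply: (gdim_mono (Cc := fun M : modcat Z => proj_fg (kmod_of M))).
    by move=> M /proj_fgE.
  apply: gdim_of_resolution pP lP => B C r /proj_fgE pC.
  exact/proj_fgE/(fgp_retract r).
have [||P [PP lP]] := @resolution_of_gdim A proj_fg n (mod0 X); last by exists P, n.
  by apply/(proj_fgE (zero_kmod Z)); exact/zero_fgp/zero_kmod0.
by apply: (gdim_mono (Cc := fgp)) dX => M /proj_fgE.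
Qed.

Lemma fin_dimP n : (fin_dim A <= Fin n)%EN <->
  forall m (X : modcat Z), perf m X -> pd n X.
Proof.
split=> [/enat_inf_le[k kn bk] m X dX|H].
  have [r1 r2] := mod0_retract X.
  have dX' : perf m (mod0 (kmod_of X)) by exact: gdim_retract (perf_theory _) _ _ _ r2 dX.
  apply: (gdim_retract (pd_theory _) r1); apply: (gdim_leq (self_cover (@zero_proj _)) kn).
  apply/pdP/bk; exists (kmod_of X); split=> //; apply/perfP; by exists m.
apply/enat_inf_le; exists n => // _ [X [/perfP[m dX] ->]].
exact/pdP/H/dX.
Qed.

End Dictionary.

Section RingChange.
Variables (R : pzRingType) (J : ideal R).
Notation A := (quotring J).
Notation Z := (zero_ideal A).

Lemma quotring_piM_rev a b :
  (quotring_pi J a : A) * quotring_pi J b = quotring_pi J (a * b).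
Proof. exact/esym/quotring_piM. Qed.

Section Restr.
Variable X : lmodType A.
(** The alias carries the action of R. *)
Definition restr : Type := X.
HB.instance Definition _ := GRing.Zmodule.on restr.
Definition restr_scale (r : R) (x : restr) : restr := (quotring_pi J r : A) *: (x : X).
Lemma restr_scaleA a b x : restr_scale a (restr_scale b x) = restr_scale (a * b) x.
Proof. by rewrite /restr_scale scalerA quotring_piM_rev. Qed.
Lemma restr_scale1 : left_id 1 restr_scale.
Proof. by move=> x; rewrite /restr_scale; exact: scale1r. Qed.
Lemma restr_scaleDr : right_distributive restr_scale +%R.
Proof. by move=> a x y; rewrite /restr_scale; exact: scalerDr. Qed.
Lemma restr_scaleDl x : {morph restr_scale^~ x : a b / a + b}.
Proof. by move=> a b; rewrite /restr_scale quotring_piD; exact: scalerDl. Qed.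
HB.instance Definition _ := GRing.Zmodule_isLmodule.Build R restr
  restr_scaleA restr_scale1 restr_scaleDr restr_scaleDl.

Lemma restr_kmodP a (x : restr) : a \in J -> a *: x = 0.
Proof.
move=> Ja; rewrite -[LHS]/((quotring_pi J a : A) *: (x : X)).
have -> : quotring_pi J a = 0; last exact: (@scale0r A X x).
have -> : (0 : A) = quotring_pi J 0.
  by apply: (addrI (quotring_pi J 0)); rewrite -quotring_piD !addr0.
by apply/quotring_pi_eq; rewrite subr0.
Qed.
End Restr.
Definition restr_k (X : modcat Z) : modcat J := KMod (@restr_kmodP (kmod_of X)).

Section Ind.
Variable X : kmod J.
(** The alias carries the action of the quotient ring, through representatives. *)
Definition indm : Type := X.
HB.instance Definition _ := GRing.Zmodule.on indm.
Definition indm_scale (q : A) (x : indm) : indm := (repr q : R) *: (x : X).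
Lemma indm_scaleE r (x : X) : indm_scale (quotring_pi J r) x = r *: x.
Proof.
apply/eqP; rewrite -subr_eq0 -scalerBl; apply/eqP/kmodP.
by apply/quotring_pi_eq; exact: quotring_reprK.
Qed.
Lemma indm_scaleA a b x : indm_scale a (indm_scale b x) = indm_scale (a * b) x.
Proof.
rewrite -[a]quotring_reprK -[b]quotring_reprK quotring_piM_rev !indm_scaleE.
by rewrite scalerA.
Qed.
Lemma indm_scale1 : left_id 1 indm_scale.
Proof. by move=> x; rewrite [LHS]indm_scaleE; exact: scale1r. Qed.
Lemma indm_scaleDr : right_distributive indm_scale +%R.
Proof. by move=> a x y; rewrite /indm_scale; exact: scalerDr. Qed.
Lemma indm_scaleDl x : {morph indm_scale^~ x : a b / a + b}.
Proof.
move=> a b; rewrite -[a]quotring_reprK -[b]quotring_reprK -quotring_piD !indm_scaleE.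
exact: scalerDl.
Qed.
HB.instance Definition _ := GRing.Zmodule_isLmodule.Build A indm
  indm_scaleA indm_scale1 indm_scaleDr indm_scaleDl.
End Ind.
Definition ind_k (X : modcat J) : modcat Z := mod0 (indm X).

Lemma restr_linear (X Y : lmodType A) (f : X -> Y) :
  linear f <-> linear (f : restr X -> restr Y).
Proof.
split=> lf a x y; first exact: lf.
by rewrite -[a]quotring_reprK; exact: lf.
Qed.

Lemma indm_linear (X Y : kmod J) (f : X -> Y) :
  linear f <-> linear (f : indm X -> indm Y).
Proof.
split=> lf a x y; first exact: lf.
by have := lf (quotring_pi J a) x y; rewrite /GRing.scale /= !indm_scaleE.
Qed.

Lemma restr_ind (X : modcat J) : retract X (restr_k (ind_k X)).
Proof.
have E a (x : kmod_of X) : (a *: (x : restr (indm X))) = (a *: x : kmod_of X) :> car X.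
  exact: indm_scaleE.
exists id, id; split=> // a x y; first by rewrite [a *: (_ : restr _)]E.
by rewrite [a *: (_ : restr _)]E.
Qed.

Lemma ind_restr (X : modcat Z) : retract X (ind_k (restr_k X)).
Proof.
have E a (x : kmod_of X) : (a *: (x : indm (restr_k X : kmod J))) = (a *: x : kmod_of X) :> car X.
  rewrite -[a]quotring_reprK; exact: (@indm_scaleE (restr_k X) (repr a) x).
exists id, id; split=> // a x y; first by rewrite [a *: (_ : indm _)]E.
by rewrite [a *: (_ : indm _)]E.
Qed.

End RingChange.

Section Transfer.
Variables (R : pzRingType) (J : ideal R).
Notation A := (quotring J).
Notation Z := (zero_ideal A).

Lemma restr_short (K N X : modcat Z) : short K N X ->
  short (restr_k K) (restr_k N) (restr_k X).
Proof.
by move=> [i [g [li lg ii sg ex]]]; exists i, g; split=> //; apply/restr_linear.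
Qed.

Lemma ind_short (K N X : modcat J) : short K N X -> short (ind_k K) (ind_k N) (ind_k X).
Proof.
move=> [i [g [li lg ii sg ex]]]; exists i, g; split=> //; first exact: (iffLR (indm_linear _) li).
exact: (iffLR (indm_linear _) lg).
Qed.

Lemma restr_proj (P : modcat Z) : proj P -> proj (restr_k P).
Proof.
move=> pP X Y g f lg sg lf.
have lf' : @hom (modcat Z) P (ind_k Y) f.
  move=> a x y; rewrite -[a]quotring_reprK.
  have /= := lf (repr a) x y; rewrite -[X in f (X + _)]/((quotring_pi J (repr a) : A) *: (x : kmod_of P)).
  by move=> ->; rewrite -(indm_scaleE (X := Y)).
have [h lh hE] := pP (ind_k X) (ind_k Y) g f (iffLR (indm_linear _) lg) sg lf'.
exists h => // a x y.
have /= := lh (quotring_pi J a) x y.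
by rewrite -(indm_scaleE (X := X)).
Qed.

Lemma ind_proj (P : modcat J) : proj P -> proj (ind_k P).
Proof.
move=> pP X Y g f lg sg lf.
have lf' : @hom (modcat J) P (restr_k Y) f.
  move=> a x y; have /= := lf (quotring_pi J a) x y.
  by rewrite -(indm_scaleE (X := P)).
have [h lh hE] := pP (restr_k X) (restr_k Y) g f
  (iffLR (restr_linear _) lg) sg lf'.
exists h => // a x y; rewrite -[a]quotring_reprK.
have /= := lh (repr a) x y.
by rewrite -(indm_scaleE (X := P)).
Qed.

Lemma restr_fin (X : modcat Z) : fin X -> fin (restr_k X).
Proof.
move=> [n [e eE]]; exists n, e => x; have [c cE] := eE x.
exists (fun i => repr (c i)); rewrite [LHS]cE.
apply: eq_bigr => i _; rewrite -[in LHS](quotring_reprK (c i)) //.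
Qed.

Lemma ind_fin (X : modcat J) : fin X -> fin (ind_k X).
Proof.
move=> [n [e eE]]; exists n, e => x; have [c cE] := eE x.
exists (fun i => quotring_pi J (c i)); rewrite [LHS]cE.
by apply: eq_bigr => i _; rewrite -(indm_scaleE (X := X)).
Qed.

Lemma fin_dim_quotringP n : (fin_dim A <= Fin n)%EN <->
  forall m (X : modcat J), perf m X -> pd n X.
Proof.
have exR (K P X : modcat Z) : short K P X -> any X -> any K /\ short (restr_k K) (restr_k P) (restr_k X).
  by move=> S _; split=> //; exact: restr_short.
have exI (K P X : modcat J) : short K P X -> any X -> any K /\ short (ind_k K) (ind_k P) (ind_k X).
  by move=> S _; split=> //; exact: ind_short.
have fR (P : modcat Z) : fgp P -> fgp (restr_k P).
  by move=> [pP fP]; split; [exact: restr_proj | exact: restr_fin].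
have fI (P : modcat J) : fgp P -> fgp (ind_k P).
  by move=> [pP fP]; split; [exact: ind_proj | exact: ind_fin].
split=> [/fin_dimP H m X dX|H].
  apply: (gdim_retract (pd_theory _) (restr_ind X)).
  apply: (gdim_functor (F := @restr_k R J) (G := any) (@restr_proj)) => //.
    by move=> K P Y S _; exact: exR S.
  apply: H; apply: (gdim_functor (F := @ind_k R J) (G := any) fI) dX => //.
  by move=> K P Y S _; exact: exI S.
apply/fin_dimP => m X dX; apply: (gdim_retract (pd_theory _) (ind_restr X)).
apply: (gdim_functor (F := @ind_k R J) (G := any) (@ind_proj)) => //.
  by move=> K P Y S _; exact: exI S.
apply: H; apply: (gdim_functor (F := @restr_k R J) (G := any) fR) dX => //.
by move=> K P Y S _; exact: exR S.
Qed.

End Transfer.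

Section Flat.
Variable R : pzRingType.
Notation Zc := (zero_ideal R^c).

Lemma flat_of_tor1 (M : lmodType R^c) :
  (forall (N N' : lmodType R) (f : {linear N -> N'}), injective f ->
    forall x, tensor_map M f x = 0 -> x = 0) -> flat M.
Proof.
move=> H N N' f fi x y xy; apply/eqP; rewrite -subr_eq0; apply/eqP.
by apply: (H _ _ f fi); rewrite tensor_map_B xy subrr.
Qed.

Lemma flat_retract : retract_closed (@flatk R).
Proof.
move=> A B [i [r [li lr ri]]] fB; apply: flat_of_tor1 => N N' f fi x fx.
have [iN [iNB iNU]] := tensor_mapl N li; have [iN' [iN'B iN'U]] := tensor_mapl N' li.
have [rN [rNB rNU]] := tensor_mapl N lr.
have nat' : tensor_map (kmod_of B) f (iN x) = iN' (tensor_map (kmod_of A) f x).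
  apply: (tensor_ext (f := fun x => tensor_map (kmod_of B) f (iN x))
    (g := fun x => iN' (tensor_map (kmod_of A) f x))) => [p q|p q|m n].
  - by rewrite iNB tensor_map_B.
  - by rewrite tensor_map_B iN'B.
  - by rewrite iNU !tensor_map_pure iN'U.
have ix : iN x = 0.
  apply: (fB _ _ f fi); rewrite nat' fx (morphB0 iN'B).
  by rewrite (morphB0 (@tensor_map_B _ _ _ _ _)).
have <- : rN (iN x) = x; last by rewrite ix (morphB0 rNB).
apply: (tensor_ext (f := fun x => rN (iN x)) (g := id)) => [p q|//|m n].
  by rewrite iNB rNB.
by rewrite iNU rNU ri.
Qed.

Lemma zero_flat (M : modcat Zc) : is_zero M -> flatk M.
Proof.
move=> M0; apply: flat_of_tor1 => N N' f _ x _; elim/tensor_ind: x => //.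
  by move=> x y -> ->; rewrite subrr.
by move=> m n; rewrite (M0 m) pure0l.
Qed.

Lemma flat_dimP n (M : lmodType R^c) :
  (flat_dim M <= Fin n)%EN -> gdim any (@flatk R) (@flatk R) n (mod0 M).
Proof.
move=> /enat_inf_le[m mn [P [fP lP]]].
apply: (gdim_leq (self_cover zero_flat) mn).
exact: gdim_of_resolution flat_retract fP lP.
Qed.

End Flat.

(** * The bounds *)

Section FlatBound.
Variables (R : pzRingType) (I1 I2 : ideal R).
Hypothesis I1I2 : forall x : R, x \in I1 -> x \in I2 -> x = 0.
Notation Z := (zero_ideal R).

Lemma torfree_high_syzygy f n (X Y : modcat Z) :
  (flat_dim (quotient_rmod I2) <= Fin f)%EN -> perf n X -> syz f X Y ->
  torfree (ideal_sub I2 Z) Y.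
Proof.
move=> df dX s.
apply: (torfree_coind (D := fun Y => exists2 j, (f <= j)%N & syz j X Y /\ exists k, perf k Y)).
  move=> {s}{}Y [j fj [s [k dY]]]; split.
    apply: tor1_torfree.
    have dT := gdim_leq (self_cover (@zero_flat R)) fj (flat_dimP df).
    exact: (tor1_syz dT s).
  have [K [P [S fP dK]]] := perf_cov dY; exists K, P; split=> //; first by case: fP.
  exists j.+1; first exact: leqW.
  by split; [exact: syzS s S fP | exists k.-1].
exists f => //; split=> //; elim: s n dX => [W n dW|m W V K P _ IH S fP n dW].
  by exists n.
have [k dV] := IH _ dW; exists k.
exact: (gdim_syz (perf_theory _) S fP (gdimS (self_cover (@zero_fgp _)) dV)).
Qed.

Lemma fin_dim_le_flat s t f : (fin_dim (quotring I1) <= Fin s)%EN ->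
  (fin_dim (quotring I2) <= Fin t)%EN ->
  (flat_dim (quotient_rmod I2) <= Fin f)%EN ->
  (fin_dim R <= Fin (s + t + f))%EN.
Proof.
move=> /fin_dim_quotringP hs /fin_dim_quotringP ht hf.
apply/fin_dimP => n X dX; have [Y sY [m dY]] := perf_syz f dX.
have tY := torfree_high_syzygy hf dX sY.
rewrite addnC [(s + t)%N]addnC; apply: syz_pd sY _.
exact: (pd_le_milnor I1I2 dY tY hs ht).
Qed.
End FlatBound.

Section TorBounds.
Variables (R : pzRingType) (I1 I2 : ideal R).
Hypothesis I1I2 : forall x : R, x \in I1 -> x \in I2 -> x = 0.
Hypothesis Tor0 :
  forall (i : nat) (x : Tor i (ideal_rmod I2) (ideal_lmod I1)), x = 0.
Hypothesis S_res : has_finite_fgproj_res (quotient_lmod I1).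
Notation Z := (zero_ideal R).
Notation S := (kres (@zero_ideal_sub R I1) (regmod I1)).

Lemma S_perf : exists k, perf k S.
Proof.
have /perfP[k d] := S_res; exists k.
exact: gdim_retract (perf_theory _) _ _ _ (proj1 (mod0_retract S)) d.
Qed.

(** Tor_1(R/I2, R/I1) = 0 because I1 /\ I2 = 0, and the higher groups are those
of I1. *)
Lemma S_torfree : torfree (ideal_sub I2 Z) S.
Proof.
apply: (torfree_cokernel (ideal_short I1)) (torfree_of_Tor Tor0) (proj_torfree _ (proj1 (fgp_R R))).
apply: (torfree1_pres (ideal_ses I1) (proj1 (fgp_R R))) => x ix.
have -> : x = 0 :> ideal_lmod I1; last exact: imul0.
by apply: val_inj; apply: I1I2; [exact: (valP x) | exact: imul_regular].
Qed.

Lemma fin_dim_sum_quotient_le s t : (fin_dim (quotring I1) <= Fin s)%EN ->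
  (fin_dim (quotring I2) <= Fin t)%EN ->
  (fin_dim (quotring (ideal_add I1 I2)) <= Fin (s + t + 1))%EN.
Proof.
move=> /fin_dim_quotringP hs /fin_dim_quotringP ht.
apply/fin_dim_quotringP => n X dX; have [k dS] := S_perf.
rewrite addn1 [(s + t)%N]addnC -addnS.
exact: (pd_sum_quotient_ring I1I2 dS S_torfree dX hs ht).
Qed.

Lemma fin_dim_quotient_le r m p : (fin_dim R <= Fin r)%EN ->
  (fin_dim (quotring (ideal_add I1 I2)) <= Fin m)%EN ->
  (proj_dim (quotient_lmod I1) <= Fin p)%EN ->
  (fin_dim (quotring I1) <= Fin (r + m + p.+1))%EN.
Proof.
move=> /fin_dimP hr /fin_dim_quotringP hm /pdP hp.
apply/fin_dim_quotringP => n X dX; have [k dS] := S_perf.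
rewrite -addnA.
have dp : pd p S by exact: gdim_retract (pd_theory _) _ _ _ (proj1 (mod0_retract S)) hp.
exact: (pd_quotient_ring I1I2 dp dS S_torfree dX hr hm).
Qed.
End TorBounds.

Lemma enat_le_Infty x : (x <= Infty)%EN. Proof. by case: x. Qed.
Lemma enat_leW m x n : (x <= Fin m)%EN -> (m <= n)%N -> (x <= Fin n)%EN.
Proof. by case: x => //= k; exact: leq_trans. Qed.

Theorem corollary1p5 (R : pzRingType) (I1 I2 : ideal R)
  (I1I2 : forall x : R, x \in I1 -> x \in I2 -> x = 0) :
  (fin_dim R <= fin_dim (quotring I1) + fin_dim (quotring I2)
                + enat_max (Fin 1) (flat_dim (quotient_rmod I2)) + Fin 1)%EN
  /\
  ((forall (i : nat) (x : Tor i (ideal_rmod I2) (ideal_lmod I1)), x = 0) ->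
   has_finite_fgproj_res (quotient_lmod I1) ->
   (fin_dim (quotring (ideal_add I1 I2))
      <= fin_dim (quotring I1) + fin_dim (quotring I2) + Fin 1)%EN
   /\
   (fin_dim (quotring I1)
      <= fin_dim R + fin_dim (quotring (ideal_add I1 I2))
         + enat_max (Fin 1) (proj_dim (quotient_lmod I1)) + Fin 3)%EN).
Proof.
split=> [|Tor0 S_res]; last split.
- have := @fin_dim_le_flat R I1 I2 I1I2.
  case: (fin_dim (quotring I1)) => [s|]; last by move=> _; exact: enat_le_Infty.
  case: (fin_dim (quotring I2)) => [t|]; last by move=> _; exact: enat_le_Infty.
  case: (flat_dim _) => [f|]; last by move=> _; exact: enat_le_Infty.
  move=> /(_ s t f (leqnn s) (leqnn t) (leqnn f)) h.
  apply: enat_leW h _; apply: leq_trans (leq_addr _ _).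
  by rewrite leq_add2l leq_maxr.
- have := @fin_dim_sum_quotient_le R I1 I2 I1I2 Tor0 S_res.
  case: (fin_dim (quotring I1)) => [s|]; last by move=> _; exact: enat_le_Infty.
  case: (fin_dim (quotring I2)) => [t|]; last by move=> _; exact: enat_le_Infty.
  exact: (fun h => h s t (leqnn s) (leqnn t)).
- have := @fin_dim_quotient_le R I1 I2 I1I2 Tor0 S_res.
  case: (fin_dim R) => [r|]; last by move=> _; exact: enat_le_Infty.
  case: (fin_dim (quotring (ideal_add I1 I2))) => [m|]; last by move=> _; exact: enat_le_Infty.
  case: (proj_dim _) => [p|]; last by move=> _; exact: enat_le_Infty.
  move=> /(_ r m p (leqnn r) (leqnn m) (leqnn p)) h.
  apply: enat_leW h _; rewrite -[X in (_ <= X)%N]addnA leq_add2l -addn1.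
  by apply: leq_add => //; exact: leq_maxr.
Qed.
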